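(* There is no star product on the symplectic sphere $\mathbb{S}^2$ induced by a twist. That is, for any symplectic form $\omega$ on $\mathbb{S}^2$, no star product on $\mathbb{S}^2$ quantizing the Poisson bracket of $\omega$ is induced by a Drinfel'd twist of a finite-dimensional real Lie algebra.
   Context: For a finite-dimensional real Lie algebra $\mathfrak{g}$, $\mathcal{U}(\mathfrak{g})[[\hbar]]$ carries the $\hbar$-linear extension of the standard Hopf algebra structure $(\Delta,\epsilon,S)$ of the universal enveloping algebra. Twist: a (Drinfel'd) twist of $\mathfrak{g}$ is an element $\mathcal{F}\in(\mathcal{U}(\mathfrak{g})\otimes\mathcal{U}(\mathfrak{g}))[[\hbar]]$ with $\mathcal{F}=1\otimes 1+\sum_{k\ge 1}\hbar^k\mathcal{F}_k$, $(\mathcal{F}\otimes 1)(\Delta\otimes\mathrm{id})(\mathcal{F})=(1\otimes\mathcal{F})(\mathrm{id}\otimes\Delta)(\mathcal{F})$ and $(\epsilon\otimes\mathrm{id})\mathcal{F}=(\mathrm{id}\otimes\epsilon)\mathcal{F}=1$. Star product: a star product on a manifold $M$ is an associative $\mathbb{R}[[\hbar]]$-bilinear product on $C^\infty(M)[[\hbar]]$ of the form $f\star g=fg+\sum_{k\ge1}\hbar^kC_k(f,g)$ with bidifferential operators $C_k$ and with unit $1$; it quantizes the Poisson bracket $\{f,g\}=C_1(f,g)-C_1(g,f)$. Star product induced by a twist: $\star$ is induced by a twist $\mathcal{F}$ of $\mathfrak{g}$ if there is a Lie algebra homomorphism $\phi\colon\mathfrak{g}\to\Gamma^\infty(TM)$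 such that $f\star g=m(\mathcal{F}^{-1}\triangleright(f\otimes g))$ for all $f,g\in C^\infty(M)[[\hbar]]$, where $m$ is the pointwise multiplication and $\triangleright$ is the action of $\mathcal{U}(\mathfrak{g})[[\hbar]]$ on $C^\infty(M)[[\hbar]]$ extending $\xi\triangleright f=\phi(\xi)f$, $\xi\in\mathfrak{g}$. *)

(* Defs.v *)
From HB Require Import structures.
From mathcomp Require Import all_boot all_order all_algebra.
From mathcomp Require Import generic_quotient.
From mathcomp Require Import all_classical all_reals all_analysis.
From mathcomp Require Import ring lra.

Set Implicit Arguments.
Unset Strict Implicit.
Unset Printing Implicit Defensive.

Import Order.TTheory GRing.Theory Num.Theory.
Import numFieldNormedType.Exports.

Local Open Scope ring_scope.
Local Open Scope quotient_scope.

(* Every nonzero vector is sent to 1 by some linear functional. *)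
Lemma ex_functional (R : fieldType) (V : lmodType R) (v : V) :
  v != 0 -> exists phi : V -> R^o, linear phi /\ phi v = 1.
Proof.
move=> v0.
pose P (H : set V) :=
  (forall k x y, H x -> H y -> H (k *: x + y)) /\ ~ H v.
have [F FP Ftot|H [[Hl Hv] Hmax]] := @Zorn_bigcup V P.
  split=> [k x y [X FX Xx] [Y FY Yy]|[X FX Xv]]; last by have [_] := FP _ FX.
  have [XY|YX] := Ftot _ _ FX FY.
    by exists Y => //; have [h _] := FP _ FY; apply: h => //; exact: XY.
  by exists X => //; have [h _] := FP _ FX; apply: h => //; exact: YX.
have H0 : H 0.
  apply: contrapT => nH0.
  apply: (Hmax [set 0%R]%classic _ _).
    split; last by move=> /(_ 0 erefl).
    move=> x Hx; exfalso; apply: nH0.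
    by rewrite -(addNr x) -scaleN1r; exact: Hl.
  split=> [k x y -> ->|/= v00]; first by rewrite scaler0 addr0.
  by rewrite v00 eqxx in v0.
have exk a : exists k, H (a - k *: v).
  apply: contrapT => nk.
  apply: (Hmax [set x | exists h c, H h /\ x = h + c *: a]%classic _ _).
    split=> [x Hx|/(_ a) Ha]; first by exists x, 0; rewrite scale0r addr0.
    have {}Ha : H a by apply: Ha; exists 0, 1; rewrite scale1r add0r.
    by apply: nk; exists 0; rewrite scale0r subr0.
  split=> [k x y [h [c [Hh ->]]] [h' [c' [Hh' ->]]]|[h [c [Hh vE]]]].
    exists (k *: h + h'), (k * c + c'); split; first exact: Hl.
    by rewrite scalerDr scalerA scalerDl addrACA.
  have [c0|c0] := eqVneq c 0.
    by move: vE; rewrite c0 scale0r addr0 => vh; apply: Hv; rewrite vh.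
  apply: nk; exists c^-1; rewrite vE scalerDr scalerA mulVf // scale1r.
  by rewrite opprD addrCA subrr addr0 -scaleNr -[_ *: h]addr0; exact: Hl.
have [phi Hphi] := choice exk.
have uniq a k : H (a - k *: v) -> phi a = k.
  move=> Hk; apply/eqP; apply/negPn/negP => nek; apply: Hv.
  have d0 : phi a - k != 0 by rewrite subr_eq0.
  have /= := Hl (phi a - k)^-1 _ _
    (Hl (-1) _ _ (Hphi a) Hk) H0.
  rewrite scaleN1r opprB addrA subrK -scalerBl addr0 scalerA.
  by rewrite mulVf // scale1r.
exists phi; split.
  move=> k x y; apply: (uniq _ (k * phi x + phi y)).
  have -> : k *: x + y - (k * phi x + phi y) *: v =
    k *: (x - phi x *: v) + (y - phi y *: v).
    by rewrite scalerBr scalerDl opprD scalerA addrACA.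
  exact: Hl.
by apply: uniq; rewrite scale1r subrr.
Qed.

(* The algebra of linear endomorphisms, with composition as product. *)
Section Endo.
Variables (R : fieldType) (V : algType R).

Definition is_endo : {pred V -> V} := fun f => `[< linear f >].

Record endo := Endo {efun :> V -> V; _ : efun \in is_endo}.
HB.instance Definition _ := [isSub for efun].
HB.instance Definition _ := gen_eqMixin endo.
HB.instance Definition _ := gen_choiceMixin endo.

Let endo_submod : submod_closed is_endo.
Proof.
split=> [|k f g /asboolP fl /asboolP gl]; apply/asboolP => a u v /=.
  by rewrite scaler0 addr0.
change (k *: f (a *: u + v) + g (a *: u + v) =
        a *: (k *: f u + g u) + (k *: f v + g v)).
by rewrite fl gl !scalerDr !scalerA (mulrC k a) addrACA.
Qed.
HB.instance Definition _ := GRing.isSubmodClosed.Build R (V -> V) is_endo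
  endo_submod.
HB.instance Definition _ := [SubChoice_isSubLmodule of endo by <:].

Lemma endo_linear (f : endo) : linear f.
Proof. by case: f => f /= /asboolP. Qed.

Lemma endoP (f g : endo) : f =1 g -> f = g.
Proof. by move=> fg; apply: val_inj; apply/funext. Qed.

Lemma endo_addE (f g : endo) x : (f + g) x = f x + g x. Proof. by []. Qed.
Lemma endo_scaleE k (f : endo) x : (k *: f) x = k *: f x. Proof. by []. Qed.

Let id_endo : id \in is_endo. Proof. exact/asboolP. Qed.
Let comp_endo (f g : endo) : f \o g \in is_endo.
Proof. by apply/asboolP => a u v /=; rewrite !endo_linear. Qed.

Let one := Endo id_endo.
Let mul f g := Endo (comp_endo f g).

Let mulA : associative mul. Proof. by move=> f g h; exact: endoP. Qed.
Let mul1 : left_id one mul. Proof. by move=> f; exact: endoP. Qed.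
Let mulr1 : right_id one mul. Proof. by move=> f; exact: endoP. Qed.
Let mulDl : left_distributive mul +%R.
Proof. by move=> f g h; exact: endoP. Qed.
Let endoD (f : endo) x y : f (x + y) = f x + f y.
Proof. by have := endo_linear f 1 x y; rewrite !scale1r. Qed.
Let mulDr : right_distributive mul +%R.
Proof. by move=> f g h; apply: endoP => x; exact: endoD. Qed.
HB.instance Definition _ :=
  GRing.Zmodule_isPzRing.Build endo mulA mul1 mulr1 mulDl mulDr.
Let one_neq0 : 1 != 0 :> endo.
Proof.
apply/eqP => /(congr1 (fun f : endo => f 1)) /eqP.
by rewrite (_ : (0 : endo) 1 = 0) // oner_eq0.
Qed.
HB.instance Definition _ := GRing.PzSemiRing_isNonZero.Build endo one_neq0.

Lemma endo_mulE (f g : endo) x : (f * g) x = f (g x). Proof. by []. Qed.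

Let mulAl (k : R) (f g : endo) : k *: (f * g) = (k *: f) * g.
Proof. exact: endoP. Qed.
Let endoZ (f : endo) k x : f (k *: x) = k *: f x.
Proof.
have f0 : f 0 = 0 by apply: (addIr (f 0)); rewrite -endoD !add0r.
by have := endo_linear f k x 0; rewrite f0 !addr0.
Qed.
Let mulAr (k : R) (f g : endo) : k *: (f * g) = f * (k *: g).
Proof. by apply: endoP => x; rewrite endo_mulE !endo_scaleE endo_mulE endoZ. Qed.
HB.instance Definition _ := GRing.Lmodule_isLalgebra.Build R endo mulAl.
HB.instance Definition _ := GRing.Lalgebra_isAlgebra.Build R endo mulAr.
End Endo.

Section Lie.
Variables (R : fieldType) (g : lmodType R) (br : g -> g -> g).

Definition lie_bracket : Prop :=
  [/\ forall y, linear (br^~ y), forall x, linear (br x),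
      forall x, br x x = 0 &
      forall x y z, br x (br y z) + br y (br z x) + br z (br x y) = 0].

Definition lie_hom (A : algType R) (f : g -> A) : Prop :=
  linear f /\ forall x y, f (br x y) = f x * f y - f y * f x.

(* The counit extends the zero map. *)
Lemma lie_hom0 : lie_hom (fun=> 0 : R^o).
Proof.
by split=> [k x y|x y]; rewrite /= ?scaler0 ?mul0r ?subr0 ?addr0.
Qed.

End Lie.

(* The universal enveloping algebra of (g, br): noncommutative polynomial
   expressions in the elements of g, two of them being identified when they
   take the same value under every Lie algebra homomorphism from g to an
   associative algebra. *)
Section UEA.
Variables (R : fieldType) (g : lmodType R) (br : g -> g -> g).

Inductive uterm :=
  | UGen of g
  | UScal of R
  | UAdd of uterm & uterm
  | UMul of uterm & uterm.

HB.instance Definition _ := gen_eqMixin uterm.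
HB.instance Definition _ := gen_choiceMixin uterm.

Fixpoint uterm_eval (A : algType R) (f : g -> A) (t : uterm) : A :=
  match t with
  | UGen x => f x
  | UScal k => k *: 1
  | UAdd s t => uterm_eval f s + uterm_eval f t
  | UMul s t => uterm_eval f s * uterm_eval f t
  end.

Definition uterm_eq (s t : uterm) : bool :=
  `[< forall (A : algType R) (f : g -> A), lie_hom br f ->
      uterm_eval f s = uterm_eval f t >].

Let uterm_eq_refl : reflexive uterm_eq.
Proof. by move=> s; apply/asboolP. Qed.
Let uterm_eq_sym : symmetric uterm_eq.
Proof. by move=> s t; apply/asboolP/asboolP => e A f hf; rewrite e. Qed.
Let uterm_eq_trans : transitive uterm_eq.
Proof.
move=> t s r /asboolP e1 /asboolP e2; apply/asboolP => A f hf.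
by rewrite e1 ?e2.
Qed.

Canonical uterm_equiv :=
  EquivRel uterm_eq uterm_eq_refl uterm_eq_sym uterm_eq_trans.

Definition uea := {eq_quot uterm_equiv}.
HB.instance Definition _ := Choice.on uea.
HB.instance Definition _ := EqQuotient.on uea.

(* The extension of a Lie algebra homomorphism g -> A to U(g) -> A. *)
Definition uea_lift (A : algType R) (f : g -> A) (u : uea) : A :=
  uterm_eval f (repr u).

Lemma uea_lift_pi (A : algType R) (f : g -> A) t :
  lie_hom br f -> uea_lift f (\pi_uea t) = uterm_eval f t.
Proof.
move=> hf; have /eqquotP/asboolP e : repr (\pi_uea t) = t %[mod uea].
  by rewrite reprK.
exact: e.
Qed.

Lemma ueaP (u v : uea) :
  (forall (A : algType R) (f : g -> A), lie_hom br f ->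
     uea_lift f u = uea_lift f v) -> u = v.
Proof. by move=> e; rewrite -[u]reprK -[v]reprK; apply/eqquotP/asboolP. Qed.

Definition uea_gen (x : g) : uea := \pi_uea (UGen x).
Let scal (k : R) : uea := \pi_uea (UScal k).
Let add (u v : uea) : uea := \pi_uea (UAdd (repr u) (repr v)).
Let mul (u v : uea) : uea := \pi_uea (UMul (repr u) (repr v)).

Section Lift.
Variables (A : algType R) (f : g -> A) (hf : lie_hom br f).
Let lscal k : uea_lift f (scal k) = k *: 1. Proof. exact: uea_lift_pi. Qed.
Let ladd u v : uea_lift f (add u v) = uea_lift f u + uea_lift f v.
Proof. exact: uea_lift_pi. Qed.
Let lmul u v : uea_lift f (mul u v) = uea_lift f u * uea_lift f v.
Proof. exact: uea_lift_pi. Qed.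
Definition lE := (ladd, lmul, lscal).
End Lift.

Ltac by_lift :=
  let h := fresh in apply: ueaP => ? ? h; rewrite !(lE h).

Let addA : associative add.
Proof. by move=> u v w; by_lift; rewrite addrA. Qed.
Let addC : commutative add.
Proof. by move=> u v; by_lift; rewrite addrC. Qed.
Let add0 : left_id (scal 0) add.
Proof. by move=> u; by_lift; rewrite scale0r add0r. Qed.
Let addN : left_inverse (scal 0) (fun u => mul (scal (-1)) u) add.
Proof.
by move=> u; by_lift; rewrite -scalerAl mul1r scaleN1r addNr scale0r.
Qed.
HB.instance Definition _ := GRing.isZmodule.Build uea addA addC add0 addN.

Let mulA : associative mul.
Proof. by move=> u v w; by_lift; rewrite mulrA. Qed.
Let mul1u : left_id (scal 1) mul.
Proof. by move=> u; by_lift; rewrite scale1r mul1r. Qed.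
Let mulu1 : right_id (scal 1) mul.
Proof. by move=> u; by_lift; rewrite scale1r mulr1. Qed.
Let mulDl : left_distributive mul +%R.
Proof. by move=> u v w; by_lift; rewrite mulrDl. Qed.
Let mulDr : right_distributive mul +%R.
Proof. by move=> u v w; by_lift; rewrite mulrDr. Qed.
HB.instance Definition _ :=
  GRing.Zmodule_isPzRing.Build uea mulA mul1u mulu1 mulDl mulDr.
Let one_neq0 : 1 != 0 :> uea.
Proof.
apply/eqP => /(congr1 (uea_lift (fun=> 0 : R^o))).
by rewrite !(lE (lie_hom0 br)) scale0r scale1r => /eqP; rewrite oner_eq0.
Qed.
HB.instance Definition _ := GRing.PzSemiRing_isNonZero.Build uea one_neq0.

Let scale (k : R) (u : uea) : uea := mul (scal k) u.
Let scaleA a b u : scale a (scale b u) = scale (a * b) u.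
Proof. by by_lift; rewrite -!scalerAl !mul1r scalerA. Qed.
Let scale1 : left_id 1 scale.
Proof. by move=> u; by_lift; rewrite scale1r mul1r. Qed.
Let scaleDr : right_distributive scale +%R.
Proof. by move=> a u v; by_lift; rewrite mulrDr. Qed.
Let scaleDl u : {morph scale^~ u : a b / a + b}.
Proof. by move=> a b; by_lift; rewrite scalerDl mulrDl. Qed.
HB.instance Definition _ :=
  GRing.Zmodule_isLmodule.Build R uea scaleA scale1 scaleDr scaleDl.

Let mulAl (k : R) (u v : uea) : k *: (u * v) = (k *: u) * v.
Proof. by by_lift; rewrite mulrA. Qed.
Let mulAr (k : R) (u v : uea) : k *: (u * v) = u * (k *: v).
Proof. by by_lift; rewrite -!scalerAl !mul1r scalerAr. Qed.
HB.instance Definition _ := GRing.Lmodule_isLalgebra.Build R uea mulAl.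
HB.instance Definition _ := GRing.Lalgebra_isAlgebra.Build R uea mulAr.

Lemma uea_lift_gen (A : algType R) (f : g -> A) x :
  lie_hom br f -> uea_lift f (uea_gen x) = f x.
Proof. exact: uea_lift_pi. Qed.

Lemma uea_liftD (A : algType R) (f : g -> A) u v :
  lie_hom br f -> uea_lift f (u + v) = uea_lift f u + uea_lift f v.
Proof. exact: uea_lift_pi. Qed.

Lemma uea_liftM (A : algType R) (f : g -> A) u v :
  lie_hom br f -> uea_lift f (u * v) = uea_lift f u * uea_lift f v.
Proof. exact: uea_lift_pi. Qed.

Lemma uea_lift1 (A : algType R) (f : g -> A) :
  lie_hom br f -> uea_lift f 1 = 1.
Proof. by move=> hf; rewrite uea_lift_pi //= scale1r. Qed.

Lemma uea_liftZ (A : algType R) (f : g -> A) k u :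
  lie_hom br f -> uea_lift f (k *: u) = k *: uea_lift f u.
Proof. by move=> hf; rewrite !(lE hf) -scalerAl mul1r. Qed.

Lemma uea_gen_hom : lie_hom br uea_gen.
Proof.
split=> [k x y|x y]; apply: ueaP => A f hf.
  rewrite uea_liftD // uea_liftZ // !uea_lift_gen //.
  by case: hf => fl _; exact: fl.
rewrite uea_liftD // -scaleN1r uea_liftZ // !uea_liftM // !uea_lift_gen //.
by rewrite scaleN1r; case: hf.
Qed.

End UEA.

(* The tensor product: finite formal sums of pairs, two of them being
   identified when every bilinear map sends them to the same vector. *)
Section Tensor.
Variables (R : fieldType) (M N : lmodType R).

Definition bilin (W : lmodType R) (f : M -> N -> W) : Prop :=
  (forall y, linear (f^~ y)) /\ (forall x, linear (f x)).

Definition tterm : Type := seq (M * N).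
HB.instance Definition _ := Choice.on tterm.

Definition tterm_eval (W : zmodType) (f : M -> N -> W) (s : tterm) : W :=
  \sum_(p <- s) f p.1 p.2.

Definition tterm_eq (s t : tterm) : bool :=
  `[< forall (W : lmodType R) (f : M -> N -> W), bilin f ->
      tterm_eval f s = tterm_eval f t >].

Let tterm_eq_refl : reflexive tterm_eq.
Proof. by move=> s; apply/asboolP. Qed.
Let tterm_eq_sym : symmetric tterm_eq.
Proof. by move=> s t; apply/asboolP/asboolP => e W f hf; rewrite e. Qed.
Let tterm_eq_trans : transitive tterm_eq.
Proof.
move=> t s r /asboolP e1 /asboolP e2; apply/asboolP => W f hf.
by rewrite e1 ?e2.
Qed.

Canonical tterm_equiv :=
  EquivRel tterm_eq tterm_eq_refl tterm_eq_sym tterm_eq_trans.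

Definition tensor := {eq_quot tterm_equiv}.
HB.instance Definition _ := Choice.on tensor.
HB.instance Definition _ := EqQuotient.on tensor.

(* The linear map on the tensor product induced by a bilinear map. *)
Definition tlift (W : zmodType) (f : M -> N -> W) (t : tensor) : W :=
  tterm_eval f (repr t).

Lemma tlift_pi (W : lmodType R) (f : M -> N -> W) s :
  bilin f -> tlift f (\pi_tensor s) = tterm_eval f s.
Proof.
move=> hf; have /eqquotP/asboolP e : repr (\pi_tensor s) = s %[mod tensor].
  by rewrite reprK.
exact: e.
Qed.

Lemma tensorP (s t : tensor) :
  (forall (W : lmodType R) (f : M -> N -> W), bilin f ->
     tlift f s = tlift f t) -> s = t.
Proof. by move=> e; rewrite -[s]reprK -[t]reprK; apply/eqquotP/asboolP. Qed.

Definition tpure (x : M) (y : N) : tensor   := \pi_tensor [:: (x, y)].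

Let tscale (k : R) (t : tensor) : tensor :=
  \pi_tensor ([seq (k *: p.1, p.2) | p <- repr t] : tterm).
Let tadd (s t : tensor) : tensor := \pi_tensor (repr s ++ repr t : tterm).
Let tzero : tensor := \pi_tensor ([::] : tterm).

Lemma bilinZl (W : lmodType R) (f : M -> N -> W) k x y :
  bilin f -> f (k *: x) y = k *: f x y.
Proof.
case=> fl _; have f0 : f 0 y = 0.
  by apply: (addIr (f 0 y)); have := fl y 1 0 0; rewrite !scale1r !add0r => <-.
by have := fl y k x 0; rewrite f0 !addr0.
Qed.

Section LiftOps.
Variables (W : lmodType R) (f : M -> N -> W) (hf : bilin f).
Let l0 : tlift f tzero = 0.
Proof. by rewrite tlift_pi // /tterm_eval big_nil. Qed.
Let lD s t : tlift f (tadd s t) = tlift f s + tlift f t.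
Proof. by rewrite tlift_pi // /tterm_eval big_cat. Qed.
Let lZ k t : tlift f (tscale k t) = k *: tlift f t.
Proof.
rewrite tlift_pi // /tterm_eval big_map /= scaler_sumr.
by apply: eq_bigr => p _; exact: bilinZl.
Qed.
Definition tlE := (l0, lD, lZ).
End LiftOps.

Ltac by_tlift :=
  let h := fresh in apply: tensorP => ? ? h; rewrite !(tlE h).

Let taddA : associative tadd.
Proof. by move=> r s t; by_tlift; rewrite addrA. Qed.
Let taddC : commutative tadd.
Proof. by move=> s t; by_tlift; rewrite addrC. Qed.
Let tadd0 : left_id tzero tadd.
Proof. by move=> t; by_tlift; rewrite add0r. Qed.
Let taddN : left_inverse tzero (tscale (-1)) tadd.
Proof. by move=> t; by_tlift; rewrite scaleN1r addNr. Qed.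
HB.instance Definition _ :=
  GRing.isZmodule.Build tensor taddA taddC tadd0 taddN.

Let tscaleA a b t : tscale a (tscale b t) = tscale (a * b) t.
Proof. by by_tlift; rewrite scalerA. Qed.
Let tscale1 : left_id 1 tscale.
Proof. by move=> t; by_tlift; rewrite scale1r. Qed.
Let tscaleDr : right_distributive tscale +%R.
Proof. by move=> a s t; by_tlift; rewrite scalerDr. Qed.
Let tscaleDl t : {morph tscale^~ t : a b / a + b}.
Proof. by move=> a b; by_tlift; rewrite scalerDl. Qed.
HB.instance Definition _ :=
  GRing.Zmodule_isLmodule.Build R tensor tscaleA tscale1 tscaleDr tscaleDl.

Lemma tlift_linear (W : lmodType R) (f : M -> N -> W) :
  bilin f -> linear (tlift f).
Proof. by move=> hf k s t; rewrite !(tlE hf). Qed.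

Lemma tlift_pure (W : lmodType R) (f : M -> N -> W) x y :
  bilin f -> tlift f (tpure x y) = f x y.
Proof. by move=> hf; rewrite tlift_pi // /tterm_eval big_seq1. Qed.

Lemma tlift_linear_fun (W : lmodType R) (f h : M -> N -> W) k t :
  tlift (fun x y => k *: f x y + h x y) t = k *: tlift f t + tlift h t.
Proof. by rewrite /tlift /tterm_eval big_split /= scaler_sumr. Qed.

Lemma tpure_bilin : bilin tpure.
Proof.
split=> z k x y; apply: tensorP => W f hf;
  rewrite tlift_linear // !tlift_pure //.
  by case: hf => h _; exact: h.
by case: hf => _ h; exact: h.
Qed.

Lemma tensor_ind (P : tensor -> Prop) :
  P 0 -> (forall x y t, P t -> P (tpure x y + t)) -> forall t, P t.
Proof.
move=> P0 PS t; rewrite -[t]reprK; elim: (repr t) => [//|[x y] s IHs].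
suff -> : \pi_tensor ((x, y) :: s : tterm) =
          tpure x y + \pi_tensor s by exact: PS.
apply: tensorP => W f hf; rewrite (tlE hf) tlift_pure //.
by rewrite !tlift_pi // /tterm_eval big_cons.
Qed.

End Tensor.

Notation "x '\ox' y" := (tpure x y) (at level 38, left associativity).

Definition tmap (R : fieldType) (M N M' N' : lmodType R)
    (f : M -> M') (h : N -> N') : tensor M N -> tensor M' N' :=
  tlift (fun x y => f x \ox h y).

Definition tassoc (R : fieldType) (M N P : lmodType R) :
    tensor (tensor M N) P -> tensor M (tensor N P) :=
  tlift (fun s z => tlift (fun x y => x \ox (y \ox z)) s).

Section TensorAlgebra.
Variables (R : fieldType) (A B : algType R).

Let tmul (s t : tensor A B) : tensor A B :=
  tlift (fun a b => tlift (fun c d => (a * c) \ox (b * d)) t) s.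
Let tone : tensor A B := 1 \ox 1.

Let inner_bilin a b :
  bilin (fun (c : A) (d : B) => (a * c) \ox (b * d)).
Proof.
have [hl hr] := tpure_bilin A B.
split=> z k x y /=; rewrite mulrDr -scalerAr; [exact: hl|exact: hr].
Qed.

Let outer_bilin t : bilin (fun (a : A) (b : B) =>
  tlift (fun c d => (a * c) \ox (b * d)) t).
Proof.
have [hl hr] := tpure_bilin A B.
split=> z k x y /=; rewrite -tlift_linear_fun; congr (tlift _ _);
  apply/funext => c; apply/funext => d; rewrite mulrDl -scalerAl;
  [exact: hl|exact: hr].
Qed.

Let tmul_pure a b c d :
  tmul (a \ox b) (c \ox d) = (a * c) \ox (b * d).
Proof. by rewrite /tmul !tlift_pure. Qed.

Let tmulPl k s s' t : tmul (k *: s + s') t = k *: tmul s t + tmul s' t.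
Proof. by rewrite /tmul tlift_linear. Qed.

Let tmulPr k s t t' : tmul s (k *: t + t') = k *: tmul s t + tmul s t'.
Proof.
rewrite /tmul -tlift_linear_fun; congr (tlift _ _).
by apply/funext => a; apply/funext => b; rewrite tlift_linear.
Qed.

Let tmulDl : left_distributive tmul +%R.
Proof. by move=> s s' t; have := tmulPl 1 s s' t; rewrite !scale1r. Qed.
Let tmulDr : right_distributive tmul +%R.
Proof. by move=> s t t'; have := tmulPr 1 s t t'; rewrite !scale1r. Qed.
Let tmul0l t : tmul 0 t = 0.
Proof. by apply: (addIr (tmul 0 t)); rewrite -tmulDl !add0r. Qed.
Let tmul0r t : tmul t 0 = 0.
Proof. by apply: (addIr (tmul t 0)); rewrite -tmulDr !add0r. Qed.

Let tmulA : associative tmul.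
Proof.
move=> r s t; elim/tensor_ind: r => [|a b r IHr]; first by rewrite !tmul0l.
rewrite !tmulDl IHr {IHr}; congr (_ + _).
elim/tensor_ind: s => [|c d s IHs]; first by rewrite !(tmul0r, tmul0l).
rewrite tmulDr !tmulDl tmulDr IHs {IHs}; congr (_ + _).
elim/tensor_ind: t => [|e f t IHt]; first by rewrite !tmul0r.
by rewrite !tmulDr IHt !tmul_pure !mulrA.
Qed.

Let tmul1l : left_id tone tmul.
Proof.
elim/tensor_ind => [|a b t IHt]; first exact: tmul0r.
by rewrite tmulDr IHt tmul_pure !mul1r.
Qed.

Let tmul1r : right_id tone tmul.
Proof.
elim/tensor_ind => [|a b t IHt]; first exact: tmul0l.
by rewrite tmulDl IHt tmul_pure !mulr1.
Qed.

HB.instance Definition _ :=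
  GRing.Zmodule_isPzRing.Build (tensor A B) tmulA tmul1l tmul1r tmulDl tmulDr.

Let tone_neq0 : 1 != 0 :> tensor A B.
Proof.
have [phi [phil phi1]] := ex_functional (oner_neq0 A).
have [psi [psil psi1]] := ex_functional (oner_neq0 B).
have hf : bilin (fun a b => phi a * psi b : R^o).
  split=> z k x y /=; first by rewrite phil mulrDl scalerAl.
  by rewrite psil mulrDr scalerAr.
apply/eqP => /(congr1 (tlift (fun a b => phi a * psi b : R^o))).
rewrite [LHS]tlift_pure // phi1 psi1 mulr1 -[0](scale0r (0 : tensor A B)).
rewrite -[_ *: _]addr0 tlift_linear // scale0r add0r.
have := tlift_linear hf (-1) 0 0; rewrite scaler0 addr0 scaleN1r addNr => ->.
by apply/eqP; exact: oner_neq0.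
Qed.
HB.instance Definition _ :=
  GRing.PzSemiRing_isNonZero.Build (tensor A B) tone_neq0.

Let tscaleAl k (s t : tensor A B) : k *: (s * t) = (k *: s) * t.
Proof. by have := tmulPl k s 0 t; rewrite tmul0l !addr0. Qed.
Let tscaleAr k (s t : tensor A B) : k *: (s * t) = s * (k *: t).
Proof. by have := tmulPr k s t 0; rewrite tmul0r !addr0. Qed.
HB.instance Definition _ :=
  GRing.Lmodule_isLalgebra.Build R (tensor A B) tscaleAl.
HB.instance Definition _ :=
  GRing.Lalgebra_isAlgebra.Build R (tensor A B) tscaleAr.

Lemma tensor_oneE : 1 = 1 \ox 1 :> tensor A B. Proof. by []. Qed.

Lemma tensor_mul_pure (a c : A) (b d : B) :
  (a \ox b) * (c \ox d) = (a * c) \ox (b * d).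
Proof. exact: tmul_pure. Qed.

End TensorAlgebra.

(* Smooth real functions on R^n: all iterated partial derivatives exist and
   are continuous. *)
Section Smooth.
Variables (R : realType) (n : nat).

Definition partial (i : 'I_n) (f : 'rV[R]_n -> R) : 'rV[R]_n -> R :=
  fun x => 'D_(delta_mx 0 i) f x.

Fixpoint Ck (k : nat) (f : 'rV[R]_n -> R) : Prop :=
  continuous f /\
  if k is k'.+1 then
    forall i, (forall x, derivable f x (delta_mx 0 i)) /\ Ck k' (partial i f)
  else True.

Definition smooth (f : 'rV[R]_n -> R) : Prop := forall k, Ck k f.

Lemma CkW k f : Ck k.+1 f -> Ck k f.
Proof.
elim: k f => [|k IHk] f [fc fk]; split=> // i.
by have [df Df] := fk i; split=> //; exact: IHk.
Qed.

Lemma Ck_cst k (c : R) : Ck k (cst c).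
Proof.
elim: k c => [|k IHk] c; split=> //; try by move=> x; exact: cst_continuous.
move=> i; split=> [x|]; first exact: (derivable_cst c x _).
rewrite (_ : partial i (cst c) = cst 0) //.
by apply/funext => x; exact: derive_cst.
Qed.

Lemma CkD k f h : Ck k f -> Ck k h -> Ck k (f \+ h).
Proof.
elim: k f h => [|k IHk] f h [fc fk] [hc hk]; split=> //;
  try by move=> x; exact: (cvgD (fc x) (hc x)).
move=> i; have [df Df] := fk i; have [dh Dh] := hk i.
split=> [x|]; first exact: derivableD (df x) (dh x).
rewrite (_ : partial i (f \+ h) = partial i f \+ partial i h); first exact: IHk.
by apply/funext => x; exact: deriveD (df x) (dh x).
Qed.

Lemma CkM k f h : Ck k f -> Ck k h -> Ck k (f \* h).
Proof.
elim: k f h => [|k IHk] f h fk hk; split=> //;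
  try by move=> x; exact: (cvgM (fk.1 x) (hk.1 x)).
move=> i; have [_ /(_ i)[df Df]] := fk; have [_ /(_ i)[dh Dh]] := hk.
split=> [x|]; first exact: derivableM (df x) (dh x).
rewrite (_ : partial i (f \* h) =
    (f \* partial i h) \+ (h \* partial i f)); last first.
  by apply/funext => x; rewrite /partial; exact: deriveM (df x) (dh x).
by apply: CkD; apply: IHk => //; exact: CkW.
Qed.

End Smooth.

(* The unit sphere, with the atlas of the two stereographic projections:
   [stereo true] and [stereo false] are the inverses of the projections from
   the north pole (0,0,1) and from the south pole (0,0,-1). *)
Section Sphere.
Variable R : realType.

Definition sqnorm n (x : 'rV[R]_n) : R := \sum_i x 0 i ^+ 2.

Definition sphere : Type := {p : 'rV[R]_3 | sqnorm p == 1}.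

Definition stereo_vec (c : bool) (x : 'rV[R]_2) : 'rV[R]_3 :=
  (sqnorm x + 1)^-1 *:
  \row_(i < 3) [:: 2 * x 0 0; 2 * x 0 1; (-1) ^+ (~~ c) * (sqnorm x - 1)]`_i.

Lemma sqnorm_ge0 n (x : 'rV[R]_n) : 0 <= sqnorm x.
Proof. by apply: sumr_ge0 => i _; exact: sqr_ge0. Qed.

Lemma sqnormD1_neq0 n (x : 'rV[R]_n) : sqnorm x + 1 != 0.
Proof. by rewrite gt_eqF // ltr_wpDl // sqnorm_ge0. Qed.

Lemma sqnorm2 (x : 'rV[R]_2) : sqnorm x = x 0 0 ^+ 2 + x 0 1 ^+ 2.
Proof.
rewrite /sqnorm big_ord_recr big_ord1 /=.
by congr (x 0 _ ^+ 2 + x 0 _ ^+ 2); exact: val_inj.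
Qed.

Lemma stereo_subproof c x : sqnorm (stereo_vec c x) == 1.
Proof.
have c2 : ((-1) ^+ (~~ c) : R) ^+ 2 = 1 by rewrite sqrr_sign.
rewrite {1}/sqnorm !big_ord_recl big_ord0 !mxE /=.
apply/eqP; rewrite addr0 !exprMn c2 exprVn.
by move: (sqnormD1_neq0 x); rewrite sqnorm2 => s0; field.
Qed.

Definition stereo (c : bool) (x : 'rV[R]_2) : sphere :=
  exist _ (stereo_vec c x) (stereo_subproof c x).

(* The change of coordinates between the two charts, on R^2 minus 0. *)
Definition transition (x : 'rV[R]_2) : 'rV[R]_2 := (sqnorm x)^-1 *: x.

Lemma stereo_transition c x :
  x != 0 -> stereo (~~ c) (transition x) = stereo c x.
Proof.
move=> x0; have s0 : sqnorm x != 0.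
  apply: contra x0; rewrite psumr_eq0; last by move=> i _; exact: sqr_ge0.
  move=> /allP h; apply/eqP/rowP => i; rewrite mxE.
  by have := h i (mem_index_enum i); rewrite sqrf_eq0 => /eqP.
have s1 := sqnormD1_neq0 x.
have sT : sqnorm (transition x) = (sqnorm x)^-1.
  by rewrite [LHS]sqnorm2 !mxE !exprMn -mulrDr -sqnorm2; field.
apply: val_inj; apply/rowP => -[[|[|[|//]]] i3];
  rewrite /= /stereo_vec ?mxE /= ?mxE ?sT ?negbK.
- by field; rewrite s0 s1.
- by field; rewrite s0 s1.
- by case: c; rewrite /= ?expr0 ?expr1; field; rewrite s0 s1.
Qed.

Lemma stereo_surj (p : sphere) : exists c x, stereo c x = p.
Proof.
case: p => p p1; have := eqP p1.
rewrite {1}/sqnorm !big_ord_recl big_ord0 addr0 => pE.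
set a := p 0 _ in pE; set b := p 0 _ in pE; set z := p 0 _ in pE.
have [z1|z1] := eqVneq z 1.
  exists false, 0; apply: val_inj; apply/rowP.
  have [a0 b0] : a = 0 /\ b = 0.
    by move: pE; rewrite z1; split; nra.
  have s0 : sqnorm (0 : 'rV[R]_2) = 0 by rewrite sqnorm2 !mxE expr0n addr0.
  move=> [[|[|[|//]]] i3]; rewrite /= /stereo_vec ?mxE /= ?mxE ?s0.
  - by rewrite mulr0 mulr0 -[LHS]a0; congr (p 0 _); exact: val_inj.
  - by rewrite mulr0 mulr0 -[LHS]b0; congr (p 0 _); exact: val_inj.
  - rewrite expr1 mulN1r sub0r opprK add0r invr1 mulr1 -[LHS]z1.
    by congr (p 0 _); exact: val_inj.
have z1' : 1 - z != 0 by rewrite subr_eq0 eq_sym.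
exists true, (\row_j [:: a / (1 - z); b / (1 - z)]`_j).
apply: val_inj; apply/rowP.
have sE : sqnorm (\row_(j < 2) [:: a / (1 - z); b / (1 - z)]`_j) =
    (1 + z) / (1 - z).
  rewrite sqnorm2 !mxE /=; apply: (mulIf (expf_neq0 2 z1')).
  rewrite mulrDl -!exprMn !divfK // expr2 mulrA divfK //.
  have -> : a ^+ 2 + b ^+ 2 = 1 - z ^+ 2 by rewrite -pE addrA addrK.
  by ring.
have d0 : (1 + z) / (1 - z) + 1 = 2 / (1 - z) by field.
move=> [[|[|[|//]]] i3]; rewrite /= /stereo_vec ?mxE /= ?mxE /= sE d0.
- have -> : p 0 (Ordinal i3) = a by congr (p 0 _); exact: val_inj.
  by field.
- have -> : p 0 (Ordinal i3) = b by congr (p 0 _); exact: val_inj.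
  by field.
- have -> : p 0 (Ordinal i3) = z by congr (p 0 _); exact: val_inj.
  by rewrite expr0 mul1r; field.
Qed.

Definition smooth_sphere : {pred sphere -> R^o} :=
  fun f => `[< forall c, smooth (f \o stereo c) >].

(* The algebra of smooth functions on the sphere. *)
Record Csphere := Smooth_fun {sfun :> sphere -> R^o; _ : sfun \in smooth_sphere}.
HB.instance Definition _ := [isSub for sfun].
HB.instance Definition _ := [Choice of Csphere by <:].

Lemma Csphere_smooth (f : Csphere) c : smooth (f \o stereo c).
Proof. by case: f => f /= /asboolP. Qed.

Let smooth_submod : submod_closed smooth_sphere.
Proof.
split=> [|k f h /asboolP fs /asboolP hs]; apply/asboolP => c m.
  exact: Ck_cst.
exact: CkD (CkM (Ck_cst _ m k) (fs c m)) (hs c m).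
Qed.
HB.instance Definition _ :=
  GRing.isSubmodClosed.Build R (sphere -> R^o) smooth_sphere smooth_submod.
HB.instance Definition _ := [SubChoice_isSubLmodule of Csphere by <:].

Let smooth_subring : subring_closed smooth_sphere.
Proof.
split=> [|f h fs hs|f h /asboolP fs /asboolP hs].
- by apply/asboolP => c m; exact: Ck_cst.
- exact: rpredB.
- by apply/asboolP => c m; exact: CkM (fs c m) (hs c m).
Qed.
HB.instance Definition _ := GRing.SubZmodule_isSubPzRing.Build
  (sphere -> R^o) smooth_sphere Csphere smooth_subring.

Let one_neq0 : 1 != 0 :> Csphere.
Proof.
apply/eqP => /(congr1 (fun f : Csphere => f (stereo true 0))) /eqP.
by rewrite (_ : (0 : Csphere) _ = 0) // oner_eq0.
Qed.
HB.instance Definition _ := GRing.PzSemiRing_isNonZero.Build Csphere one_neq0.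

Let smulAl k (f h : Csphere) : k *: (f * h) = (k *: f) * h.
Proof. by apply: val_inj; apply/funext => p; exact: scalerAl. Qed.
Let smulAr k (f h : Csphere) : k *: (f * h) = f * (k *: h).
Proof. by apply: val_inj; apply/funext => p; exact: scalerAr. Qed.
HB.instance Definition _ := GRing.Lmodule_isLalgebra.Build R Csphere smulAl.
HB.instance Definition _ := GRing.Lalgebra_isAlgebra.Build R Csphere smulAr.

(* A vector field, identified with its action on functions: in each chart it
   is a_1 d/dx_1 + a_2 d/dx_2 with smooth coefficients. *)
Definition vector_field (X : endo Csphere) : Prop :=
  exists a : bool -> 'I_2 -> 'rV[R]_2 -> R,
    (forall c i, smooth (a c i)) /\
    forall f c x, X f (stereo c x) =
      \sum_i a c i x * partial i (f \o stereo c) x.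

Definition multi_partial N (al : 'I_N * 'I_N) (f : 'rV[R]_2 -> R) :=
  iter al.1 (partial 0) (iter al.2 (partial 1) f).

(* Bidifferential operators: in each chart a finite sum of products of partial
   derivatives of the two arguments, with smooth coefficients. *)
Definition bidiff_op (B : Csphere -> Csphere -> Csphere) : Prop :=
  exists N (a : bool -> 'I_N * 'I_N -> 'I_N * 'I_N -> 'rV[R]_2 -> R),
    (forall c al be, smooth (a c al be)) /\
    forall f h c x, B f h (stereo c x) =
      \sum_al \sum_be a c al be x * multi_partial al (f \o stereo c) x
                                  * multi_partial be (h \o stereo c) x.

(* A symplectic form, given in each chart by the matrix
   [form c x i j] = omega(d/dx_i, d/dx_j) at [stereo c x]. Vectors are row
   vectors, so the differential of [transition] is u |-> u *m jacobian. *)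
Record symplectic_form := SymplecticForm {
  form :> bool -> 'rV[R]_2 -> 'M[R]_2;
  form_smooth : forall c i j, smooth (fun x => form c x i j);
  form_alt : forall c x, (form c x)^T = - form c x;
  form_nondeg : forall c x, form c x \in unitmx;
  form_closed : forall c i j k x,
    partial i (fun y => form c y j k) x + partial j (fun y => form c y k i) x
    + partial k (fun y => form c y i j) x = 0;
  form_compat : forall x, x != 0 ->
    form true x = jacobian transition x *m form false (transition x)
                  *m (jacobian transition x)^T
}.

(* The Hamiltonian vector field of f in the chart c, as the row vector of its
   components: omega(X_f, -) = df. *)
Definition hamiltonian (om : symplectic_form) (f : Csphere) c x : 'rV[R]_2 :=
  (\row_i partial i (f \o stereo c) x) *m invmx (om c x).

(* {f, h} = omega(X_f, X_h) at the point [stereo c x]. *)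
Definition poisson (om : symplectic_form) (f h : Csphere) c x : R :=
  (hamiltonian om f c x *m om c x *m (hamiltonian om h c x)^T) 0 0.

End Sphere.

(* Formal power series with coefficients in A are sequences nat -> A. *)
Definition fps_cst (A : zmodType) (a : A) : nat -> A :=
  fun n => if n is 0 then a else 0.

Definition cauchy (A B C : zmodType) (op : A -> B -> C)
    (u : nat -> A) (v : nat -> B) : nat -> C :=
  fun n => \sum_(i < n.+1) op (u i) (v (n - i)%N).

Section StarProduct.
Variable R : realType.
Local Notation C := (Csphere R).

Definition star_coef (star : (nat -> C) -> (nat -> C) -> (nat -> C))
    (k : nat) (f h : C) : C := star (fps_cst f) (fps_cst h) k.

Record star_product (star : (nat -> C) -> (nat -> C) -> (nat -> C)) : Prop := {
  star_assoc : associative star;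
  star_Dl : left_distributive star +%R;
  star_Dr : right_distributive star +%R;
  star_Zl : forall (a : nat -> R) u v,
    star (cauchy *:%R a u) v = cauchy *:%R a (star u v);
  star_Zr : forall (a : nat -> R) u v,
    star u (cauchy *:%R a v) = cauchy *:%R a (star u v);
  star_1l : left_id (fps_cst 1) star;
  star_1r : right_id (fps_cst 1) star;
  star_coef0 : forall f h, star_coef star 0 f h = f * h;
  star_coefS : forall k, bidiff_op (star_coef star k.+1)
}.

Definition quantizes (om : symplectic_form R)
    (star : (nat -> C) -> (nat -> C) -> (nat -> C)) : Prop :=
  forall f h c x,
    (star_coef star 1 f h - star_coef star 1 h f) (stereo c x) =
    poisson om f h c x.

Variables (g : lmodType R) (br : g -> g -> g).
Local Notation U := (uea br).

Definition coproduct : U -> tensor U U :=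
  uea_lift (fun x => uea_gen br x \ox 1 + 1 \ox uea_gen br x).

Lemma coproduct_hom :
  lie_hom br (fun x => uea_gen br x \ox 1 + 1 \ox uea_gen br x).
Proof.
have addr_shuffle (V : zmodType) (a b c d e f : V) :
    a - b + (c - d) = a + e + (f + c) - (b + f + (e + d)).
  rewrite (addrACA b) opprD (addrACA (a + e)).
  by rewrite [b + e]addrC addrKA [f + c]addrC addrKA.
have [gl gb] := uea_gen_hom br; have [hl hr] := tpure_bilin U U.
split=> [k x y|x y] /=; first by rewrite gl hl hr scalerDr addrACA.
have hN (u v : U) : (u - v) \ox (1 : U) = u \ox 1 - v \ox 1.
  by rewrite addrC -scaleN1r hl scaleN1r addrC.
have hN' (u v : U) : (1 : U) \ox (u - v) = 1 \ox u - 1 \ox v.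
  by rewrite addrC -scaleN1r hr scaleN1r addrC.
rewrite !mulrDl !mulrDr !tensor_mul_pure !mul1r !mulr1 gb hN hN'.
exact: addr_shuffle.
Qed.

Definition counit : U -> R^o := uea_lift (fun=> 0 : R^o).

Record twist (F : nat -> tensor U U) : Prop := {
  twist0 : F 0 = 1 \ox 1;
  twist_cocycle :
    (@tassoc _ _ _ _) \o cauchy *%R (fun n => F n \ox (1 : U))
                                    (tmap coproduct id \o F) =
    cauchy *%R (fun n => (1 : U) \ox F n) (tmap id coproduct \o F);
  twist_counit_l : tlift (fun u v => counit u *: v) \o F = fps_cst 1;
  twist_counit_r : tlift (fun u v => counit v *: u) \o F = fps_cst 1
}.

(* The action of T in U(g) (x) U(g) on C (x) C, given that of U(g) on C. *)
Definition tensor_action (phi : g -> endo C) (T : tensor U U) :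
    tensor C C -> tensor C C :=
  tlift (fun u v => (tmap (uea_lift phi u) (uea_lift phi v)
                      : tensor C C -> tensor C C)) T.

Definition induced_by (F : nat -> tensor U U)
    (star : (nat -> C) -> (nat -> C) -> (nat -> C)) : Prop :=
  exists phi : g -> endo C,
    [/\ lie_hom br phi, forall x, vector_field (phi x) &
      exists Finv : nat -> tensor U U,
        [/\ cauchy *%R F Finv = fps_cst 1, cauchy *%R Finv F = fps_cst 1 &
          forall u v,
            star u v = tlift *%R \o cauchy (tensor_action phi) Finv
                                           (cauchy (@tpure _ C C) u v)]].

End StarProduct.

(* Main.v *)
Require Import Defs.
From mathcomp Require Import all_boot all_order all_algebra.
From mathcomp Require Import generic_quotient.
From mathcomp Require Import all_classical all_reals all_analysis.
From mathcomp Require Import ring lra.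

(** A twist F of g that induces a star product for a symplectic form on the
    sphere would produce a vector field without zeros.

    From the twist to a bivector field. Let r be the antisymmetrization of the
    first-order coefficient of F. The cocycle identity of F in order one says
    that both legs of r are primitive, so that r lies in g \ox g, and in order
    two that r solves the classical Yang-Baxter equation ([twist_rmatrix]).
    That primitive elements lie in g is read off from the second Adams
    operation, which multiplies the part of degree n of U(g) by 2 ^ n up to
    lower order ([primitive_first_leg]). The first-order commutator of the star
    product is minus the bivector field phi(r) ([star_commutator]); as it comes
    from a symplectic form, this bivector field has no zeros ([bivector_neq0]).

    From the bivector field to a flat connection. Contracting the first leg of
    r with the inverse of the bivector field phi(r) gives, with a suitable
    sign, a one-form theta with values in g such that phi(theta(X)) = X for
    every tangent vector X. On the trivial bundle with fibre g, the equation dS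
    = - [theta, S] is a connection, and the Yang-Baxter equation is its
    flatness ([connection_flat]). A chart is a plane, so it carries a parallel
    section with any given initial value ([parallel_section]).

    From the connection to a contradiction. For a parallel section S, the
    vector field phi(S) satisfies along every curve a linear equation in which
    S itself no longer occurs ([field_dx], [field_dy]): it vanishes nowhere if
    it does not vanish at one point ([field_zero]). The parallel sections of
    the two charts that agree at one point of the equator agree along it, where
    they solve the same linear equation ([parallel_agree_circle]). Over the two
    hemispheres they would therefore give a continuous vector field on the
    sphere without zeros. Such a field is excluded as follows. In both charts
    the equator is the unit circle, and the two expressions of the field at a
    unit vector u differ by the reflection in the line orthogonal to u
    ([vcoef_circle]), so that their product as complex numbers is a negative
    multiple of u ^ 2. It has winding number two around the circle, and no zero
    in the disc ([no_disc_extension]). *)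

Set Implicit Arguments.
Unset Strict Implicit.
Unset Printing Implicit Defensive.

Import Order.TTheory GRing.Theory Num.Theory.
Import numFieldNormedType.Exports.

Local Open Scope classical_set_scope.
Local Open Scope ring_scope.
Local Notation cauchy := Defs.cauchy.

(** * Multilinear maps and tensor products *)

Section LinearMaps.
Variables (R : fieldType) (M W : lmodType R).

Lemma lin_id0 (f : M -> W) : linear f -> f 0 = 0.
Proof.
move=> fl; have := fl (-1) 0 0.
by rewrite scaler0 addr0 scaleN1r addNr.
Qed.

Lemma lin_add (f : M -> W) x y : linear f -> f (x + y) = f x + f y.
Proof. by move=> fl; have := fl 1 x y; rewrite !scale1r. Qed.

Lemma lin_scale (f : M -> W) k x : linear f -> f (k *: x) = k *: f x.
Proof. by move=> fl; have := fl k x 0; rewrite (lin_id0 fl) !addr0. Qed.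

Lemma lin_sum (f : M -> W) (I : Type) (s : seq I) (F : I -> M) :
  linear f -> f (\sum_(i <- s) F i) = \sum_(i <- s) f (F i).
Proof.
move=> fl; elim: s => [|i s IHs]; first by rewrite !big_nil (lin_id0 fl).
by rewrite !big_cons (lin_add _ _ fl) IHs.
Qed.

Lemma lin_opp (f : M -> W) x : linear f -> f (- x) = - f x.
Proof. by move=> fl; rewrite -scaleN1r (lin_scale _ _ fl) scaleN1r. Qed.

Lemma lin_sub (f : M -> W) x y : linear f -> f (x - y) = f x - f y.
Proof. by move=> fl; rewrite (lin_add _ _ fl) (lin_opp _ fl). Qed.

End LinearMaps.

Section BilinearMaps.
Variables (R : fieldType) (M N W : lmodType R).

Lemma tensor_ext (f h : tensor M N -> W) :
  linear f -> linear h -> (forall x y, f (x \ox y) = h (x \ox y)) -> f =1 h.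
Proof.
move=> fl hl e; apply: tensor_ind => [|x y t IHt].
  by rewrite (lin_id0 fl) (lin_id0 hl).
by rewrite (lin_add _ _ fl) (lin_add _ _ hl) e IHt.
Qed.

End BilinearMaps.

Section TrilinearMaps.
Variables (R : fieldType) (M N P W : lmodType R).

Definition trilin (h : M -> N -> P -> W) : Prop :=
  [/\ forall y z, linear (fun x => h x y z),
      forall x z, linear (fun y => h x y z) & forall x y, linear (h x y)].

Definition tlift3 (h : M -> N -> P -> W) : tensor M (tensor N P) -> W :=
  tlift (fun x s => tlift (h x) s).

Lemma tlift3_bilin (h : M -> N -> P -> W) :
  trilin h -> bilin (fun x s => tlift (h x) s).
Proof.
case=> h1 h2 h3; split=> [s k x y|x] /=.
  rewrite -tlift_linear_fun; congr (tlift _ _).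
  by apply/funext => u; apply/funext => v; exact: h1.
by apply: tlift_linear; split=> [z|y]; [exact: h2|exact: h3].
Qed.

Lemma tlift3_linear (h : M -> N -> P -> W) : trilin h -> linear (tlift3 h).
Proof. by move=> hl; exact/tlift_linear/tlift3_bilin. Qed.

Lemma tlift3_pure (h : M -> N -> P -> W) x y z :
  trilin h -> tlift3 h (x \ox (y \ox z)) = h x y z.
Proof.
move=> hl; rewrite /tlift3 tlift_pure; last exact: tlift3_bilin.
by case: hl => _ h2 h3; rewrite tlift_pure.
Qed.

Lemma tensor3_ext (f h : tensor M (tensor N P) -> W) :
  linear f -> linear h ->
  (forall x y z, f (x \ox (y \ox z)) = h (x \ox (y \ox z))) -> f =1 h.
Proof.
move=> fl hl e; have [_ tl] := tpure_bilin M (tensor N P).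
apply: (tensor_ext fl hl) => x s; move: s.
apply: (@tensor_ext _ _ _ _ (fun s => f (x \ox s)) (fun s => h (x \ox s))) => //.
  by move=> k u v; rewrite tl fl.
by move=> k u v; rewrite tl hl.
Qed.

End TrilinearMaps.

Lemma tmap_bilin (R : fieldType) (M N M' N' : lmodType R)
    (f : M -> M') (h : N -> N') :
  linear f -> linear h -> bilin (fun x y => f x \ox h y).
Proof.
have [tl tr] := tpure_bilin M' N'.
by move=> fl hl; split=> [y|x] k u v /=; rewrite ?fl ?hl ?tl ?tr.
Qed.

Lemma linear_comp2 (R : fieldType) (M N P : lmodType R)
    (f : N -> P) (h : M -> N) : linear f -> linear h -> linear (f \o h).
Proof. by move=> fl hl k u v /=; rewrite hl fl. Qed.

Lemma linear_idfun (R : fieldType) (M : lmodType R) : linear (@id M).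
Proof. by []. Qed.

Section TensorCube.
Variables (R : fieldType) (A : algType R).
Local Notation T2 := (tensor A A).
Local Notation T3 := (tensor A (tensor A A)).

Lemma tpure3_trilin : trilin (fun x y z : A => x \ox (y \ox z)).
Proof.
have [l2 r2] := tpure_bilin A A; have [l3 r3] := tpure_bilin A T2.
by split=> [y z|x z|x y] k u v /=; rewrite ?l2 ?r2 ?l3 ?r3.
Qed.

Let tp3 := tpure3_trilin.

Definition flip : T2 -> T2 := tlift (fun x y => y \ox x).
Definition swap12 : T3 -> T3 := tlift3 (fun x y z => y \ox (x \ox z)).
Definition cycle3 : T3 -> T3 := tlift3 (fun x y z => z \ox (x \ox y)).

Lemma flip_bilin : bilin (fun x y : A => y \ox x).
Proof. by have [l r] := tpure_bilin A A; split. Qed.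

Lemma flip_linear : linear flip.
Proof. exact/tlift_linear/flip_bilin. Qed.

Lemma flip_pure x y : flip (x \ox y) = y \ox x.
Proof. by rewrite /flip tlift_pure //; exact: flip_bilin. Qed.

Lemma flipK : involutive flip.
Proof.
apply: (@tensor_ext _ _ _ _ (flip \o flip) id) => [|//|x y].
  exact: linear_comp2 flip_linear flip_linear.
by rewrite /= !flip_pure.
Qed.

Lemma swap12_trilin : trilin (fun x y z : A => y \ox (x \ox z)).
Proof. by case: tp3 => h1 h2 h3; split. Qed.

Lemma cycle3_trilin : trilin (fun x y z : A => z \ox (x \ox y)).
Proof. by case: tp3 => h1 h2 h3; split. Qed.

Lemma swap12_linear : linear swap12.
Proof. exact: tlift3_linear swap12_trilin. Qed.

Lemma cycle3_linear : linear cycle3.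
Proof. exact: tlift3_linear cycle3_trilin. Qed.

Lemma swap12_pure x y z : swap12 (x \ox (y \ox z)) = y \ox (x \ox z).
Proof. exact: tlift3_pure swap12_trilin. Qed.

Lemma cycle3_pure x y z : cycle3 (x \ox (y \ox z)) = z \ox (x \ox y).
Proof. exact: tlift3_pure cycle3_trilin. Qed.

Lemma cycle3K t : cycle3 (cycle3 (cycle3 t)) = t.
Proof.
move: t; apply: (@tensor3_ext _ _ _ _ _ (cycle3 \o (cycle3 \o cycle3)) id) => //.
  by do 2!apply: linear_comp2 cycle3_linear _; exact: cycle3_linear.
by move=> x y z; rewrite /= !cycle3_pure.
Qed.

Lemma swap12_cycle3 t : swap12 (cycle3 t) = cycle3 (cycle3 (swap12 t)).
Proof.
move: t; apply: (@tensor3_ext _ _ _ _ _ (swap12 \o cycle3)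
  (cycle3 \o (cycle3 \o swap12))).
- exact: linear_comp2 swap12_linear cycle3_linear.
- by do 2!apply: linear_comp2 cycle3_linear _; exact: swap12_linear.
by move=> x y z; rewrite /= ?(swap12_pure, cycle3_pure).
Qed.

Lemma linear_mull (B : algType R) (b : B) : linear (fun x => x * b).
Proof. by move=> k x y; rewrite mulrDl scalerAl. Qed.

Lemma linear_mulr (B : algType R) (b : B) : linear (fun x => b * x).
Proof. by move=> k x y; rewrite mulrDr scalerAr. Qed.

Lemma tensor_mul_ext (B C E : algType R) (f : tensor B C -> E) :
  linear f ->
  (forall x y x' y', f ((x \ox y) * (x' \ox y')) = f (x \ox y) * f (x' \ox y')) ->
  forall s t, f (s * t) = f s * f t.
Proof.
move=> fl e s t.
apply: (@tensor_ext _ _ _ _ (fun s => f (s * t)) (fun s => f s * f t)) => //.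
- exact: (linear_comp2 fl (linear_mull t)).
- exact: (linear_comp2 (linear_mull (f t)) fl).
move=> x y; apply: (@tensor_ext _ _ _ _ (fun t => f (x \ox y * t))
  (fun t => f (x \ox y) * f t)) => //.
- exact: (linear_comp2 fl (linear_mulr _)).
- exact: (linear_comp2 (linear_mulr _) fl).
Qed.

Lemma tensor3_mul_ext (f : T3 -> T3) : linear f ->
  (forall x y z x' y' z', f ((x \ox (y \ox z)) * (x' \ox (y' \ox z'))) =
     f (x \ox (y \ox z)) * f (x' \ox (y' \ox z'))) ->
  forall s t, f (s * t) = f s * f t.
Proof.
move=> fl e s t.
apply: (@tensor3_ext _ _ _ _ _ (fun s => f (s * t)) (fun s => f s * f t)) => //.
- exact: (linear_comp2 fl (linear_mull t)).
- exact: (linear_comp2 (linear_mull (f t)) fl).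
move=> x y z; apply: (@tensor3_ext _ _ _ _ _ (fun t => f (x \ox (y \ox z) * t))
  (fun t => f (x \ox (y \ox z)) * f t)) => //.
- exact: (linear_comp2 fl (linear_mulr _)).
- exact: (linear_comp2 (linear_mulr _) fl).
Qed.

Lemma swap12M s t : swap12 (s * t) = swap12 s * swap12 t.
Proof.
apply: tensor3_mul_ext; first exact: swap12_linear.
by move=> *; rewrite !(tensor_mul_pure, swap12_pure).
Qed.

Lemma cycle3M s t : cycle3 (s * t) = cycle3 s * cycle3 t.
Proof.
apply: tensor3_mul_ext; first exact: cycle3_linear.
by move=> *; rewrite !(tensor_mul_pure, cycle3_pure).
Qed.

Lemma tassoc_bilin : bilin (fun (s : T2) (z : A) =>
  tlift (fun x y : A => x \ox (y \ox z)) s : T3).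
Proof.
case: tp3 => h1 h2 h3; split=> [z|s k z z'] /=.
  by apply: tlift_linear; split=> [y|x]; [exact: h1|exact: h2].
rewrite -tlift_linear_fun; congr (tlift _ _).
by apply/funext => u; apply/funext => v; exact: h3.
Qed.

Lemma tassoc_linear : linear (@tassoc R A A A).
Proof. exact: tlift_linear tassoc_bilin. Qed.

Lemma tassoc_pure x y z : @tassoc R A A A ((x \ox y) \ox z) = x \ox (y \ox z).
Proof.
rewrite /tassoc tlift_pure; last exact: tassoc_bilin.
by case: tp3 => h1 h2 h3; rewrite tlift_pure.
Qed.

Lemma tassocM (s t : tensor T2 A) :
  @tassoc R A A A (s * t) = tassoc s * tassoc t.
Proof.
have [l2 r2] := tpure_bilin T2 A.
apply: tensor_mul_ext; first exact: tassoc_linear.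
move=> u z u' z'; move: u; apply: tensor_ext => [||x y].
- move=> k u v /=; rewrite [in LHS]l2 mulrDl -scalerAl tassoc_linear.
  by congr (_ *: _ + _).
- by move=> k u v /=; rewrite l2 tassoc_linear mulrDl -scalerAl.
move: u'; apply: tensor_ext => [||x' y'].
- by move=> k u v /=; rewrite [in LHS]l2 mulrDr -scalerAr tassoc_linear.
- by move=> k u v /=; rewrite l2 tassoc_linear mulrDr -scalerAr.
by rewrite !(tassoc_pure, tensor_mul_pure).
Qed.

End TensorCube.

(** * The coboundary calculus of a cocommutative coproduct *)

Section CocommutativeCoproduct.
Variables (R : fieldType) (U : algType R).
Local Notation T2 := (tensor U U).
Local Notation T3 := (tensor U (tensor U U)).
Variable D : U -> T2.
Hypotheses (Dl : linear D) (DC : forall u, flip (D u) = D u).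

(** The embeddings t_12, t_23, t_13 and the maps (D \ox id) t and (id \ox D) t,
    all with values in the tensor cube bracketed to the right. *)
Definition leg12 (t : T2) : T3 := tassoc (t \ox (1 : U)).
Definition leg23 (t : T2) : T3 := (1 : U) \ox t.
Definition leg13 (t : T2) : T3 := swap12 (leg23 t).
Definition cop12 (t : T2) : T3 := tassoc (tmap D id t).
Definition cop23 (t : T2) : T3 := tmap id D t.

Lemma leg12_pure x y : leg12 (x \ox y) = x \ox (y \ox 1).
Proof. exact: tassoc_pure. Qed.

Lemma leg23_pure x y : leg23 (x \ox y) = 1 \ox (x \ox y). Proof. by []. Qed.

Lemma leg13_pure x y : leg13 (x \ox y) = x \ox (1 \ox y).
Proof. exact: swap12_pure. Qed.

Lemma leg12_linear : linear leg12.
Proof.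
have [l _] := tpure_bilin T2 U.
exact: (linear_comp2 (@tassoc_linear R U) (l 1)).
Qed.

Lemma leg23_linear : linear leg23.
Proof. by have [_ r] := tpure_bilin U T2; exact: r. Qed.

Lemma leg13_linear : linear leg13.
Proof. exact: linear_comp2 (@swap12_linear _ _) leg23_linear. Qed.

Lemma cop12_linear : linear cop12.
Proof.
apply: linear_comp2 (@tassoc_linear _ _) _; apply: tlift_linear.
exact: tmap_bilin Dl (@linear_idfun _ _).
Qed.

Lemma cop23_linear : linear cop23.
Proof.
by apply: tlift_linear; exact: tmap_bilin (@linear_idfun _ _) Dl.
Qed.

Lemma cop12_pure x y : cop12 (x \ox y) = tassoc (D x \ox y).
Proof.
rewrite /cop12 /tmap tlift_pure //.
exact: tmap_bilin Dl (@linear_idfun _ _).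
Qed.

Lemma cop23_pure x y : cop23 (x \ox y) = x \ox D y.
Proof.
rewrite /cop23 /tmap tlift_pure //.
exact: tmap_bilin (@linear_idfun _ _) Dl.
Qed.

Lemma cycle3_leg12 t : cycle3 (leg12 t) = leg23 t.
Proof.
move: t; apply: (@tensor_ext _ _ _ _ (@cycle3 _ _ \o leg12)).
- exact: linear_comp2 (@cycle3_linear _ _) leg12_linear.
- exact: leg23_linear.
by move=> x y /=; rewrite leg12_pure cycle3_pure.
Qed.

Lemma swap12_leg12 t : swap12 (leg12 t) = leg12 (flip t).
Proof.
move: t; apply: (@tensor_ext _ _ _ _ (@swap12 _ _ \o leg12) (leg12 \o @flip _ _)).
- exact: linear_comp2 (@swap12_linear _ _) leg12_linear.
- exact: linear_comp2 leg12_linear (@flip_linear _ _).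
by move=> x y /=; rewrite flip_pure !leg12_pure swap12_pure.
Qed.

Lemma cycle3_leg13 t : cycle3 (leg13 t) = leg12 (flip t).
Proof.
move: t; apply: (@tensor_ext _ _ _ _ (@cycle3 _ _ \o leg13) (leg12 \o @flip _ _)).
- exact: linear_comp2 (@cycle3_linear _ _) leg13_linear.
- exact: linear_comp2 leg12_linear (@flip_linear _ _).
by move=> x y /=; rewrite flip_pure leg12_pure leg13_pure cycle3_pure.
Qed.

Lemma cycle3_leg23 t : cycle3 (leg23 t) = leg13 (flip t).
Proof.
move: t; apply: (@tensor_ext _ _ _ _ (@cycle3 _ _ \o leg23) (leg13 \o @flip _ _)).
- exact: linear_comp2 (@cycle3_linear _ _) leg23_linear.
- exact: linear_comp2 leg13_linear (@flip_linear _ _).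
by move=> x y /=; rewrite flip_pure leg23_pure leg13_pure cycle3_pure.
Qed.

Lemma swap12_tassoc (s : T2) (z : U) :
  swap12 (tassoc (s \ox z)) = tassoc (flip s \ox z).
Proof.
have [l _] := tpure_bilin T2 U.
move: s; apply: (@tensor_ext _ _ _ _ (fun s => swap12 (tassoc (s \ox z)))
    (fun s => tassoc (flip s \ox z))).
- exact: linear_comp2 (@swap12_linear R U)
    (linear_comp2 (@tassoc_linear R U) (l z)).
- exact: linear_comp2 (@tassoc_linear R U)
    (linear_comp2 (l z) (@flip_linear R U)).
by move=> x y; rewrite flip_pure !tassoc_pure swap12_pure.
Qed.

Lemma cycle3_tassoc (s : T2) (z : U) :
  cycle3 (tassoc (s \ox z)) = z \ox s.
Proof.
have [l _] := tpure_bilin T2 U; have [_ r] := tpure_bilin U T2.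
move: s; apply: (@tensor_ext _ _ _ _ (fun s => cycle3 (tassoc (s \ox z)))
    (fun s => z \ox s)).
- exact: linear_comp2 (@cycle3_linear R U)
    (linear_comp2 (@tassoc_linear R U) (l z)).
- exact: r.
by move=> x y; rewrite tassoc_pure cycle3_pure.
Qed.

Lemma swap12_cop12 t : swap12 (cop12 t) = cop12 t.
Proof.
move: t; apply: (@tensor_ext _ _ _ _ (@swap12 _ _ \o cop12)).
- exact: linear_comp2 (@swap12_linear _ _) cop12_linear.
- exact: cop12_linear.
by move=> x y /=; rewrite cop12_pure swap12_tassoc DC.
Qed.

Lemma cycle3_cop12 t : cycle3 (cop12 t) = cop23 (flip t).
Proof.
move: t; apply: (@tensor_ext _ _ _ _ (@cycle3 _ _ \o cop12) (cop23 \o @flip _ _)).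
- exact: linear_comp2 (@cycle3_linear _ _) cop12_linear.
- exact: linear_comp2 cop23_linear (@flip_linear _ _).
by move=> x y /=; rewrite cop12_pure cycle3_tassoc flip_pure cop23_pure.
Qed.

(** Only the even permutations of the legs occur; on differences t - swap12 t
    this is the antisymmetrization over all permutations. *)
Definition cyclic_sum (t : T3) : T3 := t + cycle3 t + cycle3 (cycle3 t).

Lemma cyclic_sum_linear : linear cyclic_sum.
Proof.
have cl := @cycle3_linear R U.
move=> k s t; rewrite /cyclic_sum !cl !scalerDr.
by rewrite [RHS]addrACA; congr (_ + _); exact: addrACA.
Qed.

Lemma cyclic_sum_cycle3 t : cyclic_sum (cycle3 t) = cyclic_sum t.
Proof. by rewrite /cyclic_sum cycle3K addrC addrA. Qed.

Section Cocycle.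
Variables B C : T2.
Hypothesis cocycle1 : cop12 B + leg12 B = cop23 B + leg23 B.
Hypothesis cocycle2 : cop12 C + leg12 B * cop12 B + leg12 C =
  cop23 C + leg23 B * cop23 B + leg23 C.

Let r : T2 := B - flip B.

Let fl := @flip_linear R U.
Let sl := @swap12_linear R U.
Let cl := @cycle3_linear R U.
Let l12 := leg12_linear.
Let l13 := leg13_linear.
Let l23 := leg23_linear.
Let c12 := cop12_linear.

Lemma cop12_flip t : cop12 (flip t) = cycle3 (cycle3 (cop23 t)).
Proof. by rewrite -[in RHS](flipK t) -cycle3_cop12 cycle3K. Qed.

(** The hypothesis on B is the cocycle identity of a twist in first order.
    Three of its images under permutations of the legs are combined so that, D
    being cocommutative, only the coproduct of r remains. *)
Lemma cop12_antisym : cop12 r = leg13 r + leg23 r.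
Proof.
(* K1 is the image of K2 under swap12, and K3 that of K1 - K2 under cycle3. *)
have K2 : cop12 B - cycle3 (cop12 (flip B)) = leg23 B - leg12 B.
  rewrite cycle3_cop12 flipK; apply/eqP.
  by rewrite subr_eq addrAC [leg23 B + _]addrC -cocycle1 addrK.
have K1 := congr1 (@swap12 _ _) K2.
rewrite !(lin_sub _ _ sl) swap12_cycle3 !swap12_cop12 in K1.
rewrite -[swap12 (leg23 B)]/(leg13 B) swap12_leg12 in K1.
have K3 := congr1 (@cycle3 _ _) (congr2 (fun a b => a - b) K1 K2).
rewrite !(lin_sub _ _ cl) !cycle3K !cycle3_leg12 !cycle3_leg13 in K3.
rewrite !cycle3_leg23 in K3.
rewrite /r (lin_sub _ _ c12) (lin_sub _ _ l13) (lin_sub _ _ l23).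
have -> : cop12 B - cop12 (flip B) =
  (cop12 B - cycle3 (cycle3 (cop12 (flip B)))) +
  (cycle3 (cop12 B) - cop12 (flip B) -
    (cycle3 (cop12 B) - cycle3 (cycle3 (cop12 (flip B))))).
  by rewrite [cycle3 _ - _]addrC addrKA opprK [- _ + _]addrC subrKA.
rewrite K1 K3 addrA subrKA opprB addrACA [RHS]addrACA.
by congr (_ + _); exact: addrC.
Qed.

Lemma cyclic_sum_swap_cycle3 t :
  cyclic_sum (swap12 (cycle3 t)) = cyclic_sum (swap12 t).
Proof. by rewrite swap12_cycle3 !cyclic_sum_cycle3. Qed.

(** By the cocycle identity in second order, the products of first-order terms
    on its two sides, L and Q, differ by the coboundary of C. The left-hand
    side is the antisymmetrization of L - Q, and antisymmetrized coboundaries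
    vanish because D is cocommutative. *)
Lemma cyclic_sum_leg12_cop12 : cyclic_sum (leg12 r * cop12 r) = 0.
Proof.
have nl := cyclic_sum_linear.
pose L := leg12 B * cop12 B; pose Q := leg23 B * cop23 B.
have E : leg12 r * cop12 r = L - cycle3 (cycle3 Q) -
    (swap12 L - swap12 (cycle3 (cycle3 Q))).
  rewrite /r (lin_sub _ _ l12) (lin_sub _ _ c12) mulrBl !mulrBr.
  have f1 : leg12 B * cop12 (flip B) = cycle3 (cycle3 Q).
    by rewrite !cycle3M -cop12_flip -cycle3_leg12 cycle3K.
  by rewrite -f1 -swap12_leg12 !swap12M !swap12_cop12.
have LQ : L = cop23 C + Q + leg23 C - leg12 C - cop12 C.
  by rewrite -cocycle2 addrK addrAC subrr add0r.
have sN x : cyclic_sum (- x) = - cyclic_sum x by exact: (lin_opp _ nl).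
have sD x y : cyclic_sum (x + y) = cyclic_sum x + cyclic_sum y.
  exact: (lin_add _ _ nl).
have tN x : swap12 (- x) = - swap12 x :> T3 by exact: (lin_opp _ sl).
have tD x y : swap12 (x + y) = swap12 x + swap12 y :> T3.
  exact: (lin_add _ _ sl).
have cop23E t : cop23 t = cycle3 (cop12 (flip t)).
  by rewrite cycle3_cop12 flipK.
rewrite E !(sD, sN) !cyclic_sum_swap_cycle3 !cyclic_sum_cycle3 LQ.
rewrite -cycle3_leg12 cop23E.
rewrite !(tD, tN, sD, sN) !cyclic_sum_swap_cycle3 !cyclic_sum_cycle3.
rewrite !swap12_cop12 !addrK !(addrAC _ (- cyclic_sum (cop12 C)) (- _)).
by rewrite !addrK subKr subrr.
Qed.
End Cocycle.
End CocommutativeCoproduct.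

(** * Tensors with primitive legs in the enveloping algebra *)

Section EnvelopingAlgebra.
Local Open Scope quotient_scope.
Variables (R : realType) (g : lmodType R) (br : g -> g -> g).
Local Notation U := (uea br).
Local Notation gen := (uea_gen br).
Local Notation T2 := (tensor U U).
Local Notation T3 := (tensor U (tensor U U)).

Lemma uea_lift_linear (A : algType R) (f : g -> A) :
  lie_hom br f -> linear (uea_lift f : U -> A).
Proof. by move=> hf k u v; rewrite uea_liftD // uea_liftZ. Qed.

Lemma uea_ind (P : U -> Prop) :
  P 1 -> (forall x, P (gen x)) ->
  (forall k u v, P u -> P v -> P (k *: u + v)) ->
  (forall u v, P u -> P v -> P (u * v)) -> forall u, P u.
Proof.
move=> P1 Pg Pl Pm u; have P0 : P 0 by rewrite -(addNr 1) -scaleN1r; exact: Pl.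
rewrite -[u]reprK; elim: (repr u) => {u} [x|k|s IHs t IHt|s IHs t IHt].
- exact: Pg.
- suff -> : \pi_U (UScal g k) = k *: 1 + 0 by exact: Pl.
  by apply: ueaP => A f hf; rewrite addr0 uea_liftZ // uea_lift1 // uea_lift_pi.
- suff -> : \pi_U (UAdd s t) = 1 *: \pi_U s + \pi_U t by exact: Pl.
  by apply: ueaP => A f hf; rewrite scale1r uea_liftD // !uea_lift_pi.
- suff -> : \pi_U (UMul s t) = \pi_U s * \pi_U t by exact: Pm.
  by apply: ueaP => A f hf; rewrite uea_liftM // !uea_lift_pi.
Qed.

Lemma coproduct_linear : linear (@coproduct R g br).
Proof. exact: uea_lift_linear (coproduct_hom br). Qed.

Lemma coproduct_gen x : @coproduct R g br (gen x) = gen x \ox 1 + 1 \ox gen x.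
Proof. exact: uea_lift_gen (coproduct_hom br). Qed.

Lemma coproductM u v : @coproduct R g br (u * v) = coproduct u * coproduct v.
Proof. exact: uea_liftM (coproduct_hom br). Qed.

Lemma coproduct1 : @coproduct R g br 1 = 1.
Proof. exact: uea_lift1 (coproduct_hom br). Qed.

Lemma flipM (s t : T2) : flip (s * t) = flip s * flip t.
Proof.
apply: tensor_mul_ext; first exact: flip_linear.
by move=> *; rewrite !(tensor_mul_pure, flip_pure).
Qed.

Lemma coproduct_cocomm u : flip (@coproduct R g br u) = coproduct u.
Proof.
have fl := @flip_linear R U.
elim/uea_ind: u => [|x|k u v IHu IHv|u v IHu IHv].
- by rewrite coproduct1 tensor_oneE flip_pure.
- by rewrite coproduct_gen (lin_add _ _ fl) !flip_pure addrC.
- by rewrite coproduct_linear fl IHu IHv.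
- by rewrite coproductM flipM IHu IHv.
Qed.

(** The standard filtration of U(g) by the degree of noncommutative polynomials
    in elements of g. *)
Inductive filt : nat -> U -> Prop :=
| filt_one : filt 0 1
| filt_lin n k u v : filt n u -> filt n v -> filt n (k *: u + v)
| filt_mulgen n u x : filt n u -> filt n.+1 (u * gen x)
| filt_succ n u : filt n u -> filt n.+1 u.

Lemma filt_leq m n u : (m <= n)%N -> filt m u -> filt n u.
Proof.
move=> /subnK <-; elim: (n - m)%N => [//|k IHk] fu; rewrite addSn.
exact/filt_succ/IHk.
Qed.

Lemma filt0 n : filt n 0.
Proof.
have f1 : filt n 1 by apply: (@filt_leq 0) => //; exact: filt_one.
by rewrite -(addNr 1) -scaleN1r; exact: filt_lin.
Qed.

Lemma filt_scale n k u : filt n u -> filt n (k *: u).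
Proof. by move=> fu; rewrite -[_ *: _]addr0; apply: filt_lin (filt0 n). Qed.

Lemma filt_add n u v : filt n u -> filt n v -> filt n (u + v).
Proof. by move=> fu fv; rewrite -[u]scale1r; exact: filt_lin. Qed.

Lemma filt_mul m n u v : filt m u -> filt n v -> filt (m + n) (u * v).
Proof.
move=> fu; elim=> {n v} [|n k v w _ IHv _ IHw|n v x _ IHv|n v _ IHv].
- by rewrite addn0 mulr1.
- by rewrite mulrDr -scalerAr; exact: filt_lin.
- by rewrite addnS mulrA; exact: filt_mulgen.
- by rewrite addnS; exact: filt_succ.
Qed.

Lemma filt_gen x : filt 1 (gen x).
Proof. by rewrite -[gen x]mul1r; exact/filt_mulgen/filt_one. Qed.

Lemma filt_exhaustive u : exists n, filt n u.
Proof.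
elim/uea_ind: u => [|x|k u v [m fu] [n fv]|u v [m fu] [n fv]].
- by exists 0; exact: filt_one.
- by exists 1%N; exact: filt_gen.
- exists (m + n)%N; apply: filt_lin.
    by apply: filt_leq fu; exact: leq_addr.
  by apply: filt_leq fv; exact: leq_addl.
- by exists (m + n)%N; exact: filt_mul.
Qed.

(** Moving a generator across a product of generators replaces, in each term,
    one generator by a bracket, which is again a generator. *)
Lemma filt_comm n u x : filt n u -> filt n (gen x * u - u * gen x).
Proof.
have [_ gl] := uea_gen_hom br.
elim=> {n u} [|n k u v _ IHu _ IHv|n u y fu IHu|n u _ IHu].
- by rewrite mul1r mulr1 subrr; exact: filt0.
- have -> : gen x * (k *: u + v) - (k *: u + v) * gen x =
      k *: (gen x * u - u * gen x) + (gen x * v - v * gen x).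
    by rewrite mulrDr mulrDl -scalerAr -scalerAl opprD addrACA -scalerBr.
  exact: filt_lin.
- have -> : gen x * (u * gen y) - u * gen y * gen x =
      (gen x * u - u * gen x) * gen y + u * gen (br x y).
    by rewrite gl mulrBr mulrBl !mulrA addrA subrK.
  by apply: filt_add; exact: filt_mulgen.
- exact: filt_succ.
Qed.

Lemma filt1P u : filt 1 u -> exists k x, u = k *: 1 + gen x.
Proof.
have [gl _] := uea_gen_hom br; have g0 := lin_id0 gl.
(* The step from degree 0 to degree 1 needs that no generator occurs in degree
   0. *)
suff h n : filt n u -> (n <= 1)%N ->
    exists k x, u = k *: 1 + gen x /\ (n = 0 -> x = 0).
  by move=> /h /(_ isT) [k [x [-> _]]]; exists k, x.
elim=> {n u} [|n k u v _ IHu _ IHv|n u y _ IHu|n u _ IHu] n1.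
- by exists 1, 0; rewrite scale1r g0 addr0.
- have [a [x [-> x0]]] := IHu n1; have [b [y [-> y0]]] := IHv n1.
  exists (k * a + b), (k *: x + y); rewrite gl scalerDl scalerDr scalerA.
  rewrite addrACA; split=> // n0.
  by rewrite x0 // y0 // scaler0 addr0.
- have [a [x [-> x0]]] := IHu (ltnW n1); exists 0, (a *: y); split=> //.
  have n0 : n = 0 by apply/eqP; rewrite -leqn0 -ltnS.
  rewrite (x0 n0).
  by rewrite g0 addr0 scale0r add0r (lin_scale _ _ gl) -scalerAl mul1r.
- have [a [x [-> x0]]] := IHu (ltnW n1); exists a, x; split=> //.
Qed.

Inductive tspan (P : U -> U -> Prop) : T2 -> Prop :=
| tspan0 : tspan P 0
| tspan_add a b t : P a b -> tspan P t -> tspan P (a \ox b + t).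

Lemma tspanD P s t : tspan P s -> tspan P t -> tspan P (s + t).
Proof.
move=> Ps Pt; elim: Ps => [|a b s' ab _ IH]; first by rewrite add0r.
by rewrite -addrA; exact: tspan_add.
Qed.

Lemma tspan_pure P a b : P a b -> tspan P (a \ox b).
Proof. by move=> ab; rewrite -[_ \ox _]addr0; exact: tspan_add (tspan0 P). Qed.

Lemma tspan_map (P : U -> U -> Prop) (Q : T2 -> Prop) (f : T2 -> T2) :
  linear f -> Q 0 -> (forall s t, Q s -> Q t -> Q (s + t)) ->
  (forall a b, P a b -> Q (f (a \ox b))) -> forall t, tspan P t -> Q (f t).
Proof.
move=> fl Q0 QD Pf t; elim=> [|a b s ab _ IH]; first by rewrite (lin_id0 fl).
by rewrite (lin_add _ _ fl); apply: QD => //; exact: Pf.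
Qed.

(** The second Adams operation of U(g): on the part of degree n it is 2 ^ n up
    to lower order, which separates the degrees. *)
Definition adams (u : U) : U := tlift (fun a b => a * b) (coproduct u).

Lemma mul_bilin (A : algType R) : bilin (fun a b : A => a * b).
Proof. by split=> z; [exact: linear_mull|exact: linear_mulr]. Qed.

Lemma adams_linear : linear adams.
Proof. exact: (linear_comp2 (tlift_linear (mul_bilin U)) coproduct_linear). Qed.

Definition bifilt n (a b : U) : Prop :=
  exists i j, [/\ filt i a, filt j b & (i + j <= n)%N].

Lemma bifilt_scale n k t : tspan (bifilt n) t -> tspan (bifilt n) (k *: t).
Proof.
have [tl _] := tpure_bilin U U.
apply: (tspan_map (f := fun t => k *: t)) => [|||a b [i [j [fa fb le]]]].
- by move=> a u v; rewrite scalerDr !scalerA mulrC.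
- exact: tspan0.
- exact: tspanD.
- rewrite -(lin_scale _ _ (tl b)); apply: tspan_pure; exists i, j; split=> //.
  exact: filt_scale.
Qed.

Lemma coproduct_filt n u : filt n u -> tspan (bifilt n) (coproduct u).
Proof.
elim=> {n u} [|n k u v _ IHu _ IHv|n u x _ IHu|n u _ IHu].
- rewrite coproduct1 tensor_oneE; apply: tspan_pure; exists 0, 0.
  by split=> //; exact: filt_one.
- by rewrite coproduct_linear; apply: tspanD => //; exact: bifilt_scale.
- rewrite coproductM coproduct_gen.
  move: IHu; apply: (tspan_map (f := fun t => t * _));
    [exact: linear_mull|exact: tspan0|exact: tspanD|].
  move=> a b [i [j [fa fb le]]]; rewrite mulrDr !tensor_mul_pure !mulr1.
  apply: tspanD; apply: tspan_pure.
    by exists i.+1, j; split=> //; exact: filt_mulgen.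
  by exists i, j.+1; rewrite addnS; split=> //; exact: filt_mulgen.
- move: IHu; apply: (tspan_map (f := id)) => //; [exact: tspan0|exact: tspanD|].
  move=> a b [i [j [fa fb le]]]; apply: tspan_pure; exists i, j.
  by split=> //; exact: leqW.
Qed.

Lemma mul_comm_bilin x : bilin (fun a b : U => a * (gen x * b - b * gen x)).
Proof.
split=> [b|a]; first exact: linear_mull.
apply: (linear_comp2 (linear_mulr a)) => k b c.
by rewrite mulrDr mulrDl -scalerAr -scalerAl opprD addrACA -scalerBr.
Qed.

(** In the product of the legs of coproduct u * coproduct x, the factor x
    stands either at the end or between the legs; in the second case it is
    moved to the end at the cost of a commutator. *)
Lemma adams_mulgen u x : adams (u * gen x) =
  2 *: (adams u * gen x)
  + tlift (fun a b => a * (gen x * b - b * gen x)) (coproduct u).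
Proof.
have hb := mul_comm_bilin x.
rewrite /adams coproductM coproduct_gen; move: (coproduct u).
apply: (@tensor_ext _ _ _ _
  (fun t => tlift *%R (t * (gen x \ox 1 + 1 \ox gen x)))
  (fun t => 2 *: (tlift *%R t * gen x) +
     tlift (fun a b => a * (gen x * b - b * gen x)) t)).
- exact: linear_comp2 (tlift_linear (mul_bilin U)) (linear_mull _).
- move=> k s t; rewrite !(tlift_linear (mul_bilin U)) (tlift_linear hb).
  by rewrite mulrDl -scalerAl !scalerDr addrACA !scalerA mulrC.
move=> a b; rewrite mulrDr !tensor_mul_pure !mulr1.
rewrite (lin_add _ _ (tlift_linear (mul_bilin U))).
rewrite !(tlift_pure _ _ (mul_bilin U)) (tlift_pure _ _ hb).
by rewrite scaler_nat mulr2n mulrBr !mulrA [_ * b - _]addrC addrA addrK addrC.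
Qed.

Lemma adams_filt n u : filt n u ->
  if n is m.+1 then filt m (adams u - 2 ^+ n *: u) else adams u = u.
Proof.
elim=> {n u} [|n k u v _ IHu _ IHv|n u x fu IHu|n u fu IHu].
- by rewrite /adams coproduct1 tensor_oneE (tlift_pure _ _ (mul_bilin U)) mulr1.
- case: n IHu IHv => [|n] IHu IHv; first by rewrite adams_linear IHu IHv.
  have -> : adams (k *: u + v) - 2 ^+ n.+1 *: (k *: u + v) =
      k *: (adams u - 2 ^+ n.+1 *: u) + (adams v - 2 ^+ n.+1 *: v).
    rewrite adams_linear scalerDr opprD addrACA scalerBr !scalerA.
    by rewrite (mulrC k).
  exact: filt_lin.
- rewrite adams_mulgen addrAC; apply: filt_add.
    rewrite exprS -scalerA -scalerBr; apply: filt_scale.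
    rewrite scalerAl -mulrBl; case: n fu IHu => [|n] fu IHu.
      by rewrite IHu expr0 scale1r subrr mul0r; exact: filt0.
    exact: filt_mulgen.
  have hb := mul_comm_bilin x; have hl := tlift_linear hb.
  elim: (coproduct_filt fu) => [|a b t [i [j [fa fb le]]] _ IH].
    by rewrite (lin_id0 hl); exact: filt0.
  rewrite (lin_add _ _ hl) (tlift_pure _ _ hb); apply: filt_add => //.
  by apply: filt_leq le _; apply: filt_mul => //; exact: filt_comm.
- rewrite -scaleNr addrC; apply: filt_lin => //.
  case: n fu IHu => [|n] fu IHu; first by rewrite IHu.
  rewrite -[adams u](subrK (2 ^+ n.+1 *: u)).
  by apply: filt_add; [exact: filt_succ|exact: filt_scale].
Qed.

(** On first legs of degree n.+2 the Adams operation is 2 ^ n.+2 up to lower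
    order, while it is 2 on t; as these differ, t has no such part. Q
    constrains the second legs, which the operation leaves alone. *)
Lemma primitive_descent (Q : U -> Prop) n t :
  tmap adams id t = 2 *: t -> tspan (fun a b => filt n.+2 a /\ Q b) t ->
  tspan (fun a b => filt n.+1 a /\ Q b) t.
Proof.
have [tl _] := tpure_bilin U U.
have al := tmap_bilin adams_linear (@linear_idfun _ U).
have aL : linear (tmap adams (@id U)) by exact: tlift_linear.
(* f fixes t and lowers the degree of the first legs. *)
move=> t2 st; pose k : R := 2 - 2 ^+ n.+2.
have k0 : k != 0.
  by rewrite subr_eq0 lt_eqF // -[ltLHS]expr1 ltr_eXn2l // ltr1n.
pose f (s : T2) : T2 := k^-1 *: (tmap adams id s - 2 ^+ n.+2 *: s).
have ft : f t = t.
  by rewrite /f t2 -scalerBl -/k scalerA mulVf // scale1r.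
suff : tspan (fun a b => filt n.+1 a /\ Q b) (f t) by rewrite ft.
move: st; apply: (tspan_map (f := f)) => [|||a b [fa Qb]].
- move=> a u v; rewrite /f aL (scalerDr (2 ^+ _)) opprD addrACA.
  rewrite (scalerA (2 ^+ _)) (mulrC _ a) -(scalerA a) -scalerBr.
  by rewrite scalerDr scalerA mulrC -scalerA.
- exact: tspan0.
- exact: tspanD.
rewrite /f /tmap (tlift_pure _ _ al) -(lin_scale _ _ (tl b)).
rewrite -(lin_sub _ _ (tl b)) -(lin_scale _ _ (tl b)).
apply: tspan_pure; split=> //; apply: filt_scale; exact: (adams_filt fa).
Qed.

Lemma counit_linear : linear (@counit R g br).
Proof. exact: uea_lift_linear (lie_hom0 br). Qed.

Lemma counit_gen x : @counit R g br (gen x) = 0.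
Proof. exact: uea_lift_gen (lie_hom0 br). Qed.

Lemma counit1 : @counit R g br 1 = 1.
Proof. exact: uea_lift1 (lie_hom0 br). Qed.

Lemma counit_bilin : bilin (fun u v : U => counit u *: v).
Proof.
split=> [v|u] k a b /=.
  by rewrite counit_linear scalerDl scalerA.
by rewrite scalerDr !scalerA mulrC.
Qed.

Definition is_gen (u : U) : Prop := exists x, u = gen x.

(** The descent brings the first legs into the span of 1 and g; the counit
    condition removes the multiples of 1. *)
Lemma primitive_first_leg (Q : U -> Prop) t :
  tmap adams id t = 2 *: t -> tlift (fun u v => counit u *: v) t = 0 ->
  tspan (fun _ b => Q b) t -> tspan (fun a b => is_gen a /\ Q b) t.
Proof.
move=> t2 t0 st.
have [n {}st] : exists n, tspan (fun a b => filt n a /\ Q b) t.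
  elim: st => [|a b s Qb _ [n IH]]; first by exists 0; exact: tspan0.
  have [m fa] := filt_exhaustive a; exists (m + n)%N; apply: tspan_add.
    by split=> //; apply: filt_leq fa; exact: leq_addr.
  move: IH; apply: (tspan_map (f := id)) => //;
    [exact: tspan0|exact: tspanD|move=> a' b' [fa' Qb']].
  by apply: tspan_pure; split=> //; apply: filt_leq fa'; exact: leq_addl.
have {}st : tspan (fun a b => filt n.+1 a /\ Q b) t.
  move: st; apply: (tspan_map (f := id)) => //;
    [exact: tspan0|exact: tspanD|move=> a b [fa Qb]].
  by apply: tspan_pure; split=> //; exact: filt_succ.
have {n} {}st : tspan (fun a b => filt 1 a /\ Q b) t.
  elim: n st => [//|n IHn] st; apply: IHn; exact: primitive_descent.
have [tl tr] := tpure_bilin U U; have [gl _] := uea_gen_hom br.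
have cl := tlift_linear counit_bilin.
(* f fixes t and subtracts from each first leg its multiple of 1. *)
pose f (s : T2) : T2 := s - 1 \ox tlift (fun u v => counit u *: v) s.
have ft : f t = t by rewrite /f t0 (lin_id0 (tr 1)) subr0.
suff : tspan (fun a b => is_gen a /\ Q b) (f t) by rewrite ft.
move: st; apply: (tspan_map (f := f)) => [|||a b [/filt1P [k [x ->]] Qb]].
- move=> k u v; rewrite /f cl tr opprD addrACA.
  by rewrite scalerBr.
- exact: tspan0.
- exact: tspanD.
have ek : counit (k *: 1 + gen x) = k.
  by rewrite counit_linear counit1 counit_gen addr0; exact: mulr1.
have e1 : (k *: 1 + gen x) \ox b = k *: (1 \ox b) + gen x \ox b := tl b k 1 _.
have e2 : 1 \ox (k *: b) = k *: (1 \ox b) := lin_scale k b (tr 1).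
rewrite /f (tlift_pure _ _ counit_bilin) ek e1 e2 addrAC subrr add0r.
by apply: tspan_pure; split=> //; exists x.
Qed.

End EnvelopingAlgebra.

(** * The classical r-matrix of a twist *)

Section RMatrix.
Variables (R : realType) (g : lmodType R) (br : g -> g -> g).
Local Notation U := (uea br).
Local Notation gen := (uea_gen br).
Local Notation T2 := (tensor U U).
Local Notation T3 := (tensor U (tensor U U)).
Local Notation D := (@coproduct R g br).
Local Notation Dl := (@coproduct_linear R g br).
Local Notation DC := (@coproduct_cocomm R g br).

Lemma mul_legs_trilin : trilin (fun x y z : U => (x * y) \ox z).
Proof.
have [tl tr] := tpure_bilin U U.
split=> [y z|x z|x y].
- exact: linear_comp2 (tl z) (linear_mull y).
- exact: linear_comp2 (tl z) (linear_mulr x).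
- exact: tr.
Qed.

(** Multiplying the first two legs turns (D \ox id) t into the Adams operation
    on the first leg of t, and both t_13 and t_23 into t. *)
Lemma primitive_adams (t : T2) :
  cop12 D t = leg13 t + leg23 t -> tmap (@adams R g br) id t = 2 *: t.
Proof.
have ml := tlift3_linear mul_legs_trilin.
have mp x y z := tlift3_pure x y z mul_legs_trilin.
set m := tlift3 _ in ml mp.
have [tl tr] := tpure_bilin U U.
have al := tmap_bilin (@adams_linear R g br) (@linear_idfun _ U).
have adamsE s : m (cop12 D s) = tmap (@adams R g br) id s.
  move: s; apply: (@tensor_ext _ _ _ _ (m \o cop12 D)).
  - exact: linear_comp2 ml (cop12_linear Dl).
  - exact: tlift_linear al.
  move=> x y; rewrite /= (cop12_pure Dl) /tmap (tlift_pure _ _ al) /adams /=.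
  move: (D x); apply: (@tensor_ext _ _ _ _ (fun s => m (tassoc (s \ox y)))
    (fun s => tlift *%R s \ox y)).
  - have [l _] := tpure_bilin T2 U.
    exact: linear_comp2 ml (linear_comp2 (@tassoc_linear _ U) (l y)).
  - exact: linear_comp2 (tl y) (tlift_linear (mul_bilin U)).
  by move=> a b; rewrite tassoc_pure mp (tlift_pure _ _ (mul_bilin U)).
have leg13E s : m (leg13 s) = s.
  move: s; apply: (@tensor_ext _ _ _ _ (m \o @leg13 _ U) id) => //.
    exact: linear_comp2 ml (@leg13_linear _ U).
  by move=> x y; rewrite /= leg13_pure mp mulr1.
have leg23E s : m (leg23 s) = s.
  move: s; apply: (@tensor_ext _ _ _ _ (m \o @leg23 _ U) id) => //.
    exact: linear_comp2 ml (@leg23_linear _ U).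
  by move=> x y; rewrite /= leg23_pure mp mul1r.
move=> /(congr1 m); rewrite adamsE (lin_add _ _ ml) leg13E leg23E => ->.
by rewrite scaler_nat mulr2n.
Qed.

Lemma tspan_any (t : T2) : tspan (fun _ _ => True) t.
Proof.
by elim/tensor_ind: t => [|x y t IH]; [exact: tspan0|exact: tspan_add].
Qed.

(** An element of g \ox g inside U(g) \ox U(g), given by the list of its
    terms. *)
Definition gsum (s : seq (g * g)) : T2 := \sum_(p <- s) gen p.1 \ox gen p.2.

(** The legs are brought into g one after the other: antisymmetry carries the
    result for the first leg over to the second. *)
Lemma primitive_gsum (t : T2) :
  cop12 D t = leg13 t + leg23 t -> flip t = - t ->
  tlift (fun u v => counit u *: v) t = 0 -> exists s, t = gsum s.
Proof.
move=> /primitive_adams ta tN te; have [gl _] := uea_gen_hom br.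
have [tl tr] := tpure_bilin U U.
have t1 := primitive_first_leg ta te (tspan_any t).
have {}t1 : tspan (fun _ b : U => is_gen b) t.
  have <- : - flip t = t by rewrite tN opprK.
  move: t1; apply: (tspan_map (f := fun s : T2 => - flip s)) => //.
  - by move=> k u v; rewrite (@flip_linear _ U) opprD -scalerN.
  - exact: tspan0.
  - exact: tspanD.
  move=> a b [[x ->] _]; rewrite flip_pure -(lin_opp _ (tr b)).
  by apply: tspan_pure; exists (- x); rewrite (lin_opp _ gl).
have := primitive_first_leg ta te t1.
elim=> [|a b s [[x ->] [y ->]] _ [l ->]].
  by exists [::]; rewrite /gsum big_nil.
by exists ((x, y) :: l); rewrite /gsum big_cons.
Qed.

Section Twist.
Variables (F : nat -> T2) (hF : twist F).

Let B := F 1%N.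
Let C := F 2%N.
Let r := B - flip B.

Lemma cauchy1 (A A' A'' : zmodType) (op : A -> A' -> A'') u v :
  cauchy op u v 1%N = op (u 0%N) (v 1%N) + op (u 1%N) (v 0%N).
Proof. by rewrite /cauchy big_ord_recr big_ord1. Qed.

Lemma cauchy2 (A A' A'' : zmodType) (op : A -> A' -> A'') u v :
  cauchy op u v 2%N =
  op (u 0%N) (v 2%N) + op (u 1%N) (v 1%N) + op (u 2%N) (v 0%N).
Proof. by rewrite /cauchy big_ord_recr big_ord_recr big_ord1. Qed.

Lemma cop12_1 : cop12 D 1 = 1.
Proof. by rewrite tensor_oneE (cop12_pure Dl) coproduct1 tensor_oneE tassoc_pure. Qed.

Lemma cop23_1 : cop23 D 1 = 1.
Proof. by rewrite tensor_oneE (cop23_pure Dl) coproduct1. Qed.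

Lemma twist_cocycle1 : cop12 D B + leg12 B = cop23 D B + leg23 B.
Proof.
have /= := congr1 (fun f => f 1%N) (twist_cocycle hF).
rewrite !cauchy1 /= (lin_add _ _ (@tassoc_linear _ U)) !tassocM.
rewrite -[tassoc (F 0 \ox 1)]/(leg12 (F 0)) -[tassoc (F 1 \ox 1)]/(leg12 B).
rewrite -[tassoc (tmap D id (F 0))]/(cop12 D (F 0)).
rewrite -[tassoc (tmap D id (F 1))]/(cop12 D B).
rewrite -[1 \ox F 0]/(leg23 (F 0)) -[1 \ox F 1]/(leg23 B).
rewrite -[tmap id D (F 0)]/(cop23 D (F 0)) -[tmap id D (F 1)]/(cop23 D B).
by rewrite (twist0 hF) -tensor_oneE cop12_1 cop23_1 leg12_pure leg23_pure
  -!tensor_oneE !mul1r !mulr1.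
Qed.

Lemma twist_cocycle2 : cop12 D C + leg12 B * cop12 D B + leg12 C =
  cop23 D C + leg23 B * cop23 D B + leg23 C.
Proof.
have /= := congr1 (fun f => f 2%N) (twist_cocycle hF).
rewrite !cauchy2 /= !(lin_add _ _ (@tassoc_linear _ U)) !tassocM.
rewrite -[tassoc (F 0 \ox 1)]/(leg12 (F 0)) -[tassoc (F 1 \ox 1)]/(leg12 B).
rewrite -[tassoc (F 2 \ox 1)]/(leg12 C).
rewrite -[tassoc (tmap D id (F 0))]/(cop12 D (F 0)).
rewrite -[tassoc (tmap D id (F 1))]/(cop12 D B).
rewrite -[tassoc (tmap D id (F 2))]/(cop12 D C).
rewrite -[1 \ox F 0]/(leg23 (F 0)) -[1 \ox F 1]/(leg23 B).
rewrite -[1 \ox F 2]/(leg23 C).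
rewrite -[tmap id D (F 0)]/(cop23 D (F 0)) -[tmap id D (F 1)]/(cop23 D B).
rewrite -[tmap id D (F 2)]/(cop23 D C).
by rewrite (twist0 hF) -tensor_oneE cop12_1 cop23_1 leg12_pure leg23_pure
  -!tensor_oneE !mul1r !mulr1.
Qed.

Lemma twist_gsum : exists s, r = gsum s.
Proof.
have fl := @flip_linear R U; have cl := tlift_linear (@counit_bilin R g br).
apply: primitive_gsum.
- exact: (cop12_antisym Dl DC twist_cocycle1).
- by rewrite /r (lin_sub _ _ fl) flipK opprB.
have e1 := congr1 (fun f => f 1%N) (twist_counit_l hF).
have e2 := congr1 (fun f => f 1%N) (twist_counit_r hF).
rewrite /= in e1 e2; rewrite /r (lin_sub _ _ cl) [tlift _ B]e1 sub0r.
have hb : bilin (fun u v : U => counit v *: u).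
  by have [b1 b2] := @counit_bilin R g br; split.
have flipE t : tlift (fun u v : U => counit u *: v) (flip t) =
    tlift (fun u v : U => counit v *: u) t.
  move: t; apply: (@tensor_ext _ _ _ _
    (fun t => tlift (fun u v : U => counit u *: v) (flip t))).
  - exact: linear_comp2 cl fl.
  - exact: tlift_linear.
  by move=> x y; rewrite flip_pure !tlift_pure //; exact: counit_bilin.
by rewrite flipE [tlift _ B]e2 oppr0.
Qed.

End Twist.

(** The classical Yang-Baxter equation [r12, r13] + [r12, r23] + [r13, r23] =
    0, with the commutators expressed by brackets of g. *)
Definition cybe (s : seq (g * g)) : Prop :=
  \sum_(p <- s) \sum_(q <- s)
    (gen (br p.1 q.1) \ox (gen p.2 \ox gen q.2)
     + gen p.1 \ox (gen (br p.2 q.1) \ox gen q.2)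
     + gen p.1 \ox (gen q.1 \ox gen (br p.2 q.2))) = 0 :> T3.

Section AntisymmetricSum.
Variable s : seq (g * g).
Hypothesis sN : flip (gsum s) = - gsum s.

(** Only the tensor is antisymmetric, not the list of its terms; every bilinear
    expression in the terms inherits the antisymmetry. *)
Lemma gsum_antisym (W : lmodType R) (f : U -> U -> W) : bilin f ->
  \sum_(p <- s) f (gen p.2) (gen p.1) = - \sum_(p <- s) f (gen p.1) (gen p.2).
Proof.
move=> hf; have fl := tlift_linear hf.
have := congr1 (tlift f) sN; rewrite (lin_opp _ fl) /gsum.
rewrite (lin_sum _ _ (@flip_linear R U)) !(lin_sum _ _ fl).
under eq_bigr do rewrite flip_pure tlift_pure //.
by under [in RHS]eq_bigr do rewrite tlift_pure //.
Qed.

(** The cyclic sum of r12 (r13 + r23) has six terms, and so have the three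
    commutators. Antisymmetry of r identifies them. *)
Lemma gsum_cybe : cop12 D (gsum s) = leg13 (gsum s) + leg23 (gsum s) ->
  cyclic_sum (leg12 (gsum s) * cop12 D (gsum s)) = 0 -> cybe s.
Proof.
move=> -> J; have [h1 h2 h3] := @tpure3_trilin R U.
have [gl gb] := uea_gen_hom br; have cl := @cycle3_linear R U.
pose S2 (f : g * g -> g * g -> T3) := \sum_(p <- s) \sum_(q <- s) f p q.
have S2D f h : S2 (fun p q => f p q + h p q) = S2 f + S2 h.
  by rewrite /S2 -big_split; apply: eq_bigr => p _; rewrite big_split.
have S2C f : S2 f = S2 (fun p q => f q p) by exact: exchange_big.
have S2c f : cycle3 (S2 f) = S2 (fun p q => cycle3 (f p q)).
  by rewrite /S2 !(lin_sum _ _ cl); apply: eq_bigr => p _; rewrite (lin_sum _ _ cl).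
pose t3 (u v w : U) : T3 := u \ox (v \ox w).
have E : leg12 (gsum s) * (leg13 (gsum s) + leg23 (gsum s)) = S2 (fun p q =>
    t3 (gen p.1 * gen q.1) (gen p.2) (gen q.2) +
    t3 (gen p.1) (gen p.2 * gen q.1) (gen q.2)).
  rewrite /gsum (lin_sum _ _ (@leg12_linear R U)).
  rewrite (lin_sum _ _ (@leg13_linear R U)).
  rewrite (lin_sum _ _ (@leg23_linear R U)) -big_split /= mulr_suml.
  apply: eq_bigr => p _; rewrite mulr_sumr; apply: eq_bigr => q _.
  rewrite leg12_pure leg13_pure leg23_pure mulrDr !tensor_mul_pure.
  by rewrite !(mulr1, mul1r).
have swapp f : (forall q, bilin (fun u v => f u v q)) ->
    S2 (fun p q => f (gen p.2) (gen p.1) q) =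
    - S2 (fun p q => f (gen p.1) (gen p.2) q).
  move=> hf; rewrite /S2 exchange_big [in RHS]exchange_big /= -sumrN.
  by apply: eq_bigr => q _; exact: (gsum_antisym (hf q)).
have swapq f : (forall p, bilin (f p)) ->
    S2 (fun p q => f p (gen q.2) (gen q.1)) =
    - S2 (fun p q => f p (gen q.1) (gen q.2)).
  move=> hf; rewrite /S2 -sumrN.
  by apply: eq_bigr => p _; exact: (gsum_antisym (hf p)).
have ct3 u v w : cycle3 (t3 u v w) = t3 w u v by exact: cycle3_pure.
rewrite E /cyclic_sum !S2D !(lin_add _ _ cl) !S2c in J.
pose T u v w := S2 (fun p q => t3 (u p q) (v p q) (w p q)).
have cT u v w : S2 (fun p q => cycle3 (t3 (u p q) (v p q) (w p q))) = T w u v.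
  by apply: eq_bigr => p _; apply: eq_bigr => q _; rewrite ct3.
have ccT u v w :
    S2 (fun p q => cycle3 (cycle3 (t3 (u p q) (v p q) (w p q)))) = T v w u.
  by apply: eq_bigr => p _; apply: eq_bigr => q _; rewrite !ct3.
rewrite !cT !ccT {cT ccT ct3} in J.
(* The legs of one or both copies of r are exchanged, so that all terms have
   their single generators in the same places as the commutators. *)
have T3E : T (fun _ q => gen q.2) (fun p q => gen p.1 * gen q.1)
    (fun p _ => gen p.2) =
    - T (fun p _ => gen p.1) (fun p q => gen q.1 * gen p.2) (fun _ q => gen q.2).
  rewrite /T (swapq (fun p u v => t3 u (gen p.1 * v) (gen p.2))).
    by rewrite S2C.
  move=> p; split=> [v|u]; first exact: h1.
  exact: linear_comp2 (h2 _ _) (linear_mulr _).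
have T6E : T (fun p q => gen p.2 * gen q.1) (fun _ q => gen q.2)
    (fun p _ => gen p.1) =
    - T (fun p q => gen q.1 * gen p.1) (fun p _ => gen p.2) (fun _ q => gen q.2).
  rewrite /T (swapp (fun u v q => t3 (u * gen q.1) (gen q.2) v)).
    by rewrite S2C.
  move=> p; split=> [v|u]; last exact: h3.
  exact: linear_comp2 (h1 _ _) (linear_mull _).
have T5E : T (fun p _ => gen p.2) (fun _ q => gen q.2)
    (fun p q => gen p.1 * gen q.1) =
    T (fun p _ => gen p.1) (fun _ q => gen q.1) (fun p q => gen p.2 * gen q.2).
  rewrite /T (swapp (fun u v q => t3 u (gen q.2) (v * gen q.1))); last first.
    move=> p; split=> [v|u]; first exact: h1.
    exact: linear_comp2 (h3 _ _) (linear_mull _).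
  rewrite (swapq (fun p u v => t3 (gen p.1) u (gen p.2 * v))) ?opprK //.
  move=> p; split=> [v|u]; first exact: h2.
  exact: linear_comp2 (h3 _ _) (linear_mulr _).
have T4E : T (fun _ q => gen q.2) (fun p _ => gen p.1)
    (fun p q => gen p.2 * gen q.1) =
    - T (fun p _ => gen p.1) (fun _ q => gen q.1) (fun p q => gen q.2 * gen p.2).
  rewrite /T (swapq (fun p u v => t3 u (gen p.1) (gen p.2 * v))).
    by rewrite S2C.
  move=> p; split=> [v|u]; first exact: h1.
  exact: linear_comp2 (h3 _ _) (linear_mulr _).
rewrite T3E T4E T5E T6E {T3E T4E T5E T6E} in J.
rewrite /cybe -[RHS]J.
have t3B1 a b v w : t3 (a - b) v w = t3 a v w - t3 b v w.
  exact: (lin_sub _ _ (h1 v w)).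
have t3B2 a b u w : t3 u (a - b) w = t3 u a w - t3 u b w.
  exact: (lin_sub _ _ (h2 u w)).
have t3B3 a b u v : t3 u v (a - b) = t3 u v a - t3 u v b.
  exact: (lin_sub _ _ (h3 u v)).
have S2B f h : S2 (fun p q => f p q - h p q) = S2 f - S2 h.
  rewrite /S2 -sumrN -big_split; apply: eq_bigr => p _.
  by rewrite -sumrN -big_split.
rewrite -/(S2 _) !S2D.
have -> : S2 (fun p q => gen (br p.1 q.1) \ox (gen p.2 \ox gen q.2)) =
    S2 (fun p q => t3 (gen p.1 * gen q.1) (gen p.2) (gen q.2)) -
    T (fun p q => gen q.1 * gen p.1) (fun p _ => gen p.2) (fun _ q => gen q.2).
  rewrite -S2B; apply: eq_bigr => p _; apply: eq_bigr => q _.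
  by rewrite gb -t3B1.
have -> : S2 (fun p q => gen p.1 \ox (gen (br p.2 q.1) \ox gen q.2)) =
    S2 (fun p q => t3 (gen p.1) (gen p.2 * gen q.1) (gen q.2)) -
    T (fun p _ => gen p.1) (fun p q => gen q.1 * gen p.2) (fun _ q => gen q.2).
  rewrite -S2B; apply: eq_bigr => p _; apply: eq_bigr => q _.
  by rewrite gb -t3B2.
have -> : S2 (fun p q => gen p.1 \ox (gen q.1 \ox gen (br p.2 q.2))) =
    T (fun p _ => gen p.1) (fun _ q => gen q.1) (fun p q => gen p.2 * gen q.2) -
    T (fun p _ => gen p.1) (fun _ q => gen q.1) (fun p q => gen q.2 * gen p.2).
  rewrite -S2B; apply: eq_bigr => p _; apply: eq_bigr => q _.
  by rewrite gb -t3B3.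
rewrite [in LHS](addrACA (S2 _)) -!addrA; congr (_ + (_ + _)).
rewrite !addrA [- _ - _ in LHS]addrC -!addrA; congr (_ + _).
by rewrite [RHS]addrCA addrC addrA.
Qed.

End AntisymmetricSum.

(** The antisymmetrized first-order term of a twist is a classical r-matrix. *)
Lemma twist_rmatrix (F : nat -> T2) : twist F -> exists s,
  [/\ F 1%N - flip (F 1%N) = gsum s, flip (gsum s) = - gsum s & cybe s].
Proof.
move=> hF; have [s rs] := twist_gsum hF; exists s.
have sN : flip (gsum s) = - gsum s.
  by rewrite -rs (lin_sub _ _ (@flip_linear R U)) flipK opprB.
split=> //; apply: gsum_cybe => //; rewrite -rs.
  exact: (cop12_antisym Dl DC (twist_cocycle1 hF)).
exact: (cyclic_sum_leg12_cop12 Dl DC (twist_cocycle2 hF)).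
Qed.

End RMatrix.

(** * Calculus on the line *)

Section ContinuityRules.
Variables (R : realType) (T : topologicalType).
Implicit Types (f h : T -> R) (x : T).

Lemma contD f h x : {for x, continuous f} -> {for x, continuous h} ->
  {for x, continuous (fun y => f y + h y)}.
Proof. exact: continuousD. Qed.

Lemma contM f h x : {for x, continuous f} -> {for x, continuous h} ->
  {for x, continuous (fun y => f y * h y)}.
Proof. exact: continuousM. Qed.

Lemma cont_cst (c : R) x : {for x, continuous (fun=> c)}.
Proof. exact: cst_continuous. Qed.

Lemma contN f x : {for x, continuous f} -> {for x, continuous (fun y => - f y)}.
Proof. exact: continuousN. Qed.

Lemma contB f h x : {for x, continuous f} -> {for x, continuous h} ->
  {for x, continuous (fun y => f y - h y)}.
Proof. by move=> fc hc; apply: contD => //; exact: contN. Qed.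

Lemma cont_sum (I : Type) (s : seq I) (F : I -> T -> R) x :
  (forall i, {for x, continuous (F i)}) ->
  {for x, continuous (fun y => \sum_(i <- s) F i y)}.
Proof.
move=> Fc; elim: s => [|i s IHs].
  rewrite (_ : (fun _ => _) = fun=> 0); first exact: cont_cst.
  by apply/funext => y; rewrite big_nil.
rewrite (_ : (fun _ => _) = fun y => F i y + \sum_(i <- s) F i y).
  exact: contD.
by apply/funext => y; rewrite big_cons.
Qed.

End ContinuityRules.

Section DerivationRules.
Variables (R : realType) (V : normedModType R).
Implicit Types (f h : V -> R) (x v : V) (a b c : R).

Lemma der_cst c x v : is_derive x v (fun=> c) 0.
Proof. exact: is_derive_cst. Qed.

Lemma derD f h x v a b : is_derive x v f a -> is_derive x v h b ->
  is_derive x v (fun y => f y + h y) (a + b).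
Proof. exact: is_deriveD. Qed.

Lemma derN f x v a : is_derive x v f a -> is_derive x v (fun y => - f y) (- a).
Proof. exact: is_deriveN. Qed.

Lemma derB f h x v a b : is_derive x v f a -> is_derive x v h b ->
  is_derive x v (fun y => f y - h y) (a - b).
Proof. exact: is_deriveB. Qed.

Lemma derM f h x v a b : is_derive x v f a -> is_derive x v h b ->
  is_derive x v (fun y => f y * h y) (a * h x + f x * b).
Proof.
move=> fa hb; have := is_deriveM fa hb.
by rewrite /GRing.scale /= [h x * a]mulrC addrC.
Qed.

Lemma derZ c f x v a :
  is_derive x v f a -> is_derive x v (fun y => c * f y) (c * a).
Proof. by move=> fa; have := derM (der_cst c x v) fa; rewrite mul0r add0r. Qed.

Lemma der_sum (I : Type) (s : seq I) (F : I -> V -> R) (D : I -> R) x v :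
  (forall i, is_derive x v (F i) (D i)) ->
  is_derive x v (fun y => \sum_(i <- s) F i y) (\sum_(i <- s) D i).
Proof.
move=> FD; elim: s => [|i s IHs].
  rewrite big_nil (_ : (fun _ => _) = fun=> 0); first exact: der_cst.
  by apply/funext => y; rewrite big_nil.
rewrite big_cons (_ : (fun _ => _) = fun y => F i y + \sum_(i <- s) F i y).
  exact: derD.
by apply/funext => y; rewrite big_cons.
Qed.

Lemma der_eq f x v a b : is_derive x v f a -> a = b -> is_derive x v f b.
Proof. by move=> fa <-. Qed.

Lemma der_ext f h x v a : f =1 h -> is_derive x v f a -> is_derive x v h a.
Proof. by move=> /funext ->. Qed.

Lemma der_unique f x v a b : is_derive x v f a -> is_derive x v f b -> a = b.
Proof. by move=> [_ <-] [_ <-]. Qed.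

Lemma der_sqr f x v a :
  is_derive x v f a -> is_derive x v (fun y => f y ^+ 2) (2 * (f x * a)).
Proof.
move=> fa; apply: der_eq (derM fa fa) _.
by rewrite mulr_natl mulr2n [a * _]mulrC.
Qed.

End DerivationRules.

Section Calculus.
Variable R : realType.
Implicit Types f df : R -> R.

Lemma is_derive_continuous f (t d : R) :
  is_derive t 1 f d -> {for t, continuous f}.
Proof.
move=> h; apply: differentiable_continuous; apply/derivable1_diffP.
exact: ex_derive.
Qed.

Lemma mean_value f df (a b : R) : a <= b ->
  (forall x, a <= x <= b -> is_derive x 1 f (df x)) ->
  exists2 c, a <= c <= b & f b - f a = df c * (b - a).
Proof.
move=> ab fd; have [||c] := @MVT_segment R f df a b ab.
- by move=> x /[!in_itv] /= /andP[ax xb]; apply: fd; rewrite !ltW.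
- apply: continuous_in_subspaceT => x; rewrite inE /= in_itv /= => h.
  exact/is_derive_continuous/fd.
by rewrite in_itv /= => h e; exists c.
Qed.

Lemma derive_le0 f df (a b : R) : a <= b ->
  (forall x, a <= x <= b -> is_derive x 1 f (df x)) ->
  (forall x, a <= x <= b -> df x <= 0) -> f b <= f a.
Proof.
move=> ab fd df0; have [c cab e] := mean_value ab fd.
by rewrite -subr_le0 e mulr_le0_ge0 ?df0 // subr_ge0.
Qed.

Lemma is_derive_reflect f (t d : R) :
  is_derive (- t) 1 f d -> is_derive t 1 (fun s => f (- s)) (- d).
Proof.
move=> h; have hN : is_derive t 1 (-%R : R -> R) (-1) by exact: is_deriveNid.
by apply: der_eq (is_derive1_comp h hN) _; rewrite mulrN1.
Qed.

Lemma is_derive_expM (c t : R) :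
  is_derive t 1 (fun s => expR (c * s)) (c * expR (c * t)).
Proof.
have hc := derZ c (is_derive_id t (1 : R)).
by apply: der_eq (is_derive1_comp (is_derive_expR _) hc) _; rewrite mulr1 mulrC.
Qed.

(** By hypothesis (e + eta / c) exp (- c t) does not increase. *)
Lemma gronwall_right (e de : R -> R) (c eta L : R) : 0 < c -> 0 <= eta ->
  (forall t, 0 <= t <= L -> is_derive t 1 e (de t)) ->
  (forall t, 0 <= t <= L -> de t <= c * e t + eta) ->
  forall t, 0 <= t <= L -> e t <= (e 0 + eta / c) * expR (c * t).
Proof.
move=> c0 eta0 ed eb t /andP[t0 tL].
pose h s := (e s + eta / c) * expR (- c * s).
have : h t <= h 0.
  apply: (@derive_le0 _ (fun s => (de s - c * e s - eta) * expR (- c * s))) => //.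
    move=> s /andP[s0 st].
    have sL : 0 <= s <= L by rewrite s0 (le_trans st).
    have d1 := derD (ed s sL) (der_cst (eta / c) s 1).
    apply: der_eq (derM d1 (is_derive_expM (- c) s)) _.
    by field; rewrite gt_eqF.
  move=> s /andP[s0 st]; apply: mulr_le0_ge0; last exact: expR_ge0.
  by rewrite -addrA -opprD subr_le0 eb // s0 (le_trans st).
rewrite /h mulr0 expR0 mulr1 => ht.
rewrite -ler_pdivrMr ?expR_gt0 // -expRN -mulNr; apply: le_trans ht.
by rewrite ler_wpM2r ?expR_ge0 // lerDl divr_ge0 // ltW.
Qed.

Lemma gronwall (e de : R -> R) (c eta L : R) : 0 < c -> 0 <= eta ->
  (forall t : R, `|t| <= L -> is_derive t 1 e (de t)) ->
  (forall t : R, `|t| <= L -> `|de t| <= c * e t + eta) ->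
  forall t : R, `|t| <= L -> e t <= (e 0 + eta / c) * expR (c * `|t|).
Proof.
move=> c0 eta0 ed eb t tL.
have L1 s : 0 <= s <= L -> `|s| <= L by move=> /andP[s0 ?]; rewrite ger0_norm.
have L2 s : 0 <= s <= L -> `|- s| <= L by rewrite normrN; exact: L1.
have [t0|t0] := leP 0 t.
  rewrite ger0_norm //; apply: (@gronwall_right e de c eta L) => //.
  - by move=> s /L1; exact: ed.
  - by move=> s /L1 /eb; exact/le_trans/ler_norm.
  - by rewrite t0 -(ger0_norm t0).
have nt : 0 <= `|t| <= L by rewrite normr_ge0.
have := @gronwall_right (fun s => e (- s)) (fun s => - de (- s)) c eta L c0 eta0
  _ _ _ nt.
rewrite oppr0 ltr0_norm // opprK; apply.
- by move=> s /L2 /ed; exact: is_derive_reflect.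
- by move=> s /L2 /eb; apply: le_trans; rewrite -normrN; exact: ler_norm.
Qed.

Lemma antiderivative_near (f : R -> R) (L : R) : 0 < L -> continuous f ->
  exists F : R -> R, F 0 = 0 /\ forall t : R, `|t| < L -> is_derive t 1 F (f t).
Proof.
move=> L0 fc; pose G x := (\int[lebesgue_measure]_(t in `[(- L)%R, x]) (f t))%R.
exists (fun x => G x - G 0); split; first exact: subrr.
move=> t; rewrite ltr_norml => /andP[Lt tL].
have fi : lebesgue_measure.-integrable `[- L, L] (EFin \o f).
  apply: continuous_compact_integrable; first exact: segment_compact.
  exact: continuous_subspaceT.
have [dG eG] := continuous_FTC1_closed tL fi Lt (fc t).
have dG' : is_derive t 1 G (f t).
  by rewrite -eG derive1E; exact: derivableP.
by have := derB dG' (der_cst (G 0) t 1); rewrite subr0.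
Qed.

(** At s the value of the member of the family with parameter |s| + 1 is taken,
    which is defined on a neighbourhood of s. *)
Lemma glue_derivable (Y : R -> R -> R) (d : R -> R) :
  (forall K L t : R, `|t| < K -> `|t| < L -> Y K t = Y L t) ->
  (forall L t : R, `|t| < L -> is_derive t 1 (Y L) (d t)) ->
  forall t : R, is_derive t 1 (fun s => Y (`|s| + 1) s) (d t).
Proof.
move=> YE Yd t; have tL : `|t| < `|t| + 1 by rewrite ltrDl.
apply: near_eq_is_derive (Yd _ _ tL).
have : \forall s \near t, `|s| < `|t| + 1.
  exact: (cvgr_lt _ (@norm_continuous _ R t)).
by apply: filterS => s st; apply: YE => //; rewrite ltrDl.
Qed.

Lemma derive0_cst (f : R -> R) (a b : R) : a <= b ->
  (forall x, a <= x <= b -> is_derive x 1 f 0) -> f b = f a.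
Proof.
move=> ab fd; have [c _] := mean_value ab fd.
by rewrite mul0r => /eqP; rewrite subr_eq0 => /eqP.
Qed.

Lemma antiderivative (f : R -> R) : continuous f ->
  exists F : R -> R, F 0 = 0 /\ forall t : R, is_derive t 1 F (f t).
Proof.
move=> fc.
have /choice [Y Yp] : forall L : R, exists F : R -> R,
    F 0 = 0 /\ forall t : R, `|t| < L -> is_derive t 1 F (f t).
  move=> L; have [L0|L0] := ltP 0 L; first exact: antiderivative_near.
  exists (fun=> 0); split=> // t tL; exfalso.
  by have := lt_le_trans tL L0; rewrite ltNge normr_ge0.
exists (fun s => Y (`|s| + 1) s); split; first exact: (Yp _).1.
apply: glue_derivable; last by move=> L; exact: (Yp L).2.
move=> K L t tK tL; apply/eqP; rewrite -subr_eq0; apply/eqP.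
pose h s := Y K s - Y L s.
have hd (s : R) : `|s| <= `|t| -> is_derive s 1 h 0.
  move=> st; have sK := le_lt_trans st tK; have sL := le_lt_trans st tL.
  by have := derB ((Yp K).2 s sK) ((Yp L).2 s sL); rewrite subrr.
have h0 : h 0 = 0 by rewrite /h (Yp K).1 (Yp L).1 subrr.
rewrite -[LHS]/(h t) -h0; have [t0|t0] := leP 0 t.
  apply: derive0_cst => // s /andP[s0 st]; apply: hd.
  by rewrite !ger0_norm.
symmetry; apply: derive0_cst => [|s /andP[st s0]]; first exact: ltW.
by apply: hd; rewrite ler0_norm // (ltr0_norm t0) lerN2.
Qed.

Lemma geometric_cauchy (u : nat -> R) (C : R) :
  (forall n, `|u n.+1 - u n| <= C / 2 ^+ n.+1) ->
  exists l, forall n, `|l - u n| <= C / 2 ^+ n.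
Proof.
(* The limit is enclosed by the monotone sequences a and b. *)
move=> ub; pose a n := u n - C / 2 ^+ n; pose b n := u n + C / 2 ^+ n.
have e n : C / 2 ^+ n = C / 2 ^+ n.+1 + C / 2 ^+ n.+1.
  by rewrite exprS; field; exact: expf_neq0.
have aS n : a n <= a n.+1.
  by move: (ub n); rewrite ler_norml /a (e n) => /andP[+ _]; lra.
have bS n : b n.+1 <= b n.
  by move: (ub n); rewrite ler_norml /b (e n) => /andP[_]; lra.
have C0 n : 0 <= C / 2 ^+ n by rewrite e addr_ge0 // (le_trans _ (ub n)).
have amono m n : (m <= n)%N -> a m <= a n.
  by move=> /subnK <-; elim: (n - m)%N => [//|k IH]; exact: le_trans IH (aS _).
have bmono m n : (m <= n)%N -> b n <= b m.
  by move=> /subnK <-; elim: (n - m)%N => [//|k IH]; exact: le_trans (bS _) IH.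
have ab m n : a m <= b n.
  apply: (@le_trans _ _ (a (m + n)%N)); first by apply: amono; exact: leq_addr.
  apply: (@le_trans _ _ (b (m + n)%N)); last by apply: bmono; exact: leq_addl.
  by rewrite /a /b lerD2l (le_trans _ (C0 _)) // oppr_le0.
have hs : has_sup (range a).
  by split; [exists (a 0), 0|exists (b 0) => _ [n _ <-]; exact: ab].
exists (sup (range a)) => n.
have l1 : a n <= sup (range a) by apply: ub_le_sup; [case: hs|exists n].
have l2 : sup (range a) <= b n.
  by apply: ge_sup; [case: hs|move=> _ [k _ <-]; exact: ab].
by rewrite ler_norml; move: l1 l2; rewrite /a /b; lra.
Qed.

Lemma exp2_unbounded (a b : R) : 0 < a -> exists n, b / 2 ^+ n < a.
Proof.
move=> a0; exists (Num.bound `|b / a|).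
have bn := archi_boundP (normr_ge0 (b / a)); set n := Num.bound _ in bn *.
have {}bn : b / a < 2 ^+ n.
  apply: le_lt_trans (ler_norm _) _; apply: lt_le_trans bn _.
  by rewrite -natrX ler_nat ltnW // ltn_expl.
by rewrite ltr_pdivrMr ?exprn_gt0 // mulrC -ltr_pdivrMr.
Qed.

End Calculus.

(** * Linear ordinary differential equations *)

Section LinearODE.
Variables (R : realType) (m : nat).
Implicit Types (A : 'I_m -> 'I_m -> R -> R) (y : 'I_m -> R -> R).

Definition solves A y : Prop := forall (t : R) k,
  is_derive t 1 (y k) (\sum_j A k j t * y j t).

Lemma sum_bound (K B : R) (a v : 'I_m -> R) : 0 <= K ->
  (forall j, `|a j| <= K) -> (forall j, `|v j| <= B) ->
  `|\sum_j a j * v j| <= m%:R * K * B.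
Proof.
move=> K0 aK vB; apply: le_trans (ler_norm_sum _ _ _) _.
apply: (@le_trans _ _ (\sum_(j < m) K * B)).
  by apply: ler_sum => j _; rewrite normrM ler_pM.
by rewrite sumr_const card_ord -[leLHS]mulr_natl mulrA.
Qed.

(** Integration against the weight exp (2 M |t|) gains a factor 2 over the
    bound M, which makes Picard iteration converge on the whole line. *)
Lemma weighted_bound (F f : R -> R) (M B : R) : 0 < M -> 0 <= B -> F 0 = 0 ->
  (forall t : R, is_derive t 1 F (f t)) ->
  (forall t, `|f t| <= M * (B * expR (2 * M * `|t|))) ->
  forall t, `|F t| <= B / 2 * expR (2 * M * `|t|).
Proof.
move=> M0 B0.
suff H (F' f' : R -> R) : F' 0 = 0 ->
    (forall t : R, is_derive t 1 F' (f' t)) ->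
    (forall t, `|f' t| <= M * (B * expR (2 * M * `|t|))) ->
    forall t, 0 <= t -> F' t <= B / 2 * expR (2 * M * `|t|).
  move=> F0 Fd fb t; rewrite ler_norml lerNl.
  have [t0|t0] := leP 0 t; apply/andP; split.
  - apply: (H (fun s => - F s) (fun s => - f s)) => //.
    + by rewrite F0 oppr0.
    + by move=> s; rewrite normrN.
  - exact: (H F f).
  - rewrite -normrN -[in F t](opprK t).
    apply: (H (fun s => - F (- s)) (fun s => f (- s))).
    + by rewrite oppr0 F0 oppr0.
    + move=> s; apply: der_eq (derN (is_derive_reflect (Fd (- s)))) _.
      exact: opprK.
    + by move=> s; rewrite -(normrN s).
    + by rewrite oppr_ge0 ltW.
  - rewrite -normrN -[in F t](opprK t).
    apply: (H (fun s => F (- s)) (fun s => - f (- s))).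
    + by rewrite oppr0 F0.
    + by move=> s; exact: is_derive_reflect (Fd (- s)).
    + by move=> s; rewrite normrN -(normrN s).
    + by rewrite oppr_ge0 ltW.
move=> F0 Fd fb t t0; rewrite ger0_norm //.
pose G s := F' s - B / 2 * expR (2 * M * s).
have : G t <= G 0.
  apply: (@derive_le0 _ _ (fun s => f' s - B / 2 * (2 * M * expR (2 * M * s)))) => //.
    by move=> s _; apply: derB => //; apply: derZ; exact: is_derive_expM.
  move=> s /andP[s0 _]; have := le_trans (ler_norm _) (fb s).
  rewrite ger0_norm // => h; rewrite subr_le0; apply: le_trans h _.
  by rewrite le_eqVlt; apply/orP; left; apply/eqP; field.
rewrite /G F0 mulr0 expR0 mulr1 sub0r lerBlDr => /le_trans; apply.
by rewrite gerDr oppr_le0 divr_ge0.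
Qed.

Lemma sum_continuous A y : (forall k j, continuous (A k j)) ->
  (forall j, continuous (y j)) ->
  forall k, continuous (fun t => \sum_j A k j t * y j t).
Proof.
move=> Ac yc k t; apply: cont_sum => j.
by apply: contM; [exact: Ac|exact: yc].
Qed.

(** Picard iteration Y from the constant function v; by [weighted_bound]
    consecutive iterates approach each other geometrically, with a factor that
    is bounded on bounded intervals. *)
Lemma bounded_ode_exists A (K : R) (v : 'I_m -> R) : 0 < K ->
  (forall k j, continuous (A k j)) -> (forall k j t, `|A k j t| <= K) ->
  exists y, solves A y /\ forall k, y k 0 = v k.
Proof.
move=> K0 Ac AK.
(* With m.+1 instead of m, M is positive also for m = 0. *)
pose M := m.+1%:R * K; pose B := \sum_k `|v k|.
have M0 : 0 < M by rewrite mulr_gt0 // ltr0n.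
have B0 : 0 <= B by apply: sumr_ge0.
pose w (t : R) := expR (2 * M * `|t|).
have sumM C (a u : 'I_m -> R) : 0 <= C -> (forall j, `|a j| <= K) ->
    (forall j, `|u j| <= C) -> `|\sum_j a j * u j| <= M * C.
  move=> C0 aK uC; apply: le_trans (sum_bound (ltW K0) aK uC) _.
  by rewrite ler_wpM2r // ler_wpM2r ?(ltW K0) // ler_nat.
have [P Pp] : exists P : (R -> R) -> R -> R, forall f : R -> R, continuous f ->
    P f 0 = 0 /\ forall t : R, is_derive t 1 (P f) (f t).
  have /choice [P Pp] : forall f : R -> R, exists F : R -> R,
      continuous f -> F 0 = 0 /\ forall t : R, is_derive t 1 F (f t).
    move=> f; have [fc|nfc] := pselect (continuous f).
      by have [F Fp] := antiderivative fc; exists F.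
    by exists f.
  by exists P.
pose step (y : 'I_m -> R -> R) k t :=
  v k + P (fun s => \sum_j A k j s * y j s) t.
pose Y n := iter n step (fun k _ => v k).
have PD y k : (forall j, continuous (y j)) -> P (fun s => \sum_j A k j s * y j s) 0 = 0
    /\ forall t : R, is_derive t 1 (P (fun s => \sum_j A k j s * y j s))
         (\sum_j A k j t * y j t).
  by move=> yc; apply: Pp; exact: sum_continuous.
have Yc n k : continuous (Y n k).
  elim: n k => [|n IHn] k t; first exact: cst_continuous.
  exact: is_derive_continuous (derD (der_cst (v k) t 1) ((PD _ k IHn).2 t)).
have Yb n k (t : R) : `|Y n.+1 k t - Y n k t| <= (B * w t) / 2 ^+ n.+1.
  elim: n k t => [|n IHn] k t.
    rewrite [Y 1%N]/(step (Y 0)) /step -[Y 0 k t]/(v k) addrAC subrr add0r.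
    have [P0 Pd] := PD (Y 0) k (Yc 0).
    rewrite expr1 mulrAC; apply: (weighted_bound M0 B0 P0 Pd) => s.
    apply: sumM => [|j|j]; [by rewrite mulr_ge0 ?expR_ge0|exact: AK|].
    apply: (@le_trans _ _ B).
      by rewrite /B (bigD1 j) //= lerDl sumr_ge0.
    by rewrite ler_peMr // -expR0 ler_expR !mulr_ge0 // ltW.
  rewrite [Y n.+2]/(step (Y n.+1)) [Y n.+1 in X in _ - X]/(step (Y n)) /step.
  rewrite opprD addrACA subrr add0r.
  have [P0 Pd] := PD (Y n.+1) k (Yc n.+1).
  have [P0' Pd'] := PD (Y n) k (Yc n).
  have := @weighted_bound (fun t => P (fun s => \sum_j A k j s * Y n.+1 j s) t -
    P (fun s => \sum_j A k j s * Y n j s) t) (fun t =>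
    \sum_j A k j t * Y n.+1 j t - \sum_j A k j t * Y n j t) M (B / 2 ^+ n.+1) M0.
  have -> : B * w t / 2 ^+ n.+2 = B / 2 ^+ n.+1 / 2 * w t.
    by rewrite [2 ^+ n.+2]exprSr invfM; ring.
  apply.
  - by rewrite divr_ge0 // exprn_ge0.
  - by rewrite P0 P0' subrr.
  move=> s; rewrite -sumrB; under eq_bigr do rewrite -mulrBr.
  apply: sumM => [|j|j]; [by rewrite !mulr_ge0 ?expR_ge0 ?invr_ge0 ?exprn_ge0|exact: AK|].
  by rewrite mulrAC; exact: IHn.
have /choice [y0 y0P] : forall k, exists y : R -> R, forall (t : R) n,
    `|y t - Y n k t| <= (B * w t) / 2 ^+ n.
  move=> k; have /choice [y yP] : forall t : R, exists l, forall n,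
      `|l - Y n k t| <= (B * w t) / 2 ^+ n.
    by move=> t; apply: geometric_cauchy => n; exact: Yb.
  by exists y.
have y0c k : continuous (y0 k).
  move=> t; apply/cvgrPdist_le => e e0.
  pose W := B * expR (2 * M * (`|t| + 1)).
  have [|n We] := @exp2_unbounded _ (e / 3) W; first by rewrite divr_gt0.
  have wW (s : R) : `|s| <= `|t| + 1 -> `|y0 k s - Y n k s| <= e / 3.
    move=> st; apply: le_trans (y0P k s n) _; apply: le_trans (ltW We).
    rewrite ler_wpM2r ?invr_ge0 ?exprn_ge0 // ler_wpM2l // ler_expR.
    by rewrite ler_wpM2l // mulr_ge0 // ltW.
  have /cvgrPdist_le /(_ (e / 3)) Yt := Yc n k t.
  have nt : \forall s \near t, `|s| <= `|t| + 1.
    apply: (cvgr_le _ (@norm_continuous _ R t)); by rewrite ltrDl.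
  near=> s.
  have h1 : `|Y n k t - Y n k s| <= e / 3 by near: s; apply: Yt; rewrite divr_gt0.
  have h2 : `|y0 k s - Y n k s| <= e / 3 by apply: wW; near: s.
  have h3 : `|y0 k t - Y n k t| <= e / 3 by apply: wW; rewrite lerDl.
  have -> : y0 k t - y0 k s = (y0 k t - Y n k t) + (Y n k t - Y n k s) -
    (y0 k s - Y n k s) by ring.
  apply: le_trans (ler_normB _ _) _.
  have := ler_normD (y0 k t - Y n k t) (Y n k t - Y n k s).
  by lra.
(* By continuity of step, both sides are limits of the same iterates. *)
have y0E k t : y0 k t = step y0 k t.
  apply/eqP; rewrite -subr_eq0; apply/negPn/negP; rewrite -normr_gt0 => d0.
  have [n] := exp2_unbounded (B * w t) d0; rewrite ltNge => /negP; apply.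
  have [P0 Pd] := PD y0 k y0c; have [P0' Pd'] := PD (Y n) k (Yc n).
  have h1 := y0P k t n.+1.
  have h2 : `|step y0 k t - Y n.+1 k t| <= B / 2 ^+ n / 2 * w t.
    rewrite [Y n.+1 k t]/(step (Y n) k t) /step opprD addrACA subrr add0r.
    apply: (@weighted_bound (fun t => P (fun s => \sum_j A k j s * y0 j s) t -
      P (fun s => \sum_j A k j s * Y n j s) t) (fun t =>
      \sum_j A k j t * y0 j t - \sum_j A k j t * Y n j t)).
    - exact: M0.
    - by rewrite divr_ge0 // exprn_ge0.
    - by rewrite P0 P0' subrr.
    move=> s; rewrite -sumrB; under eq_bigr do rewrite -mulrBr.
    apply: sumM => [|j|j]; [|exact: AK|by rewrite mulrAC; exact: y0P].
    by rewrite !mulr_ge0 ?expR_ge0 ?invr_ge0 ?exprn_ge0.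
  have -> : y0 k t - step y0 k t =
    (y0 k t - Y n.+1 k t) - (step y0 k t - Y n.+1 k t) by ring.
  apply: le_trans (ler_normB _ _) _.
  have e1 : B * w t / 2 ^+ n.+1 = B * w t / 2 ^+ n / 2.
    by rewrite exprSr invfM mulrA.
  have e2 : B / 2 ^+ n / 2 * w t = B * w t / 2 ^+ n / 2 by ring.
  by rewrite e2 in h2; rewrite e1 in h1; lra.
exists y0; split=> [t k|k]; last first.
  by rewrite y0E /step (PD y0 k y0c).1 addr0.
rewrite (_ : y0 k = step y0 k); last by apply/funext => s; exact: y0E.
apply: der_eq (derD (der_cst (v k) t 1) ((PD _ k y0c).2 t)) _.
exact: add0r.
Unshelve. all: by end_near.
Qed.

End LinearODE.

Section LinearODETheory.
Variables (R : realType) (m : nat).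
Implicit Types (A : 'I_m -> 'I_m -> R -> R) (y : 'I_m -> R -> R).

Lemma bounded_on_segment (f : R -> R) (L : R) : continuous f ->
  exists K, 0 <= K /\ forall t, `|t| <= L -> `|f t| <= K.
Proof.
move=> fc; have [L0|L0] := ltP L 0.
  exists 0; split=> // t tL.
  by have := le_lt_trans tL L0; rewrite ltNge normr_ge0.
have nfc : {within `[- L, L], continuous (fun t => `|f t|)}.
  apply: continuous_subspaceT => t.
  exact: (continuous_comp (fc t) (@norm_continuous _ R (f t))).
have [|c _ cmax] := EVT_max _ nfc; first by rewrite ge0_cp.
exists `|f c|; split=> // t tL; apply: cmax.
by rewrite in_itv /= -ler_norml.
Qed.

Lemma family_bounded_on_segment (I J : finType) (f : I -> J -> R -> R) (L : R) :
  (forall i j, continuous (f i j)) ->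
  exists K, 0 <= K /\ forall i j t, `|t| <= L -> `|f i j t| <= K.
Proof.
move=> fc.
have /choice [K Kp] : forall p : I * J, exists K, 0 <= K /\
    forall t, `|t| <= L -> `|f p.1 p.2 t| <= K.
  by move=> p; exact: bounded_on_segment.
exists (\sum_p K p); split=> [|i j t tL].
  by apply: sumr_ge0 => p _; exact: (Kp p).1.
apply: le_trans ((Kp (i, j)).2 t tL) _.
rewrite (bigD1 (i, j)) //= lerDl.
by apply: sumr_ge0 => p _; exact: (Kp p).1.
Qed.

(** Gronwall's inequality for the sum of squares of y, with 2 |a b| <= a ^ 2 +
    b ^ 2 for the mixed terms. *)
Lemma system_gronwall A y (h : 'I_m -> R -> R) (K eta L : R) :
  0 <= K -> 0 <= eta ->
  (forall t : R, `|t| <= L -> forall k,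
     is_derive t 1 (y k) (\sum_j A k j t * y j t + h k t)) ->
  (forall k j (t : R), `|t| <= L -> `|A k j t| <= K) ->
  (forall k (t : R), `|t| <= L -> `|h k t| <= eta) ->
  forall t : R, `|t| <= L ->
  \sum_k y k t ^+ 2 <= (\sum_k y k 0 ^+ 2 + m%:R * eta ^+ 2 / (2 * m%:R * K + 1))
    * expR ((2 * m%:R * K + 1) * `|t|).
Proof.
move=> K0 eta0 yd AK hb t tL.
pose e s := \sum_k y k s ^+ 2.
pose de s := \sum_k 2 * (y k s * (\sum_j A k j s * y j s + h k s)).
apply: (@gronwall _ e de _ _ L) => //.
- by rewrite ltr_wpDl // !mulr_ge0.
- by rewrite mulr_ge0 // exprn_ge0.
- by move=> s sL; apply: der_sum => k; apply: der_sqr; exact: yd.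
move=> s sL; rewrite /de; apply: le_trans (ler_norm_sum _ _ _) _.
have yy (a b : R) : `|a| * `|b| <= (a ^+ 2 + b ^+ 2) / 2.
  have aE : `|a| ^+ 2 = a ^+ 2 by rewrite real_normK ?num_real.
  have bE : `|b| ^+ 2 = b ^+ 2 by rewrite real_normK ?num_real.
  by have := sqr_ge0 (`|a| - `|b|); rewrite -aE -bE sqrrB; lra.
apply: (@le_trans _ _ (\sum_k (\sum_j K * (y k s ^+ 2 + y j s ^+ 2) +
    (y k s ^+ 2 + eta ^+ 2)))).
  apply: ler_sum => k _; rewrite normrM (ger0_norm (ler0n _ 2)) normrM.
  rewrite mulrA; apply: le_trans (ler_wpM2l _ (ler_normD _ _)) _.
    by rewrite mulr_ge0.
  rewrite mulrDr lerD //.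
    apply: le_trans (ler_wpM2l _ (ler_norm_sum _ _ _)) _; first by rewrite mulr_ge0.
    rewrite mulr_sumr; apply: ler_sum => j _; rewrite normrM.
    have := yy (y k s) (y j s); have := AK k j s sL.
    have := normr_ge0 (y k s); have := normr_ge0 (y j s).
    have := normr_ge0 (A k j s); move: (`|y k s|) (`|y j s|) (`|A k j s|).
    move=> a b c c0 b0 a0 cK ab.
    have ab0 : 0 <= a * b by rewrite mulr_ge0.
    have h1 : c * (a * b) <= K * (a * b) by rewrite ler_wpM2r.
    have h2 : K * (a * b) <= K * ((y k s ^+ 2 + y j s ^+ 2) / 2).
      by rewrite ler_wpM2l.
    have -> : 2 * a * (c * b) = 2 * (c * (a * b)) by ring.
    by lra.
  have := yy (y k s) eta; rewrite (ger0_norm eta0) => yk.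
  have h1 : `|y k s| * `|h k s| <= `|y k s| * eta by rewrite ler_wpM2l // hb.
  by rewrite -mulrA; lra.
rewrite big_split /= big_split /= sumr_const card_ord.
have -> : \sum_k \sum_j K * (y k s ^+ 2 + y j s ^+ 2) = 2 * m%:R * K * e s.
  under eq_bigr do rewrite -mulr_sumr big_split /= sumr_const card_ord.
  rewrite -mulr_sumr big_split /= sumrMnl sumr_const card_ord -/(e s).
  by rewrite -[e s *+ m]mulr_natl; ring.
rewrite -/(e s) -[_ *+ m]mulr_natl; lra.
Qed.

Lemma ode_unique A y (t0 : R) : (forall k j, continuous (A k j)) ->
  solves A y -> (forall k, y k t0 = 0) -> forall k t, y k t = 0.
Proof.
move=> Ac ys y0 k t.
pose A' i j s := A i j (s + t0); pose y' i s := y i (s + t0).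
have sd (s : R) : is_derive s 1 (fun s : R => s + t0) 1.
  by have := derD (is_derive_id s (1 : R)) (der_cst t0 s (1 : R)); rewrite addr0.
have [K [K0 AK]] := @family_bounded_on_segment _ _ A' `|t - t0| (fun i j s =>
  continuous_comp (is_derive_continuous (sd s)) (Ac i j (s + t0))).
have h00 (i : 'I_m) (s : R) : `|s| <= `|t - t0| -> `|0 : R| <= 0.
  by rewrite normr0.
have H (s : R) : `|s| <= `|t - t0| -> forall i,
    is_derive s 1 (y' i) (\sum_j A' i j s * y' j s + 0).
  move=> _ i; rewrite addr0; apply: der_eq (is_derive1_comp (ys _ _) (sd s)) _.
  exact: mulr1.
have := @system_gronwall A' y' (fun _ _ => 0) K 0 `|t - t0| K0 (lexx _) H.
move=> /(_ AK (h00) _ (lexx _)).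
rewrite expr0n /= mulr0 mul0r addr0.
have -> : \sum_i y' i 0 ^+ 2 = 0.
  by rewrite big1 // => i _; rewrite /y' add0r y0 expr0n.
rewrite mul0r => h.
have {}h : \sum_i y' i (t - t0) ^+ 2 = 0.
  apply/eqP; rewrite eq_le h sumr_ge0 // => i _; exact: sqr_ge0.
have := h => /eqP; rewrite psumr_eq0; last by move=> i _; exact: sqr_ge0.
move=> /allP /(_ k (mem_index_enum k)) /=.
by rewrite sqrf_eq0 /y' subrK => /eqP.
Qed.

(** Composing the coefficients with clamp L makes them bounded without a change
    on [- L, L]. *)
Definition clamp (L t : R) : R := Num.max (- L) (Num.min L t).

Lemma clamp_id (L t : R) : `|t| <= L -> clamp L t = t.
Proof.
by rewrite ler_norml => /andP[Lt tL]; rewrite /clamp (min_idPr tL) (max_idPr Lt).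
Qed.

Lemma clamp_norm (L t : R) : 0 <= L -> `|clamp L t| <= L.
Proof.
move=> L0; rewrite /clamp ler_norml le_max lexx /= ge_max ge_min lexx andbT.
by rewrite ge0_cp.
Qed.

Lemma clamp_continuous (L : R) : continuous (clamp L).
Proof.
move=> t; have c1 : {for t, continuous (fun=> L : R^o)} by exact: cst_continuous.
have c2 : {for t, continuous (fun=> - L : R^o)} by exact: cst_continuous.
have c3 : {for t, continuous (fun s : R => s : R^o)} by exact: cvg_id.
exact: (continuous_max c2 (continuous_min c1 c3)).
Qed.

(** The solutions for the clamped coefficients agree where the bounds permit to
    compare them, by Gronwall's inequality, and are glued. *)
Lemma ode_exists0 A (v : 'I_m -> R) : (forall k j, continuous (A k j)) ->
  exists y, solves A y /\ forall k, y k 0 = v k.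
Proof.
move=> Ac; pose A' L k j t := A k j (clamp L t).
have Ac' L k j : continuous (A' L k j).
  by move=> t; exact: (continuous_comp (@clamp_continuous L t) (Ac k j _)).
have /choice [Y Yp] : forall L : R, exists y : 'I_m -> R -> R,
    0 <= L -> solves (A' L) y /\ forall k, y k 0 = v k.
  move=> L; have [L0|L0] := ltP L 0; first by exists (fun _ _ => 0).
  have [K [K0 AK]] := family_bounded_on_segment L Ac.
  have [|k j|k j t|y yp] := @bounded_ode_exists _ _ (A' L) (K + 1) v.
  - by rewrite ltr_wpDl.
  - exact: Ac'.
  - apply: le_trans (AK _ _ _ (clamp_norm _ L0)) _.
    by rewrite lerDl.
  - by exists y.
have L0 (L t : R) : `|t| < L -> 0 <= L by move=> /ltW; exact: le_trans.
have YE k (K L t : R) : `|t| < K -> `|t| < L -> Y K k t = Y L k t.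
  move=> tK tL; have [sK vK] := Yp K (L0 _ _ tK); have [sL vL] := Yp L (L0 _ _ tL).
  pose D i s := Y K i s - Y L i s.
  have [C [C0 AC]] := family_bounded_on_segment `|t| Ac.
  have Dd (s : R) : `|s| <= `|t| -> forall i,
      is_derive s 1 (D i) (\sum_j A i j s * D j s + 0).
    move=> st i; apply: der_eq (derB (sK s i) (sL s i)) _.
    rewrite addr0 -sumrB; apply: eq_bigr => j _.
    rewrite /A' !clamp_id ?mulrBr //.
      exact: le_trans st (ltW tL).
    exact: le_trans st (ltW tK).
  have h00 (i : 'I_m) (s : R) : `|s| <= `|t| -> `|0 : R| <= 0 by rewrite normr0.
  have := @system_gronwall A D (fun _ _ => 0) C 0 `|t| C0 (lexx _) Dd AC h00 _ (lexx _).
  rewrite expr0n /= mulr0 mul0r addr0.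
  have -> : \sum_i D i 0 ^+ 2 = 0.
    by rewrite big1 // => i _; rewrite /D vK vL subrr expr0n.
  rewrite mul0r => h; have : D k t ^+ 2 <= 0.
    apply: le_trans h; rewrite (bigD1 k) //= lerDl sumr_ge0 // => i _.
    exact: sqr_ge0.
  rewrite le_eqVlt ltNge sqr_ge0 orbF sqrf_eq0 subr_eq0.
  by move/eqP.
pose y k s := Y (`|s| + 1) k s.
have yE k (L t : R) : `|t| < L -> y k t = Y L k t.
  by move=> tL; apply: YE => //; rewrite ltrDl.
exists y; split=> [t k|k]; last by rewrite /y normr0 add0r; exact: (Yp 1 _).2.
apply: (@glue_derivable _ (fun L => Y L k) (fun t => \sum_j A k j t * y j t)).
  by move=> K L s sK sL; exact: YE.
move=> L s sL; apply: der_eq ((Yp L (L0 _ _ sL)).1 s k) _.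
by apply: eq_bigr => j _; rewrite /A' clamp_id ?(ltW sL) // (yE _ _ _ sL).
Qed.

Lemma ode_exists A (v : 'I_m -> R) (t0 : R) : (forall k j, continuous (A k j)) ->
  exists y, solves A y /\ forall k, y k t0 = v k.
Proof.
move=> Ac.
have sd (a s : R) : is_derive s 1 (fun s : R => s + a) 1.
  by have := derD (is_derive_id s (1 : R)) (der_cst a s (1 : R)); rewrite addr0.
have [|y [ys yv]] := @ode_exists0 (fun k j s => A k j (s + t0)) v.
  move=> k j s.
  exact: (continuous_comp (is_derive_continuous (sd t0 s)) (Ac k j _)).
exists (fun k s => y k (s - t0)); split=> [t k|k]; last by rewrite subrr.
apply: der_eq (is_derive1_comp (ys _ _) (sd (- t0) t)) _.
by rewrite mulr1 subrK.
Qed.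

End LinearODETheory.

(** * Uniform linear approximation *)

Section LinearApproximation.
Variable R : realType.

Lemma is_deriveP (f : R -> R) (x d : R) : is_derive x 1 f d <->
  forall e, 0 < e -> \forall x' \near x,
    `|f x' - f x - (x' - x) * d| <= e * `|x' - x|.
Proof.
have quotE h : h != 0 -> `|d - h^-1 *: ((f \o shift x) (h *: 1) - f x)| =
    `|f (x + h) - f x - h * d| / `|h|.
  move=> h0; rewrite -normf_div -normrN /GRing.scale /= mulr1 [h + x]addrC.
  by congr (`| _ |); field.
split=> [fd e e0|H].
  have /cvgrPdist_le /(_ e e0) :
      (fun h => h^-1 *: ((f \o shift x) (h *: 1) - f x)) @ 0^' --> d.
    by have [df <-] := fd.
  rewrite near_withinE => /nbhs_ballP [del /= del0 Hd].
  apply/nbhs_ballP; exists del => //= x' xd.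
  have [->|h0] := eqVneq x' x; first by rewrite !subrr mul0r subrr normr0 mulr0.
  rewrite -subr_eq0 in h0; have := Hd (x' - x).
  rewrite /ball /= sub0r normrN distrC => /(_ xd h0).
  by rewrite quotE // [x + _]addrC subrK ler_pdivrMr ?normr_gt0 // [`|x - x'|]distrC.
have dc : (fun h => h^-1 *: ((f \o shift x) (h *: 1) - f x)) @ 0^' --> d.
  apply/cvgrPdist_le => e e0; have /nbhs_ballP [del /= del0 Hd] := H e e0.
  rewrite near_withinE; apply/nbhs_ballP; exists del => //= h.
  rewrite /ball /= sub0r normrN => hd h0; rewrite quotE //.
  rewrite ler_pdivrMr ?normr_gt0 //; have := Hd (x + h).
  by rewrite [x + h - x]addrC addKr; apply; rewrite /ball /= opprD addNKr normrN.
apply: DeriveDef; first by apply/cvg_ex; exists d.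
by apply/cvg_lim.
Qed.

(** Joint continuity is uniform along a compact segment. *)
Lemma tube (f : R -> R -> R) (x a b e : R) :
  continuous (fun p : R * R => f p.1 p.2) -> 0 < e ->
  \forall x' \near x, forall y, a <= y <= b -> `|f x' y - f x y| <= e.
Proof.
move=> fc e0; have /compact_near_coveringP cov := @segment_compact R a b.
have e2 : 0 < e / 2 by rewrite divr_gt0.
have := cov R (nbhs x) (fun x' y => `|f x' y - f x y| <= e) _ _.
have H y : y \in `[a, b] -> \forall y' \near y & x' \near x, `|f x' y' - f x y'| <= e.
  move=> yab.
  have /cvgrPdist_le /(_ _ e2) [[U V] /= [Ux Vy] UV] := fc (x, y).
  exists (V, U) => // -[y' x'] /= [Vy' Ux'].
  have h1 := UV (x', y') (conj Ux' Vy').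
  have h2 := UV (x, y') (conj (nbhs_singleton Ux) Vy').
  rewrite /= in h1 h2.
  have -> : f x' y' - f x y' = (f x y - f x y') - (f x y - f x' y') by ring.
  by apply: le_trans (ler_normB _ _) _; lra.
move=> /(_ _ H); apply: filterS => x' h y yab.
by apply: h; rewrite /= in_itv.
Qed.

Lemma joint_continuousl (f : R -> R -> R) (x : R) :
  continuous (fun p : R * R => f p.1 p.2) -> continuous (f x).
Proof.
move=> fc y.
have pc : {for y, continuous (fun y : R => (x, y))}.
  by apply: (@cvg_pair _ _ _ (nbhs y) (nbhs x) (nbhs y)); [exact: cvg_cst|exact: cvg_id].
exact: (continuous_comp pc (fc (x, y))).
Qed.

Lemma joint_continuousr (f : R -> R -> R) (y : R) :
  continuous (fun p : R * R => f p.1 p.2) -> continuous (f^~ y).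
Proof.
move=> fc x.
have pc : {for x, continuous (fun x : R => (x, y))}.
  by apply: (@cvg_pair _ _ _ (nbhs x) (nbhs x) (nbhs y)); [exact: cvg_id|exact: cvg_cst].
exact: (continuous_comp pc (fc (x, y))).
Qed.

(** By the mean value theorem the remainder is the oscillation of fx times the
    increment, and [tube] bounds the oscillation uniformly in y. *)
Lemma uniform_expansion (f fx : R -> R -> R) (x a b e : R) :
  continuous (fun p : R * R => fx p.1 p.2) ->
  (forall x y : R, is_derive x 1 (f^~ y) (fx x y)) -> 0 < e ->
  \forall x' \near x, forall y, a <= y <= b ->
    `|f x' y - f x y - (x' - x) * fx x y| <= e * `|x' - x|.
Proof.
move=> fxc fd e0; have /nbhs_ballP [del /= del0 Hd] := @tube fx x a b e fxc e0.
apply/nbhs_ballP; exists del => //= x' xd y yab.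
have [c cx ->] : exists2 c, ball x del c & f x' y - f x y = fx c y * (x' - x).
  have [xx|xx] := leP x x'.
    have [c /andP[xc cx] e1] := mean_value xx (fun c _ => fd c y).
    exists c => //; move: xd; rewrite /ball /= !ler0_norm ?subr_le0 //.
    by apply: le_lt_trans; rewrite !opprB lerB.
  have [c /andP[xc cx] e1] := mean_value (ltW xx) (fun c _ => fd c y).
  exists c; last by rewrite -opprB e1 -mulrN opprB.
  move: xd; rewrite /ball /= !ger0_norm ?subr_ge0 // ?(ltW xx) //.
  by apply: le_lt_trans; rewrite lerB.
rewrite mulrC -mulrBr normrM mulrC ler_wpM2r //.
exact: (Hd c cx y yab).
Qed.

End LinearApproximation.

(** * Flat connections in the plane have parallel sections *)

Section FlatConnection.
Variables (R : realType) (m : nat).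
Variables A Ay B Bx : 'I_m -> 'I_m -> R -> R -> R.
Local Notation joint f := (continuous (fun p : R * R => f p.1 p.2)).
Hypotheses (Ac : forall k j, joint (A k j)) (Bc : forall k j, joint (B k j)).
Hypothesis Bxc : forall k j, joint (Bx k j).
Hypothesis Ad : forall k j (x y : R), is_derive y 1 (A k j x) (Ay k j x y).
Hypothesis Bd : forall k j (x y : R), is_derive x 1 ((B k j)^~ y) (Bx k j x y).
Hypothesis flat : forall k j x y,
  Bx k j x y + \sum_l B k l x y * A l j x y =
  Ay k j x y + \sum_l A k l x y * B l j x y.

Lemma sum_assoc (P Q : 'I_m -> R) (M : 'I_m -> 'I_m -> R) :
  \sum_j P j * (\sum_l M j l * Q l) = \sum_l (\sum_j P j * M j l) * Q l.
Proof.
under eq_bigr do rewrite mulr_sumr.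
rewrite exchange_big /=; apply: eq_bigr => l _; rewrite mulr_suml.
by apply: eq_bigr => j _; rewrite mulrA.
Qed.

Section Transport.
Variable S : 'I_m -> R -> R -> R.
Variable y0 : R.
Hypothesis Sy : forall k (x y : R),
  is_derive y 1 (S k x) (\sum_j B k j x y * S j x y).
Hypothesis Sx0 : forall k (x : R),
  is_derive x 1 ((S k)^~ y0) (\sum_j A k j x y0 * S j x y0).

Let T k x y := \sum_j A k j x y * S j x y.

(** T is the expected derivative of S in x. By flatness it solves the equation
    that arises from differentiating the equation of S in y with respect to
    x. *)
Let Ty k (x y : R) : is_derive y 1 (T k x)
  (\sum_j Bx k j x y * S j x y + \sum_j B k j x y * T j x y).
Proof.
apply: der_eq (der_sum _ (fun j => derM (Ad k j x y) (Sy j x y))) _.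
rewrite big_split /= {1}/T !sum_assoc -!big_split /=; apply: eq_bigr => j _.
by rewrite -!mulrDl flat.
Qed.

Let shift_der (a s : R) : is_derive s 1 (fun s : R => a + s) 1.
Proof. by apply: der_eq (derD (der_cst a s 1) (is_derive_id s 1)) _; exact: add0r. Qed.

(** The error of the linear approximation S + (x' - x) T of S at x' solves, as
    a function of y, a linear equation whose initial value and inhomogeneous
    term are small compared with x' - x. Gronwall's inequality shows that it
    stays so. *)
Lemma flat_transport k (x y : R) :
  is_derive x 1 ((S k)^~ y) (\sum_j A k j x y * S j x y).
Proof.
pose L := `|y - y0|; pose a := y0 - L; pose b := y0 + L.
have inL (s : R) : `|s| <= L -> a <= y0 + s <= b.
  by rewrite ler_norml /a /b !lerD2l.
have Sc j : continuous (S j x) by move=> s; exact: is_derive_continuous (Sy j x s).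
have Tc j : continuous (T j x) by move=> s; exact: is_derive_continuous (Ty j x s).
have shc (f : R -> R) : continuous f -> continuous (fun s => f (y0 + s)).
  move=> fc s.
  exact: (continuous_comp (is_derive_continuous (shift_der y0 s)) (fc _)).
have [C1 [C10 SC]] := @family_bounded_on_segment R 'I_m unit
  (fun j _ s => S j x (y0 + s)) L (fun j _ => shc _ (Sc j)).
have [C2 [C20 TC]] := @family_bounded_on_segment R 'I_m unit
  (fun j _ s => T j x (y0 + s)) L (fun j _ => shc _ (Tc j)).
have Bxc' i j : continuous (fun s => B i j x (y0 + s)).
  exact: shc (@joint_continuousl R (B i j) x (@Bc i j)).
have [K [K0 BK]] := family_bounded_on_segment L Bxc'.
apply/is_deriveP => e e0.
(* c and Q come from Gronwall's inequality for the error D below, and e'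
   absorbs Q. *)
pose c := 2 * m%:R * (K + 1) + 1.
pose Q := (m%:R + m%:R * (m%:R * (C1 + C2)) ^+ 2 / c) * expR (c * L).
have c0 : 0 < c by rewrite ltr_wpDl // !mulr_ge0 // addr_ge0.
have Q0 : 0 <= Q.
  rewrite mulr_ge0 ?expR_ge0 // addr_ge0 // divr_ge0 ?(ltW c0) //.
  by rewrite mulr_ge0 // exprn_ge0 // mulr_ge0 // addr_ge0.
pose e' := Num.min 1 (e / (Q + 1)).
have e'0 : 0 < e' by rewrite lt_min ltr01 divr_gt0 // ltr_wpDl.
have e'1 : e' <= 1 by rewrite ge_min lexx.
have e'e : e' * (Q + 1) <= e.
  by rewrite -ler_pdivlMr ?ltr_wpDl // ge_min lexx orbT.
have N1 : \forall x' \near x, forall k j (y : R), a <= y <= b ->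
    `|B k j x' y - B k j x y| <= e'.
  apply: (filter_forall (f := (fun k x' => forall j (y : R), a <= y <= b ->
    `|B k j x' y - B k j x y| <= e')) (nbhs_filter x)) => i.
  apply: (filter_forall (f := (fun j x' => forall y : R, a <= y <= b ->
    `|B i j x' y - B i j x y| <= e')) (nbhs_filter x)) => j.
  exact: (@tube R (B i j) x a b e').
have N2 : \forall x' \near x, forall k j (y : R), a <= y <= b ->
    `|B k j x' y - B k j x y - (x' - x) * Bx k j x y| <= e' * `|x' - x|.
  apply: (filter_forall (f := (fun k x' => forall j (y : R), a <= y <= b ->
    `|B k j x' y - B k j x y - (x' - x) * Bx k j x y| <= e' * `|x' - x|)) (nbhs_filter x)) => i.
  apply: (filter_forall (f := (fun j x' => forall y : R, a <= y <= b ->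
    `|B i j x' y - B i j x y - (x' - x) * Bx i j x y| <= e' * `|x' - x|)) (nbhs_filter x)) => j.
  exact: (@uniform_expansion R (B i j) (Bx i j) x a b e').
have N3 : \forall x' \near x, forall k,
    `|S k x' y0 - S k x y0 - (x' - x) * T k x y0| <= e' * `|x' - x|.
  apply: (filter_forall (f := (fun k x' =>
    `|S k x' y0 - S k x y0 - (x' - x) * T k x y0| <= e' * `|x' - x|)) (nbhs_filter x)) => i.
  exact: ((is_deriveP _ _ _).1 (Sx0 i x)).
near=> x'.
have M1 : forall k j (y : R), a <= y <= b -> `|B k j x' y - B k j x y| <= e'.
  by near: x'; exact: N1.
have M2 : forall k j (y : R), a <= y <= b ->
    `|B k j x' y - B k j x y - (x' - x) * Bx k j x y| <= e' * `|x' - x|.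
  by near: x'; exact: N2.
have M3 : forall k,
    `|S k x' y0 - S k x y0 - (x' - x) * T k x y0| <= e' * `|x' - x|.
  by near: x'; exact: N3.
set h := x' - x in M2 M3 *.
(* f is the inhomogeneous term of the equation that D solves. *)
pose D i s := S i x' (y0 + s) - S i x (y0 + s) - h * T i x (y0 + s).
pose f i s :=
  \sum_j (B i j x' (y0 + s) - B i j x (y0 + s) - h * Bx i j x (y0 + s))
     * S j x (y0 + s) +
  \sum_j (h * (B i j x' (y0 + s) - B i j x (y0 + s))) * T j x (y0 + s).
have Dd (s : R) : `|s| <= L -> forall i,
    is_derive s 1 (D i) (\sum_j B i j x' (y0 + s) * D j s + f i s).
  move=> _ i.
  have d1 := is_derive1_comp (Sy i x' (y0 + s)) (shift_der y0 s).
  have d2 := is_derive1_comp (Sy i x (y0 + s)) (shift_der y0 s).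
  have d3 := is_derive1_comp (Ty i x (y0 + s)) (shift_der y0 s).
  apply: der_eq (derB (derB d1 d2) (derZ h d3)) _.
  rewrite !mulr1 /f mulrDr !mulr_sumr -big_split /= -!sumrB -!big_split /=.
  by apply: eq_bigr => j _; rewrite /D; ring.
have BK' i j (s : R) : `|s| <= L -> `|B i j x' (y0 + s)| <= K + 1.
  move=> sL; rewrite -(subrK (B i j x (y0 + s)) (B i j x' _)) addrC.
  apply: le_trans (ler_normD _ _) _; apply: lerD; first exact: BK.
  by apply: le_trans e'1; apply: M1; exact: inL.
have fb i (s : R) : `|s| <= L -> `|f i s| <= m%:R * (C1 + C2) * (e' * `|h|).
  move=> sL; apply: le_trans (ler_normD _ _) _.
  have -> : m%:R * (C1 + C2) * (e' * `|h|) =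
    m%:R * (e' * `|h|) * C1 + m%:R * (e' * `|h|) * C2 by ring.
  have eh0 : 0 <= e' * `|h| by rewrite mulr_ge0 // ltW.
  apply: lerD; apply: sum_bound => // j.
  - by apply: M2; exact: inL.
  - exact: (SC j tt).
  - by rewrite normrM mulrC ler_wpM2r // M1 // inL.
  - exact: (TC j tt).
have eta0 : 0 <= m%:R * (C1 + C2) * (e' * `|h|).
  by rewrite !mulr_ge0 // ?addr_ge0 // ltW.
have K10 : 0 <= K + 1 by rewrite addr_ge0.
have := @system_gronwall _ _ (fun i j s => B i j x' (y0 + s)) D f (K + 1) _ L
  K10 eta0 Dd BK' fb (y - y0) (lexx _).
rewrite -/L -/c => G.
have D0 : \sum_i D i 0 ^+ 2 <= m%:R * (e' * `|h|) ^+ 2.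
  apply: (@le_trans _ _ (\sum_(i < m) (e' * `|h|) ^+ 2)).
    apply: ler_sum => i _; rewrite -real_normK ?num_real //.
    by rewrite lerXn2r ?nnegrE ?mulr_ge0 ?(ltW e'0) // /D addr0.
  by rewrite sumr_const card_ord -[leLHS]mulr_natl.
have DQ : D k (y - y0) ^+ 2 <= (e' * `|h|) ^+ 2 * Q.
  apply: (@le_trans _ _ (\sum_i D i (y - y0) ^+ 2)).
    rewrite (bigD1 k) //= lerDl sumr_ge0 // => i _; exact: sqr_ge0.
  apply: le_trans G _; rewrite /Q [leRHS]mulrA ler_wpM2r ?expR_ge0 //.
  have -> : (e' * `|h|) ^+ 2 * (m%:R + m%:R * (m%:R * (C1 + C2)) ^+ 2 / c) =
    m%:R * (e' * `|h|) ^+ 2 + m%:R * (m%:R * (C1 + C2) * (e' * `|h|)) ^+ 2 / c.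
    by field; rewrite gt_eqF.
  by rewrite lerD2r.
have : `|D k (y - y0)| <= e' * `|h| * (Q + 1).
  rewrite -ler_sqr ?nnegrE ?mulr_ge0 ?(ltW e'0) ?addr_ge0 //.
  rewrite real_normK ?num_real //; apply: le_trans DQ _.
  by rewrite [leRHS]exprMn ler_wpM2l ?sqr_ge0 //; nra.
rewrite /D subrKC => /le_trans; apply.
by rewrite mulrAC ler_wpM2r.
Unshelve. all: by end_near.
Qed.

(** Gronwall's inequality along y, with coefficients that near x differ by at
    most 1 from those at x. *)
Lemma transport_bounded (x L : R) : exists C, \forall x' \near x,
  forall k s, `|s| <= L -> `|S k x' (y0 + s)| <= C.
Proof.
have shc (f : R -> R) : continuous f -> continuous (fun s => f (y0 + s)).
  move=> fc s.
  exact: (continuous_comp (is_derive_continuous (shift_der y0 s)) (fc _)).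
have Bxc' i j : continuous (fun s => B i j x (y0 + s)).
  exact: shc (@joint_continuousl R (B i j) x (@Bc i j)).
have [K [K0 BK]] := family_bounded_on_segment L Bxc'.
pose Q := (\sum_i (`|S i x y0| + 1) ^+ 2 + m%:R * 0 ^+ 2 / (2 * m%:R * (K + 1) + 1))
  * expR ((2 * m%:R * (K + 1) + 1) * L).
have N1 : \forall x' \near x, forall k j (y : R), y0 - L <= y <= y0 + L ->
    `|B k j x' y - B k j x y| <= 1.
  apply: (filter_forall (f := (fun k x' => forall j (y : R), y0 - L <= y <= y0 + L ->
    `|B k j x' y - B k j x y| <= 1)) (nbhs_filter x)) => i.
  apply: (filter_forall (f := (fun j x' => forall y : R, y0 - L <= y <= y0 + L ->
    `|B i j x' y - B i j x y| <= 1)) (nbhs_filter x)) => j.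
  exact: (@tube R (B i j) x (y0 - L) (y0 + L) 1).
have N2 : \forall x' \near x, forall k, `|S k x' y0| <= `|S k x y0| + 1.
  apply: (filter_forall (f := fun k x' => `|S k x' y0| <= `|S k x y0| + 1)
    (nbhs_filter x)) => i.
  have Sc := is_derive_continuous (Sx0 i x).
  have nc : {for x, continuous (fun x' => `|S i x' y0|)}.
    exact: (continuous_comp Sc (@norm_continuous _ R _)).
  by apply: (cvgr_le _ nc); rewrite ltrDl.
exists (Q + 1); near=> x' => k s sL.
have M1 : forall k j (y : R), y0 - L <= y <= y0 + L ->
    `|B k j x' y - B k j x y| <= 1 by near: x'.
have M2 : forall k, `|S k x' y0| <= `|S k x y0| + 1 by near: x'.
have BK' i j (z : R) : `|z| <= L -> `|B i j x' (y0 + z)| <= K + 1.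
  move=> tL; rewrite -(subrK (B i j x (y0 + z)) (B i j x' _)) addrC.
  apply: le_trans (ler_normD _ _) _; apply: lerD; first exact: BK.
  by apply: M1; move: tL; rewrite ler_norml !lerD2l.
have Sd (z : R) : `|z| <= L -> forall i, is_derive z 1 (fun s => S i x' (y0 + s))
    (\sum_j B i j x' (y0 + z) * S j x' (y0 + z) + 0).
  move=> _ i; rewrite addr0.
  apply: der_eq (is_derive1_comp (Sy i x' (y0 + z)) (shift_der y0 z)) _.
  exact: mulr1.
have h00 (i : 'I_m) (z : R) : `|z| <= L -> `|0 : R| <= 0 by rewrite normr0.
have K10 : 0 <= K + 1 by rewrite addr_ge0.
have G := @system_gronwall _ _ (fun i j s => B i j x' (y0 + s))
  (fun i s => S i x' (y0 + s)) (fun _ _ => 0) (K + 1) 0 L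
  K10 (lexx _) Sd BK' h00 s sL.
have c0 : 0 <= 2 * m%:R * (K + 1) + 1 by rewrite addr_ge0 // !mulr_ge0.
have SQ : S k x' (y0 + s) ^+ 2 <= Q.
  apply: (@le_trans _ _ (\sum_i S i x' (y0 + s) ^+ 2)).
    rewrite (bigD1 k) //= lerDl sumr_ge0 // => i _; exact: sqr_ge0.
  apply: le_trans G _; rewrite /Q expr0n /= mulr0 mul0r !addr0.
  apply: ler_pM.
  - by apply: sumr_ge0 => i _; exact: sqr_ge0.
  - exact: expR_ge0.
  - apply: ler_sum => i _; rewrite -real_normK ?num_real //.
    by rewrite lerXn2r ?nnegrE ?addr_ge0.
  - by rewrite ler_expR ler_wpM2l.
have Q0 : 0 <= Q by apply: le_trans SQ; exact: sqr_ge0.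
rewrite -ler_sqr ?nnegrE ?addr_ge0 // real_normK ?num_real //.
by apply: le_trans SQ _; nra.
Unshelve. all: by end_near.
Qed.

(** S is continuous in x for fixed y, and Lipschitz in y with a constant that
    is uniform near x. *)
Lemma transport_continuous k : continuous (fun p : R * R => S k p.1 p.2).
Proof.
move=> [x y].
have Scx : {for x, continuous ((S k)^~ y)}.
  exact: is_derive_continuous (flat_transport k x y).
pose L := `|y - y0| + 1.
have [C SC] := transport_bounded x L.
have shc (f : R -> R) : continuous f -> continuous (fun s => f (y0 + s)).
  move=> fc s.
  exact: (continuous_comp (is_derive_continuous (shift_der y0 s)) (fc _)).
have Bxc' i j : continuous (fun s => B i j x (y0 + s)).
  exact: shc (@joint_continuousl R (B i j) x (@Bc i j)).
have [K [K0 BK]] := family_bounded_on_segment L Bxc'.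
have N1 : \forall x' \near x, forall k j (y : R), y0 - L <= y <= y0 + L ->
    `|B k j x' y - B k j x y| <= 1.
  apply: (filter_forall (f := (fun k x' => forall j (y : R), y0 - L <= y <= y0 + L ->
    `|B k j x' y - B k j x y| <= 1)) (nbhs_filter x)) => i.
  apply: (filter_forall (f := (fun j x' => forall y : R, y0 - L <= y <= y0 + L ->
    `|B i j x' y - B i j x y| <= 1)) (nbhs_filter x)) => j.
  exact: (@tube R (B i j) x (y0 - L) (y0 + L) 1).
have C0 : 0 <= `|C| by [].
pose M := m%:R * (K + 1) * `|C| + 1.
have M0 : 0 < M by rewrite ltr_wpDl // !mulr_ge0 // addr_ge0.
apply/cvgrPdist_le => e e0.
have e2 : 0 < e / 2 by rewrite divr_gt0.
have /cvgrPdist_le /(_ _ e2) N2 := Scx.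
have N3 : \forall y' \near y, `|y - y'| <= Num.min 1 (e / 2 / M).
  have d0 : 0 < Num.min 1 (e / 2 / M) by rewrite lt_min ltr01 divr_gt0.
  by apply/nbhs_ballP; exists (Num.min 1 (e / 2 / M)) => //= y' /ltW.
have N4 : \forall x' \near x, `|S k x y - S k x' y| <= e / 2 /\
    (forall k j (y : R), y0 - L <= y <= y0 + L ->
      `|B k j x' y - B k j x y| <= 1) /\
    (forall k s, `|s| <= L -> `|S k x' (y0 + s)| <= C).
  by near=> x'; split; [near: x'|split; near: x'].
exists ([set x' | `|S k x y - S k x' y| <= e / 2 /\
    (forall k j (y : R), y0 - L <= y <= y0 + L ->
      `|B k j x' y - B k j x y| <= 1) /\
    (forall k s, `|s| <= L -> `|S k x' (y0 + s)| <= C)],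
  [set y' | `|y - y'| <= Num.min 1 (e / 2 / M)]) => //=.
move=> [x' y'] /= [[h1 [h2 h3]]]; rewrite le_min => /andP[y1 y2].
have lip : `|S k x' y - S k x' y'| <= M * `|y - y'|.
  have [c cy ->] : exists2 c, `|c - y0| <= L &
      `|S k x' y - S k x' y'| = `|\sum_j B k j x' c * S j x' c| * `|y - y'|.
    have between c : `|c - y| <= `|y - y'| -> `|c - y0| <= L.
      move=> cy; have -> : c - y0 = (c - y) + (y - y0) by ring.
      apply: le_trans (ler_normD _ _) _; rewrite /L addrC lerD2l.
      exact: le_trans cy y1.
    have [yy|yy] := leP y' y.
      have [c /andP[c1 c2] e1] := mean_value yy (fun c _ => Sy k x' c).
      exists c; last by rewrite e1 normrM.
      by apply: between; rewrite ler0_norm ?subr_le0 // ger0_norm ?subr_ge0 //; lra.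
    have [c /andP[c1 c2] e1] := mean_value (ltW yy) (fun c _ => Sy k x' c).
    exists c; last by rewrite distrC e1 normrM [`|y' - y|]distrC.
    apply: between; rewrite [`|y - y'|]distrC ger0_norm ?subr_ge0 //.
    by rewrite ger0_norm ?subr_ge0 ?(ltW yy) //; lra.
  rewrite ler_wpM2r // /M.
  apply: le_trans (_ : _ <= m%:R * (K + 1) * `|C|) _; last by rewrite lerDl.
  have cE : y0 + (c - y0) = c by rewrite addrC subrK.
  apply: sum_bound => [|j|j]; first by rewrite addr_ge0.
    rewrite -(subrK (B k j x c) (B k j x' c)) addrC.
    apply: le_trans (ler_normD _ _) _; apply: lerD.
      by rewrite -cE; exact: BK.
    by apply: h2; rewrite -cE !lerD2l -ler_norml.
  by rewrite -cE; apply: le_trans (h3 _ _ cy) (ler_norm _).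
have -> : S k x y - S k x' y' = (S k x y - S k x' y) + (S k x' y - S k x' y') by ring.
apply: le_trans (ler_normD _ _) _.
have : M * `|y - y'| <= e / 2 by rewrite mulrC -ler_pdivlMr.
by move: lip; lra.
Unshelve. all: by end_near.
Qed.

End Transport.

(** The value v is transported along the horizontal line through (x0, y0) and
    then along all vertical lines; by [flat_transport] the result is parallel
    in the horizontal direction everywhere. *)
Theorem parallel_section (x0 y0 : R) (v : 'I_m -> R) :
  exists S : 'I_m -> R -> R -> R, [/\ forall k, S k x0 y0 = v k,
    forall k, continuous (fun p : R * R => S k p.1 p.2),
    forall k (x y : R), is_derive x 1 ((S k)^~ y) (\sum_j A k j x y * S j x y) &
    forall k (x y : R), is_derive y 1 (S k x) (\sum_j B k j x y * S j x y)].
Proof.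
have [phi [phis phi0]] := @ode_exists _ _ (fun k j x => A k j x y0) v x0
  (fun k j => @joint_continuousr R (A k j) _ (@Ac k j)).
have /choice [psi psiP] := fun x => @ode_exists _ _ (fun k j y => B k j x y)
  (fun k => phi k x) y0 (fun k j => @joint_continuousl R (B k j) _ (@Bc k j)).
pose S k x y := psi x k y.
have S0 k x : S k x y0 = phi k x by exact: (psiP x).2.
have Sy k (x y : R) : is_derive y 1 (S k x) (\sum_j B k j x y * S j x y).
  exact: (psiP x).1.
have Sx0 k (x : R) : is_derive x 1 ((S k)^~ y0) (\sum_j A k j x y0 * S j x y0).
  rewrite (_ : (S k)^~ y0 = phi k); last by apply/funext => s; exact: S0.
  by under eq_bigr do rewrite S0; exact: phis.
exists S; split=> [k|k|k x y|//]; first by rewrite S0.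
- exact: (transport_continuous Sy Sx0).
- exact: (flat_transport Sy Sx0).
Qed.

End FlatConnection.

(** The chain rule along a curve. The increment in the first variable is
    expanded with [uniform_expansion], since the second variable moves as
    well. *)
Lemma der_curve (R : realType) (f fx : R -> R -> R) (fy : R) (u v : R -> R)
    (t du dv : R) :
  continuous (fun p : R * R => fx p.1 p.2) ->
  (forall x y : R, is_derive x 1 (f^~ y) (fx x y)) ->
  is_derive (v t) 1 (f (u t)) fy ->
  is_derive t 1 u du -> is_derive t 1 v dv ->
  is_derive t 1 (fun s => f (u s) (v s)) (fx (u t) (v t) * du + fy * dv).
Proof.
move=> fxc fd fyd ud vd.
(* What remains after D is the increment in the second variable, a function of
   one variable along the curve. *)
pose D s := f (u s) (v s) - f (u t) (v s).
suff Dd : is_derive t 1 D (fx (u t) (v t) * du).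
  apply: (der_ext _ (derD Dd (is_derive1_comp fyd vd))) => s.
  by rewrite /D /= subrK.
apply/is_deriveP => e e0.
pose q := fx (u t) (v t); pose N := `|du| + `|q| + 2.
have N0 : 0 < N by rewrite ltr_wpDl // addr_ge0.
pose e' := Num.min 1 (e / N / 2).
have e'0 : 0 < e' by rewrite lt_min ltr01 !divr_gt0.
have e'1 : e' <= 1 by rewrite ge_min lexx.
have e'e : e' * N * 2 <= e.
  by rewrite -!ler_pdivlMr // ge_min [e / 2 / N]mulrAC lexx orbT.
have uc := is_derive_continuous ud; have vc := is_derive_continuous vd.
have E1 := uc _ (@uniform_expansion R f fx (u t) (v t - 1) (v t + 1) e' fxc fd e'0).
have E2 : \forall s \near t, v t - 1 <= v s <= v t + 1.
  have /cvgrPdist_le /(_ 1 ltr01) := vc.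
  by apply: filterS => s; rewrite ler_distl => /andP[? ?]; apply/andP; split; lra.
have E3 : \forall s \near t, `|fx (u t) (v s) - q| <= e'.
  have fc : {for t, continuous (fun s => fx (u t) (v s))}.
    exact: (continuous_comp vc (@joint_continuousl _ fx (u t) fxc (v t))).
  have /cvgrPdist_le /(_ _ e'0) := fc.
  by apply: filterS => s; rewrite distrC.
have E4 := (is_deriveP _ _ _).1 ud _ e'0.
near=> s.
have h1 : forall y, v t - 1 <= y <= v t + 1 ->
  `|f (u s) y - f (u t) y - (u s - u t) * fx (u t) y| <= e' * `|u s - u t|.
  by near: s; exact: E1.
have h2 : v t - 1 <= v s <= v t + 1 by near: s; exact: E2.
have h3 : `|fx (u t) (v s) - q| <= e' by near: s; exact: E3.
have h4 : `|u s - u t - (s - t) * du| <= e' * `|s - t| by near: s; exact: E4.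
have {}h1 := h1 _ h2.
have h5 : `|u s - u t| <= (`|du| + 1) * `|s - t|.
  have -> : u s - u t = (u s - u t - (s - t) * du) + (s - t) * du by ring.
  apply: le_trans (ler_normD _ _) _; rewrite normrM.
  have -> : (`|du| + 1) * `|s - t| = `|s - t| + `|s - t| * `|du| by ring.
  by rewrite lerD2r; apply: le_trans h4 _; rewrite ler_piMl.
have -> : D s - D t - (s - t) * (q * du) =
  (f (u s) (v s) - f (u t) (v s) - (u s - u t) * fx (u t) (v s)) +
  ((u s - u t) * (fx (u t) (v s) - q) + q * (u s - u t - (s - t) * du)).
  by rewrite /D; ring.
apply: le_trans (ler_normD _ _) _.
apply: le_trans (lerD h1 (ler_normD _ _)) _; rewrite !normrM.
have a1 : `|u s - u t| * `|fx (u t) (v s) - q| <= e' * `|u s - u t|.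
  by rewrite mulrC ler_wpM2r.
have a2 : `|q| * `|u s - u t - (s - t) * du| <= `|q| * (e' * `|s - t|).
  by rewrite ler_wpM2l.
have a3 : e' * `|u s - u t| <= e' * ((`|du| + 1) * `|s - t|).
  by rewrite ler_wpM2l // ltW.
have a4 : e' * N * 2 * `|s - t| <= e * `|s - t| by rewrite ler_wpM2r.
have a5 : 0 <= `|q| * (e' * `|s - t|) by rewrite !mulr_ge0 // ltW.
have a6 : 0 <= e' * `|s - t| by rewrite mulr_ge0 // ltW.
have a7 : e' * N * 2 * `|s - t| = 2 * (e' * ((`|du| + 1) * `|s - t|)) +
  2 * (`|q| * (e' * `|s - t|)) + 2 * (e' * `|s - t|) by rewrite /N; ring.
by rewrite a7 in a4; lra.
Unshelve. all: by end_near.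
Qed.

(** * A winding number obstruction *)

Section Winding.
Variable R : realType.

(** The supremum of the points at which P holds is one of them, and is the end
    of the interval. *)
Lemma interval_induction (P : R -> Prop) :
  (forall t0 : R, 0 <= t0 <= 1 ->
     \forall t \near t0, 0 <= t <= 1 -> (P t0 <-> P t)) ->
  P 0 -> P 1.
Proof.
move=> loc P0; pose A := [set t | 0 <= t <= 1 /\ P t]%classic.
have A0 : A 0 by rewrite /A /= lexx ler01.
have hA : has_sup A by split; [exists 0|exists 1 => t [/andP[_ ?] _]].
pose s := sup A.
have s01 : 0 <= s <= 1.
  rewrite (ub_le_sup _ A0) /=; last by case: hA.
  by apply: ge_sup; [case: hA|move=> t [/andP[_ ?] _]].
have /nbhs_ballP [del /= del0 H] := loc s s01.
have [t [t01 Pt] st] := sup_adherent del0 hA.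
have ts : t <= s by apply: ub_le_sup; [case: hA|].
have Ps : P s.
  apply/(H t) => //.
  by rewrite /ball /= ger0_norm ?subr_ge0 //; move: st; rewrite -/s; lra.
have [s1|s1] := eqVneq s 1; first by rewrite -s1.
have {}s1 : s < 1 by rewrite lt_neqAle s1; case/andP: s01.
pose t' := Num.min 1 (s + del / 2).
have st' : s < t' by rewrite lt_min s1 ltrDl divr_gt0.
have t'01 : 0 <= t' <= 1.
  by rewrite (le_trans _ (ltW st')) ?ge_min ?lexx //; case/andP: s01.
have Pt' : P t'.
  apply/(H t') => //; rewrite /ball /= ltr0_norm ?subr_lt0 // opprB.
  have : t' <= s + del / 2 by rewrite ge_min lexx orbT.
  by lra.
have : t' <= s by apply: ub_le_sup; [case: hA|split].
by rewrite leNgt st'.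
Qed.

Lemma atan_polar (d c : R) : 0 < d ->
  exists2 r, 0 < r & d = r * cos (atan (c / d)) /\ c = r * sin (atan (c / d)).
Proof.
move=> d0; set a := atan _.
have c0 : 0 < cos a by apply: cos_gt0_pihalf; rewrite atan_gtNpi2 atan_ltpi2.
exists (d / cos a); first by rewrite divr_gt0.
split; first by rewrite divfK // gt_eqF.
have : tan a = c / d by rewrite atanK.
rewrite /tan => e; rewrite -mulrA [_^-1 * _]mulrC e; field.
by rewrite gt_eqF.
Qed.

(** L is an argument of the nonzero complex number a + i b. *)
Definition polar (a b L : R) : Prop :=
  exists2 r, 0 < r & a = r * cos L /\ b = r * sin L.

(** Between two vectors with positive inner product the angle is the arctangent
    of their cross product over their inner product. It depends continuously on
    them, so that continuous arguments can be carried along. *)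
Lemma polar_step (a b a' b' L : R) : polar a b L -> 0 < a * a' + b * b' ->
  polar a' b' (L + atan ((a * b' - b * a') / (a * a' + b * b'))).
Proof.
move=> [r r0 [aE bE]] d0; have [q q0 [dE cE]] := atan_polar (a * b' - b * a') d0.
set al := atan _ in dE cE *; exists (q / r); first by rewrite divr_gt0.
have cs := cos2Dsin2 L.
rewrite cosD sinD; split.
  have -> : q / r * (cos L * cos al - sin L * sin al) =
    (cos L * (q * cos al) - sin L * (q * sin al)) / r by field; rewrite gt_eqF.
  rewrite -dE -cE aE bE.
  have -> : cos L * (r * cos L * a' + r * sin L * b') -
    sin L * (r * cos L * b' - r * sin L * a') = r * a' * (cos L ^+ 2 + sin L ^+ 2).
    by ring.
  by rewrite cs; field; rewrite gt_eqF.
have -> : q / r * (sin L * cos al + cos L * sin al) =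
  (sin L * (q * cos al) + cos L * (q * sin al)) / r by field; rewrite gt_eqF.
rewrite -dE -cE aE bE.
have -> : sin L * (r * cos L * a' + r * sin L * b') +
  cos L * (r * cos L * b' - r * sin L * a') = r * b' * (cos L ^+ 2 + sin L ^+ 2).
  by ring.
by rewrite cs; field; rewrite gt_eqF.
Qed.

Section Loops.
Variables H1 H2 : R -> R -> R.
Hypothesis H1c : continuous (fun p : R * R => H1 p.1 p.2).
Hypothesis H2c : continuous (fun p : R * R => H2 p.1 p.2).
Hypothesis H1p : forall t th, H1 t (th + 2 * pi) = H1 t th.
Hypothesis H2p : forall t th, H2 t (th + 2 * pi) = H2 t th.
Hypothesis Hn0 : forall t th, 0 <= t <= 1 -> 0 < H1 t th ^+ 2 + H2 t th ^+ 2.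

(** The loop at radius t has a periodic continuous argument, which expresses
    that its winding number is zero. *)
Let null (t : R) : Prop := exists L : R -> R,
  [/\ continuous L, forall th, L (th + 2 * pi) = L th &
      forall th, polar (H1 t th) (H2 t th) (L th)].

Lemma continuous_atan_quotient (f h : R -> R) : continuous f -> continuous h ->
  (forall x, 0 < h x) -> continuous (fun x => atan (f x / h x)).
Proof.
move=> fc hc h0 x.
have qc : {for x, continuous (fun x => f x / h x)}.
  apply: contM; first exact: fc.
  by apply: cvgV; [rewrite gt_eqF|exact: hc].
exact: (continuous_comp qc (@continuous_atan R _)).
Qed.

Lemma null_step (t t' : R) :
  (forall th, 0 < H1 t th * H1 t' th + H2 t th * H2 t' th) -> null t -> null t'.
Proof.
move=> d0 [L [Lc Lp LP]].
have c1 s : continuous (H1 s) := @joint_continuousl _ H1 s H1c.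
have c2 s : continuous (H2 s) := @joint_continuousl _ H2 s H2c.
exists (fun th => L th + atan ((H1 t th * H2 t' th - H2 t th * H1 t' th) /
  (H1 t th * H1 t' th + H2 t th * H2 t' th))); split.
- move=> th; apply: contD; first exact: Lc.
  apply: continuous_atan_quotient => // x.
  + exact: (contB (contM (c1 t x) (c2 t' x)) (contM (c2 t x) (c1 t' x))).
  + exact: (contD (contM (c1 t x) (c1 t' x)) (contM (c2 t x) (c2 t' x))).
- by move=> th; rewrite Lp !H1p !H2p.
- by move=> th; exact: polar_step.
Qed.

Lemma periodic_reduce (f : R -> R) : (forall th, f (th + 2 * pi) = f th) ->
  (forall th, 0 <= th <= 2 * pi -> 0 < f th) -> forall th, 0 < f th.
Proof.
move=> fp f0 th.
have pp : 0 < 2 * pi :> R by rewrite mulr_gt0 // pi_gt0.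
have fn (n : nat) x : f (x + n%:R * (2 * pi)) = f x.
  elim: n x => [|n IHn] x; first by rewrite mul0r addr0.
  by rewrite -natr1 mulrDl mul1r addrA fp IHn.
have fz (z : int) x : f (x + z%:~R * (2 * pi)) = f x.
  case: z => n; first exact: fn.
  by rewrite NegzE mulrNz mulNr -(fn n.+1) subrK.
pose z := Num.floor (th / (2 * pi)).
rewrite -(fz (- z)); apply: f0; rewrite mulrNz mulNr subr_ge0 lerBlDr.
have /andP[z1 z2] := floor_itv (th / (2 * pi)).
rewrite -/z ler_pdivlMr // in z1; rewrite -/z ltr_pdivrMr // intrD mulrDl mul1r in z2.
by rewrite z1 addrC ltW.
Qed.

(** Loops at nearby radii have positive inner product, uniformly in the angle
    by compactness, and [null_step] applies in both directions. *)
Lemma null_one : null 0 -> null 1.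
Proof.
apply: interval_induction => t0 t01.
have /compact_near_coveringP cov := @segment_compact R 0 (2 * pi).
have := cov R (nbhs t0) (fun t th => 0 < H1 t0 th * H1 t th + H2 t0 th * H2 t th) _ _.
have loc th : th \in `[0, 2 * pi] -> \forall th' \near th & t \near t0,
    0 < H1 t0 th' * H1 t th' + H2 t0 th' * H2 t th'.
  move=> _.
  have sc (p : R * R) : {for p, continuous (fun p : R * R => (p.2, p.1))}.
    by apply: (@cvg_pair _ _ _ (nbhs p) (nbhs p.2) (nbhs p.1));
      [exact: cvg_snd|exact: cvg_fst].
  have c1 (H : R -> R -> R) (p : R * R) : continuous (fun p : R * R => H p.1 p.2) ->
      {for p, continuous (fun p : R * R => H t0 p.1 * H p.2 p.1)}.
    move=> Hc; apply: contM.
      have fc : {for p, continuous (fun p : R * R => p.1)} by exact: cvg_fst.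
      exact: (continuous_comp fc (@joint_continuousl _ H t0 Hc p.1)).
    exact: (continuous_comp (sc p) (Hc (p.2, p.1))).
  have := contD (c1 H1 (th, t0) H1c) (c1 H2 (th, t0) H2c).
  by move=> /cvgr_gt; apply; rewrite /= -!expr2 Hn0.
move=> /(_ _ loc); apply: filterS => t h t1.
have {}h : forall th, 0 < H1 t0 th * H1 t th + H2 t0 th * H2 t th.
  apply: periodic_reduce => [th|th th0]; first by rewrite !H1p !H2p.
  by apply: h; rewrite /= in_itv.
split; first exact: null_step.
by apply: null_step => th; rewrite [H1 t th * _]mulrC [H2 t th * _]mulrC.
Qed.
End Loops.

(** Shrinking the circle to the centre of the disc shows that G has a periodic
    continuous argument on the circle, while - r u ^ 2 has none: the difference
    del between such an argument and twice the angle decreases by 4 pi around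
    the circle although its direction is constant. *)
Theorem no_disc_extension (G1 G2 : R -> R -> R) :
  continuous (fun p : R * R => G1 p.1 p.2) ->
  continuous (fun p : R * R => G2 p.1 p.2) ->
  (forall x y, x ^+ 2 + y ^+ 2 <= 1 -> 0 < G1 x y ^+ 2 + G2 x y ^+ 2) ->
  ~ (forall th, exists2 r, 0 < r &
       G1 (cos th) (sin th) = - r * cos (th + th) /\
       G2 (cos th) (sin th) = - r * sin (th + th)).
Proof.
move=> G1c G2c Gn0 Gth; pose a := G1 0 0; pose b := G2 0 0.
have ab0 : 0 < a ^+ 2 + b ^+ 2 by apply: Gn0; rewrite expr0n addr0 ler01.
(* G times the conjugate of G(0), in polar coordinates *)
pose H1 t th := G1 (t * cos th) (t * sin th) * a + G2 (t * cos th) (t * sin th) * b.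
pose H2 t th := G2 (t * cos th) (t * sin th) * a - G1 (t * cos th) (t * sin th) * b.
have pc (p : R * R) : {for p, continuous (fun p : R * R =>
    (p.1 * cos p.2, p.1 * sin p.2))}.
  have c1 : {for p, continuous (fun p : R * R => p.1)} by exact: cvg_fst.
  have c2 : {for p, continuous (fun p : R * R => p.2)} by exact: cvg_snd.
  apply: (@cvg_pair _ _ _ (nbhs p) (nbhs (p.1 * cos p.2)) (nbhs (p.1 * sin p.2))).
    exact: (contM c1 (continuous_comp c2 (@continuous_cos R p.2))).
  exact: (contM c1 (continuous_comp c2 (@continuous_sin R p.2))).
have Hc (G : R -> R -> R) : continuous (fun p : R * R => G p.1 p.2) ->
    continuous (fun p : R * R => G (p.1 * cos p.2) (p.1 * sin p.2)).
  move=> Gc p; exact: (continuous_comp (pc p) (Gc _)).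
have H1c : continuous (fun p : R * R => H1 p.1 p.2).
  move=> p; exact: (contD (contM (Hc G1 G1c p) (@cont_cst R _ a p))
    (contM (Hc G2 G2c p) (@cont_cst R _ b p))).
have H2c : continuous (fun p : R * R => H2 p.1 p.2).
  by move=> p; exact: (contB (contM (Hc G2 G2c p) (@cont_cst R _ a p))
    (contM (Hc G1 G1c p) (@cont_cst R _ b p))).
have cp (th : R) : cos (th + 2 * pi) = cos th by rewrite mulr_natl cosD2pi.
have sp (th : R) : sin (th + 2 * pi) = sin th by rewrite mulr_natl sinD2pi.
have [||t th t01||L [Lc Lp LP]] := @null_one H1 H2 H1c H2c.
- by move=> t th; rewrite /H1 cp sp.
- by move=> t th; rewrite /H2 cp sp.
- rewrite /H1 /H2; have := Gn0 (t * cos th) (t * sin th).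
  have -> : (t * cos th) ^+ 2 + (t * sin th) ^+ 2 = t ^+ 2.
    by rewrite !exprMn -mulrDr cos2Dsin2 mulr1.
  case/andP: t01 => t0 t1; rewrite expr_le1 // => /(_ t1).
  move: (G1 _ _) (G2 _ _) => u v uv0.
  have -> : (u * a + v * b) ^+ 2 + (v * a - u * b) ^+ 2 =
    (u ^+ 2 + v ^+ 2) * (a ^+ 2 + b ^+ 2) by ring.
  exact: mulr_gt0.
- exists (fun=> 0); split=> // [x|th]; first exact: cst_continuous.
  exists (a ^+ 2 + b ^+ 2) => //; rewrite /H1 /H2 !mul0r cos0 sin0 -/a -/b.
  by split; ring.
pose del th := L th - (th + th).
have delc : continuous del.
  move=> th; have ic : {for th, continuous (fun s : R => s)} by exact: cvg_id.
  exact: (contB (Lc th) (contD ic ic)).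
(* The direction of del is the constant vector (- a, b). *)
have dir th : exists q, 0 < q /\
    cos (del th) = - q * a /\ sin (del th) = q * b.
  have [r r0 [e1 e2]] := LP th; have [s s0 [g1 g2]] := Gth th.
  rewrite /H1 /H2 !mul1r g1 g2 in e1 e2.
  exists (s / r); split; first exact: divr_gt0.
  have cs := cos2Dsin2 (th + th).
  have cL : cos (L th) = (- s * cos (th + th) * a + - s * sin (th + th) * b) / r.
    by rewrite e1 mulrAC divff ?mul1r // gt_eqF.
  have sL : sin (L th) = (- s * sin (th + th) * a - - s * cos (th + th) * b) / r.
    by rewrite e2 mulrAC divff ?mul1r // gt_eqF.
  rewrite /del cosB sinB cL sL.
  move: cs; move: (cos (th + th)) (sin (th + th)) => u v uv; split.
    have -> : (- s * u * a + - s * v * b) / r * u +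
      (- s * v * a - - s * u * b) / r * v = - (s / r) * a * (u ^+ 2 + v ^+ 2).
      by field; rewrite gt_eqF.
    by rewrite uv mulr1.
  have -> : (- s * v * a - - s * u * b) / r * u -
    (- s * u * a + - s * v * b) / r * v = s / r * b * (u ^+ 2 + v ^+ 2).
    by field; rewrite gt_eqF.
  by rewrite uv mulr1.
have cos_pos th : 0 < cos (del th - del 0).
  have [q [q0 [c1 s1]]] := dir th; have [p [p0 [c2 s2]]] := dir 0.
  rewrite cosB c1 s1 c2 s2.
  have -> : - q * a * (- p * a) + q * b * (p * b) = q * p * (a ^+ 2 + b ^+ 2) by ring.
  by rewrite !mulr_gt0.
have pp : 0 < pi :> R by exact: pi_gt0.
have [c c1 c2] : exists2 c, c \in `[0, 2 * pi] & del c = del 0 - pi.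
  have d2 : del (2 * pi) = del 0 - 4 * pi.
    by rewrite /del -[in L _](add0r (2 * pi)) Lp; ring.
  apply: IVT; first by rewrite mulr_ge0 // ltW.
    exact: continuous_subspaceT.
  by rewrite d2 ge_min le_max; apply/andP; split; apply/orP; [right|left]; lra.
by have := cos_pos c; rewrite c2 addrAC subrr add0r cosN cospi; lra.
Qed.

End Winding.

(** * Calculus in a chart *)

Section PlaneCalculus.
Variable R : realType.
Local Notation V := 'rV[R]_2.
Implicit Types (f h : V -> R) (u v w : V).
Local Notation e_ i := (delta_mx 0 i : V).

Definition pt (x y : R) : V := \row_(j < 2) [:: x; y]`_j.

Lemma row2P u v : u 0 0 = v 0 0 -> u 0 1 = v 0 1 -> u = v.
Proof.
move=> h0 h1; apply/rowP => -[[|[|//]] j2].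
  by have -> : Ordinal j2 = 0 by exact: val_inj.
by have -> : Ordinal j2 = 1 by exact: val_inj.
Qed.

Lemma pt0 x y : pt x y 0 0 = x. Proof. by rewrite mxE. Qed.
Lemma pt1 x y : pt x y 0 1 = y. Proof. by rewrite mxE. Qed.

Lemma sum2 (A : nmodType) (F : 'I_2 -> A) : \sum_i F i = F 0 + F 1.
Proof.
rewrite big_ord_recl big_ord1; congr (F _ + F _); exact: val_inj.
Qed.

Lemma sum3 (A : nmodType) (F : 'I_3 -> A) :
  \sum_i F i = F ord0 + F (lift ord0 ord0) + F ord_max.
Proof.
rewrite !big_ord_recl big_ord0 addr0 addrA.
by congr (_ + _ + F _); exact: val_inj.
Qed.

Lemma ord2P (P : 'I_2 -> Prop) : P 0 -> P 1 -> forall i, P i.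
Proof.
move=> P0 P1 [[|[|//]] i2].
  by have -> : Ordinal i2 = 0 by exact: val_inj.
by have -> : Ordinal i2 = 1 by exact: val_inj.
Qed.

Lemma der_line (g : R -> V) f (t d : R) v :
  (forall h : R, g (h *: 1 + t) = h *: v + g t) ->
  is_derive (g t) v f d -> is_derive t 1 (f \o g) d.
Proof.
move=> gE [df <-].
have qE : (fun h : R => h^-1 *: (((f \o g) \o shift t) (h *: 1) - (f \o g) t)) =
    (fun h : R => h^-1 *: ((f \o shift (g t)) (h *: v) - f (g t))).
  by apply/funext => h /=; rewrite gE.
by apply: DeriveDef; rewrite /derivable /derive qE.
Qed.

Lemma der_pt0 f (x y d : R) :
  is_derive (pt x y) (e_ 0) f d -> is_derive x 1 (fun x => f (pt x y)) d.
Proof.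
apply: (@der_line (pt^~ y)) => h.
by apply: row2P; rewrite !mxE /= ?mulr1 ?mulr0 ?add0r // [h *: 1]mulr1.
Qed.

Lemma der_pt1 f (x y d : R) :
  is_derive (pt x y) (e_ 1) f d -> is_derive y 1 (fun y => f (pt x y)) d.
Proof.
apply: (@der_line (pt x)) => h.
by apply: row2P; rewrite !mxE /= ?mulr1 ?mulr0 ?add0r // [h *: 1]mulr1.
Qed.

Lemma pt_continuous : continuous (fun p : R * R => pt p.1 p.2).
Proof.
move=> p.
have -> : (fun p : R * R => pt p.1 p.2) = (fun p => p.1 *: e_ 0 + p.2 *: e_ 1).
  apply/funext => q; apply: row2P;
    by rewrite !mxE /= ?mulr1 ?mulr0 ?add0r ?addr0.
have f1 : {for p, continuous (fun p : R * R => p.1)} by exact: cvg_fst.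
have f2 : {for p, continuous (fun p : R * R => p.2)} by exact: cvg_snd.
by apply: cvgD; apply: cvgZr_tmp.
Qed.

Lemma joint_pt f : continuous f -> continuous (fun p : R * R => f (pt p.1 p.2)).
Proof. by move=> fc p; exact: (continuous_comp (@pt_continuous p) (fc _)). Qed.

Lemma der_coord (j : 'I_2) u v : is_derive u v (fun u => u 0 j) (v 0 j).
Proof.
have qE : {near 0^', (fun h : R => h^-1 *: (((fun u : V => u 0 j : R) \o shift u) (h *: v) -
    (u 0 j : R))) =1 fun=> v 0 j}.
  rewrite near_withinE; near=> h => h0 /=.
  by rewrite !mxE addrK /GRing.scale /= mulrA mulVf // mul1r.
have c : (fun h : R => h^-1 *: (((fun u : V => u 0 j : R) \o shift u) (h *: v) -
    (u 0 j : R))) @ 0^' --> v 0 j.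
  by apply: cvg_near_cst; move: qE; apply: filterS => h ->.
apply: DeriveDef; first by apply/cvg_ex; exists (v 0 j).
exact/cvg_lim.
Unshelve. all: by end_near. Qed.

Lemma derV f u v d : f u != 0 ->
  is_derive u v f d -> is_derive u v (fun u => (f u)^-1) (- d / f u ^+ 2).
Proof.
move=> f0 [fd <-]; have fdV := derivableV f0 fd.
have := deriveV f0 fd; rewrite /GRing.scale /= => e.
apply: DeriveDef; first exact: fdV.
by rewrite [LHS]e !mulNr mulrC.
Qed.

Lemma der_derivable f u v d : is_derive u v f d -> derivable f u v.
Proof. by case. Qed.

Lemma partialE f (i : 'I_2) (d : V -> R) :
  (forall u, is_derive u (e_ i) f (d u)) -> partial i f = d.
Proof. by move=> fd; apply/funext => u; rewrite /partial; have [_ ->] := fd u. Qed.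

Lemma Ck1_der f k (i : 'I_2) u : Ck k.+1 f -> is_derive u (e_ i) f (partial i f u).
Proof. by case=> _ /(_ i) [fd _]; exact: derivableP. Qed.

Lemma Ck_coord k (j : 'I_2) : Ck k (fun u : V => u 0 j).
Proof.
case: k => [|k]; split=> //; try exact: coord_continuous.
move=> i; split=> [u|]; first exact: (der_derivable (der_coord j u (e_ i))).
rewrite (partialE (fun u => der_coord j u (e_ i))).
exact: (Ck_cst 2 k (e_ i 0 j)).
Qed.

Lemma Ck_sum k (I : Type) (s : seq I) (F : I -> V -> R) :
  (forall i, Ck k (F i)) -> Ck k (fun u => \sum_(i <- s) F i u).
Proof.
move=> Fk; elim: s => [|i s IHs].
  rewrite (_ : (fun _ => _) = cst 0); first exact: Ck_cst.
  by apply/funext => u; rewrite big_nil.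
rewrite (_ : (fun _ => _) = F i \+ (fun u => \sum_(i <- s) F i u)).
  exact: CkD.
by apply/funext => u; rewrite big_cons.
Qed.

Lemma CkZ k (c : R) f : Ck k f -> Ck k (fun u => c * f u).
Proof. by move=> fk; exact: (CkM (Ck_cst 2 k c) fk). Qed.

Lemma CkN k f : Ck k f -> Ck k (fun u => - f u).
Proof.
move=> fk; rewrite (_ : (fun _ => _) = (fun u => -1 * f u)); first exact: CkZ.
by apply/funext => u; rewrite mulN1r.
Qed.

Lemma CkV k f : (forall u, f u != 0) -> Ck k f -> Ck k (fun u => (f u)^-1).
Proof.
move=> f0 fk; have fc : continuous f by case: k fk => [|k] [].
have Vc : continuous (fun u => (f u)^-1) by move=> u; exact: (cvgV (f0 u) (fc u)).
elim: k fk => [|k IHk] fk; split=> // i; have dV u := derV (f0 u) (Ck1_der i u fk).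
split=> [u|]; first exact: (der_derivable (dV u)).
rewrite (partialE dV).
have -> : (fun u => - partial i f u / f u ^+ 2) =
    (fun u => -1 * (partial i f u * ((f u)^-1 * (f u)^-1))).
  by apply/funext => u; rewrite mulN1r mulNr expr2 invfM.
have Dk : Ck k (partial i f) by case: fk => _ /(_ i) [].
have Vk := IHk (CkW fk).
exact: (CkZ (-1) (CkM Dk (CkM Vk Vk))).
Qed.

End PlaneCalculus.

(** * Functions on the sphere with a given differential at a point *)

Section TestFunctions.
Variable R : realType.
Local Notation V := 'rV[R]_2.
Local Notation e_ i := (delta_mx 0 i : V).
Implicit Types (u v w : V) (c : bool) (k : 'I_3).

Definition dot u v : R := u 0 0 * v 0 0 + u 0 1 * v 0 1.

(** Numerator of the k-th coordinate of the stereographic parametrisation, its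
    derivative in the direction v, and the second derivative. *)
Definition stereo_num c k u : R :=
  [:: 2 * u 0 0; 2 * u 0 1; (-1) ^+ (~~ c) * (dot u u - 1)]`_k.
Definition dstereo_num c k v u : R :=
  [:: 2 * v 0 0; 2 * v 0 1; (-1) ^+ (~~ c) * (2 * dot u v)]`_k.
Definition ddstereo_num c k v w : R := [:: 0; 0; (-1) ^+ (~~ c) * (2 * dot w v)]`_k.
Definition stereo_den u : R := dot u u + 1.

Lemma ord3P (P : 'I_3 -> Prop) :
  P ord0 -> P (lift ord0 ord0) -> P ord_max -> forall k, P k.
Proof.
move=> P0 P1 P2 [[|[|[|//]]] k3].
- by have -> : Ordinal k3 = ord0 by exact: val_inj.
- by have -> : Ordinal k3 = lift ord0 ord0 by exact: val_inj.
- by have -> : Ordinal k3 = ord_max by exact: val_inj.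
Qed.

Lemma stereo_den_neq0 u : stereo_den u != 0.
Proof. by rewrite gt_eqF // ltr_wpDl // addr_ge0 // -expr2 sqr_ge0. Qed.

Lemma sqnormE u : sqnorm u = dot u u.
Proof. by rewrite sqnorm2 !expr2. Qed.

Lemma stereo_vecE c u k : stereo_vec c u 0 k = stereo_num c k u * (stereo_den u)^-1.
Proof.
by rewrite mulrC /stereo_vec !mxE sqnormE.
Qed.

Lemma der_dotr w u v : is_derive u v (fun u => dot u w) (dot v w).
Proof.
have h := derD (derM (der_coord 0 u v) (der_cst (w 0 0) u v))
  (derM (der_coord 1 u v) (der_cst (w 0 1) u v)).
by apply: der_eq h _; rewrite !mulr0 !addr0.
Qed.

Lemma der_dot u v : is_derive u v (fun u => dot u u) (2 * dot u v).
Proof.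
have h := derD (derM (der_coord 0 u v) (der_coord 0 u v))
  (derM (der_coord 1 u v) (der_coord 1 u v)).
by apply: der_eq h _; rewrite /dot; ring.
Qed.

Lemma der_stereo_den u v : is_derive u v stereo_den (2 * dot u v).
Proof. by apply: der_eq (derD (der_dot u v) (der_cst 1 u v)) _; rewrite addr0. Qed.

Lemma der_stereo_num c k u v : is_derive u v (stereo_num c k) (dstereo_num c k v u).
Proof.
move: k; apply: ord3P.
- exact: (derZ 2 (der_coord 0 u v)).
- exact: (derZ 2 (der_coord 1 u v)).
apply: der_eq (derZ ((-1) ^+ (~~ c)) (derB (der_dot u v) (der_cst 1 u v))) _.
by rewrite subr0.
Qed.

Lemma der_dstereo_num c k v u w : is_derive u w (dstereo_num c k v) (ddstereo_num c k v w).
Proof.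
move: k; apply: ord3P; [exact: der_cst|exact: der_cst|].
exact: (derZ _ (derZ 2 (der_dotr v u w))).
Qed.

Definition stereo_coord c k u : R := stereo_num c k u * (stereo_den u)^-1.
Definition dstereo_coord c k v u : R :=
  dstereo_num c k v u * (stereo_den u)^-1 + stereo_num c k u * (- (2 * dot u v) / stereo_den u ^+ 2).

Lemma der_coordinate c k u v : is_derive u v (stereo_coord c k) (dstereo_coord c k v u).
Proof. exact: derM (der_stereo_num c k u v) (derV (stereo_den_neq0 u) (der_stereo_den u v)). Qed.

(** Symmetry of the second derivative, from its explicit form. *)
Lemma der_dstereo_coord_sym c k u v w (a b : R) :
  is_derive u w (dstereo_coord c k v) a -> is_derive u v (dstereo_coord c k w) b -> a = b.
Proof.
have D v' w' := derD (derM (der_dstereo_num c k v' u w') (derV (stereo_den_neq0 u) (der_stereo_den u w')))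
  (derM (der_stereo_num c k u w') (derM (derN (derZ 2 (der_dotr v' u w')))
     (derV (expf_neq0 2 (stereo_den_neq0 u)) (der_sqr (der_stereo_den u w'))))).
move=> ha hb; rewrite (der_unique ha (D v w)) (der_unique hb (D w v)).
have sym : ddstereo_num c k v w = ddstereo_num c k w v.
  by move: k {D ha hb}; apply: ord3P => //; rewrite /ddstereo_num /= /dot; ring.
rewrite sym; have dotC : dot w v = dot v w by rewrite /dot; ring.
by rewrite dotC; field; exact: stereo_den_neq0.
Qed.

(** Stereographic projection is conformal. *)
Lemma dstereo_coord_gram c u v w :
  \sum_k dstereo_coord c k v u * dstereo_coord c k w u = 4 * dot v w / stereo_den u ^+ 2.
Proof.
have d0 := stereo_den_neq0 u.
have c2 : ((-1) ^+ (~~ c) : R) ^+ 2 = 1 by rewrite sqrr_sign.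
rewrite sum3 /dstereo_coord /stereo_num /dstereo_num /=; set eps := (-1) ^+ _ in c2 *.
have -> : dot u u = stereo_den u - 1 by rewrite /stereo_den addrK.
set s := stereo_den u in d0 *.
have sE : u 0 0 ^+ 2 + u 0 1 ^+ 2 = s - 1 by rewrite /s /stereo_den addrK /dot !expr2.
have -> : (eps * (2 * dot u v) / s + eps * (s - 1 - 1) * (- (2 * dot u v) / s ^+ 2))
  * (eps * (2 * dot u w) / s + eps * (s - 1 - 1) * (- (2 * dot u w) / s ^+ 2)) =
  eps ^+ 2 * (16 * dot u v * dot u w / s ^+ 4) by field.
rewrite c2 mul1r.
have -> : (2 * v 0 0 / s + 2 * u 0 0 * (- (2 * dot u v) / s ^+ 2)) *
    (2 * w 0 0 / s + 2 * u 0 0 * (- (2 * dot u w) / s ^+ 2)) +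
  (2 * v 0 1 / s + 2 * u 0 1 * (- (2 * dot u v) / s ^+ 2)) *
    (2 * w 0 1 / s + 2 * u 0 1 * (- (2 * dot u w) / s ^+ 2)) =
  4 * dot v w / s ^+ 2 - 16 * dot u v * dot u w / s ^+ 3 +
  16 * (u 0 0 ^+ 2 + u 0 1 ^+ 2) * dot u v * dot u w / s ^+ 4.
  by rewrite /dot; field.
by rewrite sE; field.
Qed.

Definition linear_form (a : 'I_3 -> R) : sphere R -> R^o :=
  fun p => \sum_k a k * sval p 0 k.

Lemma linear_form_stereo a c :
  linear_form a \o stereo c = fun u => \sum_k a k * stereo_coord c k u.
Proof. by apply/funext => u; apply: eq_bigr => k _; rewrite stereo_vecE. Qed.

Lemma Ck_dot m : Ck m (fun u => dot u u).
Proof. by apply: CkD; apply: CkM; exact: Ck_coord. Qed.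

Lemma Ck_coordinate m c k : Ck m (stereo_coord c k).
Proof.
apply: CkM; last first.
  by apply: CkV; [exact: stereo_den_neq0|exact: (CkD (Ck_dot m) (Ck_cst 2 m 1))].
move: k; apply: ord3P.
- exact: (CkZ 2 (Ck_coord R m 0)).
- exact: (CkZ 2 (Ck_coord R m 1)).
- exact: (CkZ _ (CkD (Ck_dot m) (Ck_cst 2 m (-1)))).
Qed.

Lemma linear_form_smooth a : linear_form a \in @smooth_sphere R.
Proof.
apply/asboolP => c m; rewrite linear_form_stereo.
by apply: Ck_sum => k; apply: CkZ; exact: Ck_coordinate.
Qed.

Definition lform a : Csphere R := Smooth_fun (linear_form_smooth a).

Lemma partial_lform a c i :
  partial i (lform a \o stereo c) = fun u => \sum_k a k * dstereo_coord c k (e_ i) u.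
Proof.
apply: partialE => u; rewrite [lform a \o _]linear_form_stereo.
by apply: der_sum => k; apply: derZ; exact: der_coordinate.
Qed.

Lemma lform_hessian_sym a c u i j :
  partial i (partial j (lform a \o stereo c)) u =
  partial j (partial i (lform a \o stereo c)) u.
Proof.
have D i' j' k : is_derive u (e_ i') (dstereo_coord c k (e_ j'))
    (partial i' (dstereo_coord c k (e_ j')) u).
  apply: derivableP.
  have h := derD (derM (der_dstereo_num c k (e_ j') u (e_ i'))
      (derV (stereo_den_neq0 u) (der_stereo_den u (e_ i'))))
    (derM (der_stereo_num c k u (e_ i')) (derM (derN (derZ 2 (der_dotr (e_ j') u (e_ i'))))
     (derV (expf_neq0 2 (stereo_den_neq0 u)) (der_sqr (der_stereo_den u (e_ i')))))).
  exact: der_derivable h.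
have S i' j' : partial i' (partial j' (lform a \o stereo c)) u =
    \sum_k a k * partial i' (dstereo_coord c k (e_ j')) u.
  rewrite partial_lform; have := der_sum (index_enum _) (fun k => derZ (a k) (D i' j' k)).
  by case=> _.
rewrite !S; apply: eq_bigr => k _; congr (_ * _).
exact: der_dstereo_coord_sym (D i j k) (D j i k).
Qed.

(** By conformality the differential of the embedding at u, applied to e_ i and
    scaled, is a linear form on the ambient space whose pullback has the
    differential dx_i at u. Unlike the chart coordinate itself, it is a
    function on the whole sphere. *)
Definition test c u i : Csphere R :=
  lform (fun k => stereo_den u ^+ 2 / 4 * dstereo_coord c k (e_ i) u).

Lemma dot_delta (i j : 'I_2) : dot (e_ i) (e_ j) = (i == j)%:R.
Proof.
move: i j; apply: ord2P; apply: ord2P;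
  by rewrite /dot !mxE /= ?mulr0 ?mul0r ?mulr1 ?addr0 ?add0r.
Qed.

Lemma partial_test c u i j : partial j (test c u i \o stereo c) u = (i == j)%:R.
Proof.
rewrite partial_lform; under eq_bigr do rewrite -mulrA.
rewrite -mulr_sumr dstereo_coord_gram dot_delta; field; exact: stereo_den_neq0.
Qed.

End TestFunctions.

(** * Vector fields on the sphere in the two charts *)

Section VectorFieldAction.
Variables (R : realType) (g : lmodType R) (br : g -> g -> g).
Local Notation C := (Csphere R).
Local Notation V := 'rV[R]_2.
Local Notation e_ i := (delta_mx 0 i : V).
Variable phi : g -> endo C.
Hypothesis hphi : lie_hom br phi.
Variable a : g -> bool -> 'I_2 -> V -> R.
Hypothesis a_smooth : forall z c i, smooth (a z c i).
Hypothesis aE : forall z (f : C) c x,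
  phi z f (stereo c x) = \sum_i a z c i x * partial i (f \o stereo c) x.

Lemma delta_sum (F : 'I_2 -> R) i : \sum_j F j * (i == j)%:R = F i.
Proof.
rewrite (bigD1 i) //= eqxx mulr1 big1 ?addr0 // => j ji.
by rewrite eq_sym (negPf ji) mulr0.
Qed.

(** The coefficients of phi z were chosen for each z separately. As values on
    test functions they are linear in z and compatible with brackets. *)
Lemma vcoef_test z c x i : phi z (test c x i) (stereo c x) = a z c i x.
Proof.
by rewrite aE; under eq_bigr do rewrite partial_test; exact: delta_sum.
Qed.

Lemma Csphere_ext (f h : C) : f =1 h -> f = h.
Proof. by move=> fh; apply: val_inj; apply/funext. Qed.

Lemma Csphere_addE (f h : C) p : (f + h) p = f p + h p. Proof. by []. Qed.
Lemma Csphere_scaleE k (f : C) p : (k *: f) p = k * f p. Proof. by []. Qed.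
Lemma Csphere_mulE (f h : C) p : (f * h) p = f p * h p. Proof. by []. Qed.
Lemma vcoef_linear k y z c i x :
  a (k *: y + z) c i x = k * a y c i x + a z c i x.
Proof.
have e : phi (k *: y + z) = k *: phi y + phi z := hphi.1 k y z.
by rewrite -!vcoef_test e endo_addE endo_scaleE Csphere_addE Csphere_scaleE.
Qed.

Lemma vcoef0 c i x : a 0 c i x = 0.
Proof.
by have := vcoef_linear (-1) 0 0 c i x; rewrite scaler0 addr0 mulN1r addNr.
Qed.

Lemma vcoef_sum (I : Type) (s : seq I) (k : I -> R) (z : I -> g) c i x :
  a (\sum_(l <- s) k l *: z l) c i x = \sum_(l <- s) k l * a (z l) c i x.
Proof.
elim: s => [|l s IHs]; first by rewrite !big_nil vcoef0.
by rewrite !big_cons vcoef_linear IHs.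
Qed.

Lemma der_vcoef z c i x b : is_derive x (e_ b) (a z c i) (partial b (a z c i) x).
Proof. by apply: Ck1_der; exact: (a_smooth z c i 1). Qed.

Lemma partial_action z (F : C) c x b :
  partial b (phi z F \o stereo c) x =
  \sum_i (partial b (a z c i) x * partial i (F \o stereo c) x +
          a z c i x * partial b (partial i (F \o stereo c)) x).
Proof.
have -> : phi z F \o stereo c = fun u => \sum_i a z c i u * partial i (F \o stereo c) u.
  by apply/funext => u; exact: aE.
have D i : is_derive x (e_ b) (partial i (F \o stereo c))
    (partial b (partial i (F \o stereo c)) x).
  apply: (@Ck1_der _ _ 0); have := Csphere_smooth F c 2.
  by case=> _ /(_ i) [].
by have [_ <-] := der_sum (index_enum _) (fun i => derM (der_vcoef z c i x b) (D i)).
Qed.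

(** The second-order terms of the commutator cancel by symmetry of second
    derivatives. *)
Lemma vcoef_br y z c i x : a (br y z) c i x =
  \sum_b (a y c b x * partial b (a z c i) x - a z c b x * partial b (a y c i) x).
Proof.
rewrite -vcoef_test hphi.2; set F := test c x i.
have -> : (phi y * phi z - phi z * phi y) F (stereo c x) =
    phi y (phi z F) (stereo c x) - phi z (phi y F) (stereo c x) by [].
rewrite !aE; under eq_bigr do rewrite partial_action.
under [X in _ - X]eq_bigr do rewrite partial_action.
have T (H K : 'I_2 -> R) (q : R) :
    q * (\sum_j (H j * partial j (F \o stereo c) x + K j)) =
    q * H i + \sum_j q * K j.
  rewrite big_split /= mulrDr !mulr_sumr; congr (_ + _).
  rewrite -(delta_sum (fun j => q * H j)); apply: eq_bigr => j _.
  by rewrite partial_test mulrA.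
under eq_bigr => b _ do rewrite (T (fun j => partial b (a z c j) x)
  (fun j => a z c j x * partial b (partial j (F \o stereo c)) x)).
under [X in _ - X]eq_bigr => b _ do rewrite (T (fun j => partial b (a y c j) x)
  (fun j => a y c j x * partial b (partial j (F \o stereo c)) x)).
rewrite !big_split /= opprD addrACA sumrN -[RHS]addr0; congr (_ + _).
apply/eqP; rewrite subr_eq0; apply/eqP; rewrite exchange_big /=.
apply: eq_bigr => j _; apply: eq_bigr => b _.
by rewrite (lform_hessian_sym _ c x b j); ring.
Qed.

Lemma stereo_circle (x : V) : dot x x = 1 -> stereo true x = stereo false x.
Proof.
move=> x1; apply: val_inj; apply/rowP => k; rewrite /= !stereo_vecE.
move: k; apply: ord3P; rewrite /stereo_num //=.
by rewrite x1 subrr !mulr0.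
Qed.

(** At a unit vector the differential of the change of charts is the reflection
    in the orthogonal line. This is found by letting the vector field act on
    the three coordinate functions of the ambient space. *)
Lemma vcoef_circle z (x : V) i : dot x x = 1 -> a z false i x =
  a z true i x - 2 * (a z true 0 x * x 0 0 + a z true 1 x * x 0 1) * x 0 i.
Proof.
move=> x1; have sc := stereo_circle x1.
pose E (k : 'I_3) := lform (fun l => (k == l)%:R : R).
have PE c k j : partial j (E k \o stereo c) x = dstereo_coord c k (e_ j) x.
  rewrite partial_lform (bigD1 k) //= eqxx mul1r big1 ?addr0 // => l lk.
  by rewrite eq_sym (negPf lk) mul0r.
have H k : \sum_j a z true j x * dstereo_coord true k (e_ j) x =
    \sum_j a z false j x * dstereo_coord false k (e_ j) x.
  under eq_bigr do rewrite -PE; under [RHS]eq_bigr do rewrite -PE.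
  by rewrite -!aE sc.
have := H ord_max; have := H (lift ord0 ord0); have := H ord0.
rewrite !sum2 /dstereo_coord /dstereo_num /stereo_num /stereo_den x1 /dot !mxE /=.
have two : 1 + 1 = 2 :> R by [].
have four : 2 ^+ 2 = 4 :> R by ring.
rewrite !mulr1 !mulr0 !addr0 !add0r expr1 expr0 subrr two four.
move: x1; rewrite /dot; move: i {H sc PE}; apply: ord2P.
  move: (x 0 0) (x 0 1) => u v uv.
  move: (a z true 0 x) (a z true 1 x) (a z false 0 x) (a z false 1 x).
  move=> p q p' q' h0 _ h2.
  have w' : p' * u + q' * v = - (p * u + q * v) by lra.
  have e : p - u * (p * u + q * v) = p' - u * (p' * u + q' * v) by lra.
  by move: e; rewrite w'; lra.
move: (x 0 0) (x 0 1) => u v uv.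
move: (a z true 0 x) (a z true 1 x) (a z false 0 x) (a z false 1 x).
move=> p q p' q' _ h1 h2.
have w' : p' * u + q' * v = - (p * u + q * v) by lra.
have e : q - v * (p * u + q * v) = q' - v * (p' * u + q' * v) by lra.
by move: e; rewrite w'; lra.
Qed.

End VectorFieldAction.

(** * The Poisson bracket of an induced star product *)

Section InducedPoisson.
Variables (R : realType) (g : lmodType R) (br : g -> g -> g).
Local Notation C := (Csphere R).
Local Notation V := 'rV[R]_2.
Local Notation U := (uea br).
Local Notation T2 := (tensor U U).
Local Notation gen := (uea_gen br).
Variable phi : g -> endo C.
Hypothesis hphi : lie_hom br phi.

Definition biaction (f h : C) (u v : U) : C := uea_lift phi u f * uea_lift phi v h.

Lemma biaction_bilin f h : bilin (biaction f h).
Proof.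
have pl := uea_lift_linear hphi.
split=> [v|u] k x y; rewrite /biaction pl endo_addE endo_scaleE.
  by rewrite mulrDl scalerAl.
by rewrite mulrDr scalerAr.
Qed.

Lemma tmap_action_bilin : bilin (fun u v : U =>
  (tmap (uea_lift phi u) (uea_lift phi v) : tensor C C -> tensor C C)).
Proof.
have pl := uea_lift_linear hphi; have [tl tr] := tpure_bilin C C.
split=> [v|u] k x y; apply/funext => t.
  have -> : tmap (uea_lift phi (k *: x + y)) (uea_lift phi v) t =
      tlift (fun f h : C => k *: (uea_lift phi x f \ox uea_lift phi v h) +
        uea_lift phi y f \ox uea_lift phi v h) t.
    congr (tlift _ t); apply/funext => f; apply/funext => h.
    by rewrite pl endo_addE endo_scaleE; exact: tl.
  exact: tlift_linear_fun.
have -> : tmap (uea_lift phi u) (uea_lift phi (k *: x + y)) t =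
    tlift (fun f h : C => k *: (uea_lift phi u f \ox uea_lift phi x h) +
      uea_lift phi u f \ox uea_lift phi y h) t.
  congr (tlift _ t); apply/funext => f; apply/funext => h.
  by rewrite pl endo_addE endo_scaleE; exact: tr.
exact: tlift_linear_fun.
Qed.

Lemma mul_tensor_action (T : T2) (f h : C) :
  tlift *%R (tensor_action phi T (f \ox h)) = tlift (biaction f h) T.
Proof.
have ml : bilin ( *%R : C -> C -> C).
  by split=> z k x y; rewrite ?mulrDl ?mulrDr ?scalerAl // -scalerAl scalerAr.
move: T; apply: (@tensor_ext _ _ _ _
  (fun T => tlift *%R (tensor_action phi T (f \ox h)))).
- move=> k S T; have e : tensor_action phi (k *: S + T) =
      k *: tensor_action phi S + tensor_action phi T.
    exact: tlift_linear tmap_action_bilin _ _ _.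
  rewrite e; exact: (tlift_linear ml).
- exact: tlift_linear (biaction_bilin f h).
move=> u v; have e : tensor_action phi (u \ox v) =
    tmap (uea_lift phi u) (uea_lift phi v).
  exact: tlift_pure tmap_action_bilin.
rewrite e (tlift_pure _ _ (biaction_bilin f h)) /tmap.
have b := tmap_bilin (@endo_linear _ _ (uea_lift phi u)) (@endo_linear _ _ (uea_lift phi v)).
by rewrite (tlift_pure _ _ b) (tlift_pure _ _ ml).
Qed.

Lemma tensor_action0 (T : T2) : tensor_action phi T 0 = 0.
Proof.
have h : linear (tensor_action phi T).
  elim/tensor_ind: T => [|u v T IH].
    rewrite /tensor_action (lin_id0 (tlift_linear tmap_action_bilin)).
    by move=> k x y /=; rewrite scaler0 addr0.
  have -> : tensor_action phi (u \ox v + T) =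
      tmap (uea_lift phi u) (uea_lift phi v) + tensor_action phi T.
    rewrite /tensor_action (lin_add _ _ (tlift_linear tmap_action_bilin)).
    by rewrite (tlift_pure _ _ tmap_action_bilin).
  have b := tlift_linear (tmap_bilin (@endo_linear _ _ (uea_lift phi u))
    (@endo_linear _ _ (uea_lift phi v))).
  move=> k x y /=.
  rewrite [LHS](_ : _ = tmap (uea_lift phi u) (uea_lift phi v) (k *: x + y) +
    tensor_action phi T (k *: x + y)) //.
  by rewrite [tmap _ _ _]b IH scalerDr addrACA.
exact: lin_id0 h.
Qed.

Variables (F Finv : nat -> T2) (star : (nat -> C) -> (nat -> C) -> (nat -> C)).
Hypothesis hF : twist F.
Hypothesis FFinv : cauchy *%R F Finv = fps_cst 1.
Hypothesis starE : forall u v,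
  star u v = tlift *%R \o cauchy (tensor_action phi) Finv (cauchy (@tpure _ C C) u v).

Lemma Finv1 : Finv 1%N = - F 1%N.
Proof.
have F0 : F 0%N = 1 by rewrite (twist0 hF).
have /= := congr1 (fun f => f 0%N) FFinv.
rewrite /cauchy big_ord1 F0 mul1r => e0.
have := congr1 (fun f => f 1%N) FFinv.
by rewrite cauchy1 F0 mul1r e0 mulr1 => /eqP; rewrite addr_eq0 => /eqP.
Qed.

Lemma star_coef1 f h : star_coef star 1 f h = - tlift (biaction f h) (F 1%N).
Proof.
have [tl tr] := tpure_bilin C C.
rewrite /star_coef starE /= cauchy1.
have -> : cauchy (@tpure _ C C) (fps_cst f) (fps_cst h) 1%N = 0.
  rewrite cauchy1 /=; have -> : f \ox (0 : C) = 0 by exact: lin_id0 (tr f).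
  have -> : (0 : C) \ox h = 0 by exact: lin_id0 (tl h).
  exact: addr0.
have -> : cauchy (@tpure _ C C) (fps_cst f) (fps_cst h) 0%N = f \ox h.
  by rewrite /cauchy big_ord1.
rewrite tensor_action0 add0r mul_tensor_action Finv1.
exact: lin_opp (tlift_linear (biaction_bilin f h)).
Qed.

(** The inverse of F is 1 - F_1 in first order, and exchanging f and h amounts
    to flipping F_1. *)
Lemma star_commutator (s : seq (g * g)) f h :
  F 1%N - flip (F 1%N) = gsum br s ->
  star_coef star 1 f h - star_coef star 1 h f =
  - \sum_(p <- s) phi p.1 f * phi p.2 h.
Proof.
move=> sE; have bl f h := tlift_linear (biaction_bilin f h).
have fE : tlift (biaction h f) (F 1%N) = tlift (biaction f h) (flip (F 1%N)).
  move: (F 1%N); apply: (@tensor_ext _ _ _ _ _ (tlift (biaction f h) \o @flip _ U)).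
  - exact: bl.
  - exact: linear_comp2 (bl f h) (@flip_linear _ U).
  move=> u v; rewrite /= flip_pure !(tlift_pure _ _ (biaction_bilin _ _)).
  by apply: Csphere_ext => p; rewrite /biaction !Csphere_mulE mulrC.
rewrite !star_coef1 opprK fE addrC -opprB -(lin_sub _ _ (bl f h)) sE.
rewrite /gsum (lin_sum _ _ (bl f h)); congr (- _); apply: eq_bigr => p _.
by rewrite (tlift_pure _ _ (biaction_bilin f h)) /biaction !uea_lift_gen.
Qed.

End InducedPoisson.

(** * The adjoint representation *)

Section Adjoint.
Variables (R : realType) (g : lmodType R) (br : g -> g -> g).
Hypothesis hbr : lie_bracket br.
Variables (m : nat) (e : 'I_m.+1 -> g) (co : 'I_m.+1 -> g -> R^o).
Hypothesis co_linear : forall k, linear (co k).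
Hypothesis coE : forall v, \sum_k co k v *: e k = v.

(** The adjoint representation in the coordinates co. The vectors e need only
    span g. *)
Definition adm (y : g) : 'M[R]_m.+1 := \matrix_(k, j) co k (br y (e j)).

Lemma co_br k y z : co k (br y z) = \sum_j adm y k j * co j z.
Proof.
have [_ brl _ _] := hbr.
rewrite -{1}(coE z) (lin_sum _ _ (brl y)) (lin_sum _ _ (co_linear k)).
apply: eq_bigr => j _; rewrite (lin_scale _ _ (brl y)).
by rewrite (lin_scale _ _ (co_linear k)) mxE [LHS]mulrC.
Qed.

Lemma br_jacobi y z w : br (br y z) w = br y (br z w) - br z (br y w).
Proof.
have [brl brr br0 jac] := hbr.
have anti u v : br u v = - br v u.
  have := br0 (u + v); rewrite (lin_add _ _ (brl _)) !(lin_add _ _ (brr _)) !br0.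
  by rewrite add0r addr0 => /eqP; rewrite addr_eq0 => /eqP.
have := jac y z w; rewrite (anti w (br y z)) (anti w y).
rewrite (lin_opp _ (brr z)) => /eqP; rewrite subr_eq0 => /eqP <-.
by [].
Qed.

Lemma adm_hom : lie_hom br adm.
Proof.
have [brl brr br0 jac] := hbr.
split=> [k y z|y z]; apply/matrixP => i j.
  by rewrite !mxE brl co_linear.
rewrite !mxE br_jacobi (lin_sub _ _ (co_linear i)) !co_br.
by congr (_ - _); apply: eq_bigr => l _; rewrite !mxE.
Qed.

End Adjoint.

Section VectorSpaceCoordinates.
Variables (R : realType) (g : vectType R).

(** A last vector 0 is added to a basis, so that the number of vectors is a
    successor and square matrices of this size form an algebra, even for g =
    0. *)
Lemma exists_coordinates : exists m (e : 'I_m.+1 -> g) (co : 'I_m.+1 -> g -> R^o),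
  (forall k, linear (co k)) /\ (forall v, \sum_k co k v *: e k = v).
Proof.
pose b := vbasis {:g}; exists (\dim {:g}), (fun k => b`_k).
exists (fun k v => if insub (k : nat) is Some i then coord b i v else 0); split.
  move=> k c u v; case: insub => [i|]; first by rewrite linearP.
  by rewrite scaler0 addr0.
move=> v; rewrite big_ord_recr /= insubF ?ltnn // scale0r addr0.
rewrite {2}(coord_vbasis (memvf v)); apply: eq_bigr => i _.
by rewrite insubT //= => h; congr (coord _ _ _ *: _); exact: val_inj.
Qed.

End VectorSpaceCoordinates.

(** * The bivector field of an r-matrix *)

Section Bivector.
Variables (R : realType) (g : lmodType R) (br : g -> g -> g).
Local Notation C := (Csphere R).
Local Notation V := 'rV[R]_2.
Local Notation U := (uea br).
Local Notation gen := (uea_gen br).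
Local Notation e_ i := (delta_mx 0 i : V).
Variable phi : g -> endo C.
Hypothesis hphi : lie_hom br phi.
Variable a : g -> bool -> 'I_2 -> V -> R.
Hypothesis a_smooth : forall z c i, smooth (a z c i).
Hypothesis aE : forall z (f : C) c x,
  phi z f (stereo c x) = \sum_i a z c i x * partial i (f \o stereo c) x.
Variable s : seq (g * g).
Hypothesis sN : flip (gsum br s) = - gsum br s.

(** The components of phi(r) in a chart. *)
Definition bivector c i j x : R := \sum_(p <- s) a p.1 c i x * a p.2 c j x.

Definition at_point (f : C) c x (u : U) : R^o := uea_lift phi u f (stereo c x).

Lemma at_point_linear f c x : linear (at_point f c x).
Proof.
move=> k u v; have e : uea_lift phi (k *: u + v) =
    k *: uea_lift phi u + uea_lift phi v by exact: uea_lift_linear hphi k u v.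
by rewrite /at_point e endo_addE endo_scaleE Csphere_addE Csphere_scaleE.
Qed.

Lemma at_point_test c x i z : at_point (test c x i) c x (gen z) = a z c i x.
Proof. by rewrite /at_point uea_lift_gen // (vcoef_test aE). Qed.

Lemma bivector_antisym c i j x : bivector c j i x = - bivector c i j x.
Proof.
pose f u v : R^o := at_point (test c x i) c x u * at_point (test c x j) c x v.
have fb : bilin f.
  split=> z k u v; rewrite /f at_point_linear; first by rewrite mulrDl scalerAl.
  by rewrite mulrDr scalerAr.
have := gsum_antisym sN fb; rewrite /f.
under eq_bigr do rewrite !at_point_test.
under [in RHS]eq_bigr do rewrite !at_point_test.
by move=> <-; apply: eq_bigr => q _; rewrite mulrC.
Qed.

Lemma bivector_diag c i x : bivector c i i x = 0.
Proof. by have := bivector_antisym c i i x; move: (bivector _ _ _ _) => k; lra. Qed.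

(** If this component vanished, so would all others by antisymmetry. On test
    functions the Poisson bracket gives the entries of the inverse of the
    symplectic matrix, which would be zero. *)
Lemma bivector_neq0 (om : symplectic_form R) c x :
  (forall f h, - (\sum_(p <- s) phi p.1 f * phi p.2 h) (stereo c x) =
     poisson om f h c x) -> bivector c 0 1 x != 0.
Proof.
move=> hq; apply/eqP => b01.
have b0 i j : bivector c i j x = 0.
  move: i j; apply: ord2P; apply: ord2P; rewrite ?bivector_diag ?b01 //.
  by rewrite bivector_antisym b01 oppr0.
have ev (F : g * g -> C) (P : sphere R) :
    (\sum_(p <- s) F p) P = \sum_(p <- s) F p P.
  by elim: s => [|q l IH]; rewrite ?big_nil // !big_cons Csphere_addE IH.
have grad i : \row_j partial j (test c x i \o stereo c) x = e_ i.
  by apply/rowP => j; rewrite !mxE partial_test eq_sym.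
have inv0 i j : invmx (om c x) j i = 0.
  have := hq (test c x i) (test c x j); rewrite ev //.
  under eq_bigr do rewrite Csphere_mulE !(vcoef_test aE).
  rewrite -/(bivector c i j x) b0 oppr0 /poisson /hamiltonian !grad mulmxKV ?form_nondeg //.
  rewrite trmx_mul -rowE !mxE.
  rewrite (bigD1 j) //= big1 ?addr0 => [|k kj]; rewrite !mxE ?eqxx /=.
    by rewrite mulr1.
  by rewrite (negPf kj) mulr0.
have := mulmxV (form_nondeg om c x).
rewrite (_ : invmx _ = 0) ?mulmx0; last by apply/matrixP => k l; rewrite inv0 mxE.
by move=> /matrixP /(_ 0 0); rewrite !mxE /= => /eqP; rewrite eq_sym oner_eq0.
Qed.

End Bivector.

(** * The Yang-Baxter equation on vector fields *)

Section ContractedYangBaxter.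
Variables (R : realType) (g : lmodType R) (br : g -> g -> g).
Local Notation C := (Csphere R).
Local Notation V := 'rV[R]_2.
Local Notation U := (uea br).
Local Notation gen := (uea_gen br).
Local Notation e_ i := (delta_mx 0 i : V).
Variable phi : g -> endo C.
Hypothesis hphi : lie_hom br phi.
Variable a : g -> bool -> 'I_2 -> V -> R.
Hypothesis a_smooth : forall z c i, smooth (a z c i).
Hypothesis aE : forall z (f : C) c x,
  phi z f (stereo c x) = \sum_i a z c i x * partial i (f \o stereo c) x.
Variable s : seq (g * g).
Hypothesis sN : flip (gsum br s) = - gsum br s.
Hypothesis sC : cybe br s.
Variable m : nat.
Variable rho : g -> 'M[R]_m.+1.
Hypothesis hrho : lie_hom br rho.
Local Notation biv := (bivector a s).

Definition entry (k l : 'I_m.+1) (u : U) : R^o := uea_lift rho u k l.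

Lemma entry_linear k l : linear (entry k l).
Proof.
move=> t u v; have e : uea_lift rho (t *: u + v) =
    t *: uea_lift rho u + uea_lift rho v by exact: uea_lift_linear hrho t u v.
by rewrite /entry e !mxE.
Qed.

Lemma entry_gen k l z : entry k l (gen z) = rho z k l.
Proof. by rewrite /entry uea_lift_gen. Qed.

(** The first two legs of the Yang-Baxter equation act on the test functions of
    the two coordinates, and the third acts in the representation rho. *)
Lemma cybe_at_point c x k l :
  \sum_(p <- s) \sum_(q <- s)
   (a (br p.1 q.1) c 0 x * a p.2 c 1 x * rho q.2 k l +
    a p.1 c 0 x * a (br p.2 q.1) c 1 x * rho q.2 k l +
    a p.1 c 0 x * a q.1 c 1 x * rho (br p.2 q.2) k l) = 0.
Proof.
pose h (u v w : U) : R^o := at_point phi (test c x 0) c x u *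
  at_point phi (test c x 1) c x v * entry k l w.
have ht : trilin h.
  have al := at_point_linear hphi.
  split=> [v w|u w|u v] t y z; rewrite /h.
  - by rewrite al !mulrDl !scalerAl.
  - by rewrite al mulrDr mulrDl -scalerAr -scalerAl.
  - by rewrite entry_linear mulrDr scalerAr.
have hl := tlift3_linear ht.
have := congr1 (tlift3 h) sC; rewrite (lin_sum _ _ hl) (lin_id0 hl) => e.
rewrite -[RHS]e.
apply: eq_bigr => p _; rewrite (lin_sum _ _ hl); apply: eq_bigr => q _.
rewrite !(lin_add _ _ hl) !(tlift3_pure _ _ _ ht) /h.
by rewrite !(at_point_test hphi aE) !entry_gen.
Qed.

(** r with its first leg turned into the i-th component of a vector field and
    its second leg acting in the representation rho. *)
Definition half_action c i x : 'M[R]_m.+1 := \sum_(q <- s) a q.1 c i x *: rho q.2.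

Lemma half_action_br c i j x :
  \sum_(p <- s) \sum_(q <- s) (a p.1 c i x * a q.1 c j x) *: rho (br p.2 q.2) =
  half_action c i x * half_action c j x - half_action c j x * half_action c i x.
Proof.
rewrite /half_action !mulr_suml.
under [X in _ = X - _]eq_bigr do rewrite mulr_sumr.
under [X in _ = _ - X]eq_bigr do rewrite mulr_sumr.
rewrite [X in _ - X]exchange_big -sumrB; apply: eq_bigr => p _.
rewrite -sumrB; apply: eq_bigr => q _.
have [_ ->] := hrho; rewrite scalerBr -!scalerAl -!scalerAr !scalerA.
by rewrite [a q.1 c j x * _]mulrC.
Qed.

Lemma der_bivector c i j x b : is_derive x (e_ b) (biv c i j)
  (\sum_(p <- s) (partial b (a p.1 c i) x * a p.2 c j x +
                  a p.1 c i x * partial b (a p.2 c j) x)).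
Proof.
apply: (@der_sum _ _ _ s) => p; exact: (derM (der_vcoef a_smooth p.1 c i x b)
  (der_vcoef a_smooth p.2 c j x b)).
Qed.

(** Both sides are minus the Lie derivative of the bivector field along phi q;
    in dimension two the derivatives of phi q enter through its divergence
    only. *)
Lemma lie_derivative_bivector c x (q : g) :
  \sum_(p <- s) (a (br p.1 q) c 0 x * a p.2 c 1 x +
                 a p.1 c 0 x * a (br p.2 q) c 1 x) =
  biv c 0 1 x * (partial 0 (a q c 0) x + partial 1 (a q c 1) x) -
  (a q c 0 x * partial 0 (biv c 0 1) x + a q c 1 x * partial 1 (biv c 0 1) x).
Proof.
have D b : partial b (biv c 0 1) x =
    \sum_(p <- s) (partial b (a p.1 c 0) x * a p.2 c 1 x +
                   a p.1 c 0 x * partial b (a p.2 c 1) x).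
  by have [_ <-] := der_bivector c 0 1 x b.
have e00 := bivector_diag hphi aE sN c 0 x.
have e11 := bivector_diag hphi aE sN c 1 x.
(* The diagonal components, which vanish, complete the right-hand side to a sum
   that can be compared term by term. *)
have -> : biv c 0 1 x * (partial 0 (a q c 0) x + partial 1 (a q c 1) x) =
    biv c 0 1 x * partial 0 (a q c 0) x + biv c 1 1 x * partial 1 (a q c 0) x +
    (biv c 0 0 x * partial 0 (a q c 1) x + biv c 0 1 x * partial 1 (a q c 1) x).
  by rewrite e00 e11 !mul0r addr0 add0r mulrDr.
rewrite !D /bivector !mulr_suml !mulr_sumr -!big_split /= -sumrB.
by apply: eq_bigr => p _; rewrite !(vcoef_br hphi a_smooth aE) !sum2; ring.
Qed.

Lemma cybe_half_action c x :
  \sum_(q <- s) (biv c 0 1 x * (partial 0 (a q.1 c 0) x + partial 1 (a q.1 c 1) x) -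
  (a q.1 c 0 x * partial 0 (biv c 0 1) x + a q.1 c 1 x * partial 1 (biv c 0 1) x))
   *: rho q.2 +
  (half_action c 0 x * half_action c 1 x - half_action c 1 x * half_action c 0 x) = 0.
Proof.
apply/matrixP => k l; rewrite [RHS]mxE -(cybe_at_point c x k l).
rewrite -half_action_br mxE !summxE.
have e p : (\sum_(q <- s) (a p.1 c 0 x * a q.1 c 1 x) *: rho (br p.2 q.2)) k l =
  \sum_(q <- s) a p.1 c 0 x * a q.1 c 1 x * rho (br p.2 q.2) k l.
  by rewrite summxE; apply: eq_bigr => q _; rewrite mxE.
under [X in _ + X]eq_bigr do rewrite e.
under [RHS]eq_bigr do rewrite big_split.
rewrite big_split; congr (_ + _); rewrite exchange_big; apply: eq_bigr => q _.
rewrite mxE -lie_derivative_bivector mulr_suml; apply: eq_bigr => p _.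
by rewrite mulrDl.
Qed.

End ContractedYangBaxter.

(** * The flat connection of an r-matrix *)

Section RMatrixConnection.
Variables (R : realType) (g : lmodType R) (br : g -> g -> g).
Local Notation C := (Csphere R).
Local Notation V := 'rV[R]_2.
Local Notation U := (uea br).
Local Notation gen := (uea_gen br).
Local Notation e_ i := (delta_mx 0 i : V).
Variable phi : g -> endo C.
Hypothesis hphi : lie_hom br phi.
Variable a : g -> bool -> 'I_2 -> V -> R.
Hypothesis a_smooth : forall z c i, smooth (a z c i).
Hypothesis aE : forall z (f : C) c x,
  phi z f (stereo c x) = \sum_i a z c i x * partial i (f \o stereo c) x.
Variable s : seq (g * g).
Hypothesis sN : flip (gsum br s) = - gsum br s.
Hypothesis sC : cybe br s.
Local Notation biv := (bivector a s).
Hypothesis biv_neq0 : forall c x, biv c 0 1 x != 0.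
Variable m : nat.
Variable rho : g -> 'M[R]_m.+1.
Hypothesis hrho : lie_hom br rho.
Local Notation P := (half_action a s rho).

Lemma half_actionE c i x k l : P c i x k l = \sum_(q <- s) a q.1 c i x * rho q.2 k l.
Proof. by rewrite /half_action summxE; apply: eq_bigr => q _; rewrite mxE. Qed.

Lemma der_half_action c i k l x b :
  is_derive x (e_ b) (fun x => P c i x k l)
    (\sum_(q <- s) partial b (a q.1 c i) x * rho q.2 k l).
Proof.
apply: (der_ext (fun x => esym (half_actionE c i x k l))).
apply: (@der_sum _ _ _ s) => q; under eq_fun do rewrite mulrC.
by rewrite mulrC; exact: derZ _ (der_vcoef a_smooth q.1 c i x b).
Qed.

Lemma Ck_half_action n c i k l : Ck n (fun x => P c i x k l).
Proof.
rewrite (_ : (fun _ => _) = fun x => \sum_(q <- s) rho q.2 k l * a q.1 c i x).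
  by apply: Ck_sum => q; apply: CkZ; exact: a_smooth.
apply/funext => x; rewrite half_actionE; apply: eq_bigr => q _; exact: mulrC.
Qed.

Lemma Ck_bivector n c i j : Ck n (biv c i j).
Proof. by apply: Ck_sum => q; apply: CkM; exact: a_smooth. Qed.

(** The matrices of the connection: along the coordinate lines a parallel
    section satisfies d_0 S = conn0 S and d_1 S = conn1 S. They are obtained
    from r by inverting the bivector field in its first leg. *)
Definition conn0 c k l x : R := P c 1 x k l / biv c 0 1 x.
Definition conn1 c k l x : R := - P c 0 x k l / biv c 0 1 x.

Lemma Ck_conn0 n c k l : Ck n (conn0 c k l).
Proof.
exact: CkM (Ck_half_action n c 1 k l) (CkV (biv_neq0 c) (Ck_bivector n c 0 1)).
Qed.

Lemma Ck_conn1 n c k l : Ck n (conn1 c k l).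
Proof.
exact: CkM (CkN (Ck_half_action n c 0 k l)) (CkV (biv_neq0 c) (Ck_bivector n c 0 1)).
Qed.

(** Multiplied by the square of the component of the bivector, this is
    [cybe_half_action]. *)
Lemma connection_flat c k j x :
  partial 0 (conn1 c k j) x + \sum_l conn1 c k l x * conn0 c l j x =
  partial 1 (conn0 c k j) x + \sum_l conn0 c k l x * conn1 c l j x.
Proof.
have bd b : is_derive x (e_ b) (biv c 0 1) (partial b (biv c 0 1) x).
  by apply: Ck1_der; exact: Ck_bivector 1 _ _ _.
have D0 := derM (derN (der_half_action c 0 k j x 0)) (derV (biv_neq0 c x) (bd 0)).
have D1 := derM (der_half_action c 1 k j x 1) (derV (biv_neq0 c x) (bd 1)).
have e0 := der_unique (Ck1_der 0 x (Ck_conn1 1 c k j)) D0.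
have e1 := der_unique (Ck1_der 1 x (Ck_conn0 1 c k j)) D1.
rewrite e0 e1 {e0 e1 D0 D1}.
have S01 : \sum_l conn1 c k l x * conn0 c l j x =
    - (P c 0 x * P c 1 x) k j / biv c 0 1 x ^+ 2.
  rewrite mxE -sumrN mulr_suml; apply: eq_bigr => l _.
  by rewrite /conn0 /conn1 expr2 invfM; ring.
have S10 : \sum_l conn0 c k l x * conn1 c l j x =
    - (P c 1 x * P c 0 x) k j / biv c 0 1 x ^+ 2.
  rewrite mxE -sumrN mulr_suml; apply: eq_bigr => l _.
  by rewrite /conn0 /conn1 expr2 invfM; ring.
rewrite S01 S10.
have := cybe_half_action hphi a_smooth aE sN sC hrho c x.
move=> /matrixP /(_ k j); rewrite [RHS]mxE => CY.
have {}CY : biv c 0 1 x * ((\sum_(q <- s) partial 0 (a q.1 c 0) x * rho q.2 k j) +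
   \sum_(q <- s) partial 1 (a q.1 c 1) x * rho q.2 k j) -
   (P c 0 x k j * partial 0 (biv c 0 1) x + P c 1 x k j * partial 1 (biv c 0 1) x) +
   ((P c 0 x * P c 1 x) k j - (P c 1 x * P c 0 x) k j) = 0.
  rewrite -[RHS]CY [RHS]mxE; congr (_ + _); last by rewrite [RHS]mxE [X in _ = _ + X]mxE.
  rewrite [RHS]summxE !half_actionE -big_split mulr_sumr !mulr_suml -big_split -sumrB.
  by apply: eq_bigr => q _; rewrite mxE /=; ring.
have := biv_neq0 c x.
move: CY {bd S01 S10}; move: (biv c 0 1 x) (partial 0 _ x) (partial 1 _ x) (P c 0 x k j) (P c 1 x k j).
move: ((P c 0 x * P c 1 x) k j) ((P c 1 x * P c 0 x) k j).
move: (\sum_(q <- s) _) (\sum_(q <- s) _) => d0 d1 p01 p10 p p0 p1 P0 P1 CY pn.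
apply/eqP; rewrite -subr_eq0; apply/eqP.
rewrite -[RHS](mul0r (- p ^- 2)) -CY; field.
by [].
Qed.

Theorem parallel_transport c (v : 'I_m.+1 -> R) :
  exists S : 'I_m.+1 -> R -> R -> R, [/\ forall k, S k 1 0 = v k,
    forall k, continuous (fun p : R * R => S k p.1 p.2),
    forall k (x y : R), is_derive x 1 ((S k)^~ y)
      (\sum_j conn0 c k j (pt x y) * S j x y) &
    forall k (x y : R), is_derive y 1 (S k x)
      (\sum_j conn1 c k j (pt x y) * S j x y)].
Proof.
apply: (@parallel_section _ _ (fun k j x y => conn0 c k j (pt x y))
  (fun k j x y => partial 1 (conn0 c k j) (pt x y))
  (fun k j x y => conn1 c k j (pt x y))
  (fun k j x y => partial 0 (conn1 c k j) (pt x y))).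
- by move=> k j; apply: joint_pt; case: (Ck_conn0 0 c k j).
- by move=> k j; apply: joint_pt; case: (Ck_conn1 0 c k j).
- move=> k j; apply: joint_pt; case: (Ck_conn1 1 c k j) => _ /(_ 0) [_].
  by case.
- by move=> k j x y; apply: der_pt1; apply: Ck1_der; exact: Ck_conn0 1 _ _ _.
- by move=> k j x y; apply: der_pt0; apply: Ck1_der; exact: Ck_conn1 1 _ _ _.
- by move=> k j x y; exact: connection_flat.
Qed.

End RMatrixConnection.

(** * The vector field of a parallel section *)

Section ParallelField.
Variables (R : realType) (g : lmodType R) (br : g -> g -> g).
Hypothesis hbr : lie_bracket br.
Local Notation C := (Csphere R).
Local Notation V := 'rV[R]_2.
Local Notation e_ i := (delta_mx 0 i : V).
Variable phi : g -> endo C.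
Hypothesis hphi : lie_hom br phi.
Variable a : g -> bool -> 'I_2 -> V -> R.
Hypothesis a_smooth : forall z c i, smooth (a z c i).
Hypothesis aE : forall z (f : C) c x,
  phi z f (stereo c x) = \sum_i a z c i x * partial i (f \o stereo c) x.
Variable s : seq (g * g).
Hypothesis sN : flip (gsum br s) = - gsum br s.
Local Notation biv := (bivector a s).
Hypothesis biv_neq0 : forall c x, biv c 0 1 x != 0.
Variables (m : nat) (e : 'I_m.+1 -> g) (co : 'I_m.+1 -> g -> R^o).
Hypothesis co_linear : forall k, linear (co k).
Hypothesis coE : forall v, \sum_k co k v *: e k = v.
Local Notation rho := (adm br e co).
Local Notation P := (half_action a s rho).

Lemma half_action_field c t i u (S : 'I_m.+1 -> R) :
  \sum_j (\sum_l P c t u j l * S l) * a (e j) c i u =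
  \sum_(q <- s) a q.1 c t u * a (br q.2 (\sum_l S l *: e l)) c i u.
Proof.
have [_ brl _ _] := hbr.
have aw w : a w c i u = \sum_j co j w * a (e j) c i u.
  by rewrite -{1}(coE w) (vcoef_sum hphi aE).
under [RHS]eq_bigr do rewrite aw mulr_sumr.
rewrite [RHS]exchange_big; apply: eq_bigr => j _ /=.
under eq_bigr do rewrite half_actionE mulr_suml.
rewrite exchange_big mulr_suml; apply: eq_bigr => q _ /=.
rewrite mulrA; congr (_ * _).
rewrite (lin_sum _ _ (brl q.2)) (lin_sum _ _ (co_linear j)) mulr_sumr.
apply: eq_bigr => l _; rewrite mxE (lin_scale _ _ (brl _)).
by rewrite (lin_scale _ _ (co_linear j)) -mulrA; congr (_ * _); exact: mulrC.
Qed.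

Definition drift c t i b u : R := \sum_(q <- s) a q.1 c t u * partial b (a q.2 c i) u.

(** In the coefficients of the bracket of phi q.2 and phi w, the terms that
    differentiate w combine to the bivector field, and those that differentiate
    phi q.2 involve w only through the value of phi w. *)
Lemma half_action_br_field c t i u w :
  \sum_(q <- s) a q.1 c t u * a (br q.2 w) c i u =
  \sum_b (biv c t b u * partial b (a w c i) u - drift c t i b u * a w c b u).
Proof.
rewrite !sum2 /bivector /drift !mulr_suml -!sumrB -big_split.
by apply: eq_bigr => q _; rewrite (vcoef_br hphi a_smooth aE) sum2 /=; ring.
Qed.

Section Chart.
Variables (c : bool) (S : 'I_m.+1 -> R -> R -> R).
Hypothesis Sc : forall k, continuous (fun p : R * R => S k p.1 p.2).
Hypothesis Sx : forall k (x y : R), is_derive x 1 ((S k)^~ y)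
      (\sum_j conn0 a s rho c k j (pt x y) * S j x y).
Hypothesis Sy : forall k (x y : R), is_derive y 1 (S k x)
      (\sum_j conn1 a s rho c k j (pt x y) * S j x y).

(** The components of the vector field phi(S) in the chart c. *)
Definition field i x y : R := \sum_j S j x y * a (e j) c i (pt x y).

Lemma field_coef i x y : field i x y = a (\sum_j S j x y *: e j) c i (pt x y).
Proof. by rewrite (vcoef_sum hphi aE). Qed.

Lemma field_joint i : continuous (fun p : R * R => field i p.1 p.2).
Proof.
have ac j : continuous (fun p : R * R => a (e j) c i (pt p.1 p.2)).
  by apply: joint_pt; case: (a_smooth (e j) c i 0).
move=> p; apply: cont_sum => j.
exact: contM (@Sc j p) (@ac j p).
Qed.

Lemma partial_field b i x y : partial b (a (\sum_j S j x y *: e j) c i) (pt x y) =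
  \sum_j S j x y * partial b (a (e j) c i) (pt x y).
Proof.
have h := @der_sum _ _ _ (index_enum _) (fun j u => S j x y * a (e j) c i u)
  (fun j => S j x y * partial b (a (e j) c i) (pt x y)) (pt x y) (e_ b)
  (fun j => derZ (S j x y) (der_vcoef a_smooth (e j) c i (pt x y) b)).
have f : (fun u => \sum_j S j x y * a (e j) c i u) =1
    a (\sum_j S j x y *: e j) c i.
  by move=> u; rewrite (vcoef_sum hphi aE).
exact: der_unique (der_vcoef a_smooth _ c i _ b) (der_ext f h).
Qed.

(** The term that differentiates the coefficients of phi(S) with S kept fixed
    cancels against the one produced by the connection, since the connection
    contains the inverse of the bivector. *)
Lemma field_dx i (x y : R) : is_derive x 1 ((field i)^~ y)
  (\sum_b (- drift c 1 i b (pt x y) / biv c 0 1 (pt x y)) * field b x y).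
Proof.
have D : is_derive x 1 ((field i)^~ y) (\sum_j
    ((\sum_l conn0 a s rho c j l (pt x y) * S l x y) * a (e j) c i (pt x y) +
     S j x y * partial 0 (a (e j) c i) (pt x y))).
  apply: der_sum => j; apply: derM (Sx j x y) _.
  by apply: der_pt0; exact: der_vcoef.
apply: der_eq D _; rewrite big_split -partial_field /=.
have -> : \sum_j (\sum_l conn0 a s rho c j l (pt x y) * S l x y) * a (e j) c i (pt x y) =
    (\sum_j (\sum_l P c 1 (pt x y) j l * S l x y) * a (e j) c i (pt x y))
      / biv c 0 1 (pt x y).
  rewrite mulr_suml; apply: eq_bigr => j _; rewrite [RHS]mulrAC.
  by congr (_ * _); rewrite mulr_suml; apply: eq_bigr => l _; rewrite /conn0 mulrAC.
rewrite half_action_field half_action_br_field !sum2 -!field_coef.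
rewrite (bivector_diag hphi aE sN) (bivector_antisym hphi aE sN c 0 1).
by move: (biv_neq0 c (pt x y)) => p0; field.
Qed.

Lemma field_dy i (x y : R) : is_derive y 1 (field i x)
  (\sum_b (drift c 0 i b (pt x y) / biv c 0 1 (pt x y)) * field b x y).
Proof.
have D : is_derive y 1 (field i x) (\sum_j
    ((\sum_l conn1 a s rho c j l (pt x y) * S l x y) * a (e j) c i (pt x y) +
     S j x y * partial 1 (a (e j) c i) (pt x y))).
  apply: der_sum => j; apply: derM (Sy j x y) _.
  by apply: der_pt1; exact: der_vcoef.
apply: der_eq D _; rewrite big_split -partial_field /=.
have -> : \sum_j (\sum_l conn1 a s rho c j l (pt x y) * S l x y) * a (e j) c i (pt x y) =
    - (\sum_j (\sum_l P c 0 (pt x y) j l * S l x y) * a (e j) c i (pt x y))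
      / biv c 0 1 (pt x y).
  rewrite -sumrN mulr_suml; apply: eq_bigr => j _; rewrite -mulNr [RHS]mulrAC.
  congr (_ * _); rewrite -sumrN mulr_suml; apply: eq_bigr => l _.
  by rewrite /conn1 -mulNr mulrAC.
rewrite half_action_field half_action_br_field !sum2 -!field_coef.
rewrite (bivector_diag hphi aE sN).
by move: (biv_neq0 c (pt x y)) => p0; field.
Qed.

Lemma drift_quotient_joint t i b :
  continuous (fun p : R * R => drift c t i b (pt p.1 p.2) / biv c 0 1 (pt p.1 p.2)).
Proof.
suff [h _] : Ck 0 (fun u => drift c t i b u * (biv c 0 1 u)^-1).
  exact: joint_pt h.
apply: CkM; last by apply: CkV => [u|]; [exact: biv_neq0|exact: (Ck_bivector a_smooth)].
apply: Ck_sum => q; apply: CkM; first exact: a_smooth.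
by have [_ /(_ b) []] := a_smooth q.2 c i 1.
Qed.

(** Uniqueness for linear equations spreads a zero along a vertical line, and
    from there along a horizontal one. *)
Lemma field_zero (x0 y0 x y : R) : (forall i, field i x y = 0) -> forall i, field i x0 y0 = 0.
Proof.
move=> f0.
have fx y' i : field i x y' = 0.
  apply: (@ode_unique _ _ (fun i b y' => drift c 0 i b (pt x y') / biv c 0 1 (pt x y'))
    (fun i => field i x) y); last exact: f0.
  - move=> k j; exact: (@joint_continuousl R (fun x y => drift c 0 k j (pt x y) / biv c 0 1 (pt x y)) x
      (@drift_quotient_joint 0 k j)).
  - by move=> t k; exact: field_dy.
move=> i.
apply: (@ode_unique _ _ (fun i b x' => - drift c 1 i b (pt x' y0) / biv c 0 1 (pt x' y0))
    (fun i x' => field i x' y0) x); last by move=> k; exact: fx.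
- move=> k j; rewrite (_ : (fun _ => _) = fun x' => - (drift c 1 k j (pt x' y0) / biv c 0 1 (pt x' y0))).
    move=> x'; apply: (@contN _ _ (fun x' => drift c 1 k j (pt x' y0) / biv c 0 1 (pt x' y0))).
    exact: (@joint_continuousr R (fun x y => drift c 1 k j (pt x y) / biv c 0 1 (pt x y)) y0
      (@drift_quotient_joint 1 k j)).
  by apply/funext => x'; rewrite mulNr.
- by move=> t k; exact: field_dx.
Qed.

End Chart.
End ParallelField.

(** * The equator in both charts *)

Section UnitCircle.
Variables (R : realType) (g : lmodType R) (br : g -> g -> g).
Local Notation C := (Csphere R).
Local Notation V := 'rV[R]_2.
Variable phi : g -> endo C.
Hypothesis hphi : lie_hom br phi.
Variable a : g -> bool -> 'I_2 -> V -> R.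
Hypothesis a_smooth : forall z c i, smooth (a z c i).
Hypothesis aE : forall z (f : C) c x,
  phi z f (stereo c x) = \sum_i a z c i x * partial i (f \o stereo c) x.
Variable s : seq (g * g).
Hypothesis sN : flip (gsum br s) = - gsum br s.
Hypothesis sC : cybe br s.
Local Notation biv := (bivector a s).
Hypothesis biv_neq0 : forall c x, biv c 0 1 x != 0.

(** Reflections reverse the orientation. *)
Lemma bivector_circle (x : V) : dot x x = 1 -> biv false 0 1 x = - biv true 0 1 x.
Proof.
move=> x1; have K00 := bivector_diag hphi aE sN true 0 x.
have K11 := bivector_diag hphi aE sN true 1 x.
have K10 := bivector_antisym hphi aE sN true 0 1 x.
have -> : biv false 0 1 x = biv true 0 1 x -
    2 * x 0 1 * (biv true 0 0 x * x 0 0 + biv true 0 1 x * x 0 1) -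
    2 * x 0 0 * (biv true 0 1 x * x 0 0 + biv true 1 1 x * x 0 1) +
    4 * x 0 0 * x 0 1 * (biv true 0 0 x * x 0 0 ^+ 2 +
      (biv true 0 1 x + biv true 1 0 x) * (x 0 0 * x 0 1) +
      biv true 1 1 x * x 0 1 ^+ 2).
  rewrite /bivector -(big_split +%R) !mulr_suml -!big_split /= !mulr_sumr.
  rewrite -!sumrB -!big_split /=; apply: eq_bigr => p _.
  rewrite !(vcoef_circle aE _ _ x1).
  move: (a p.1 true 0 x) (a p.1 true 1 x) (a p.2 true 0 x) (a p.2 true 1 x).
  by move: (x 0 0) (x 0 1) => x0 x1' p0 p1 q0 q1; ring.
rewrite K00 K11 K10; move: x1; rewrite /dot.
move: (x 0 0) (x 0 1) (biv true 0 1 x) => u v k uv.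
rewrite [LHS](_ : _ = k - 2 * k * (u * u + v * v)); last by ring.
by rewrite uv; ring.
Qed.

Variable m : nat.
Variable rho : g -> 'M[R]_m.+1.
Local Notation P := (half_action a s rho).

Lemma half_action_circle (x : V) k l : dot x x = 1 ->
  P false 0 x k l * x 0 0 + P false 1 x k l * x 0 1 =
  - (P true 0 x k l * x 0 0 + P true 1 x k l * x 0 1).
Proof.
move=> x1; rewrite !half_actionE !mulr_suml -!big_split /= -sumrN.
apply: eq_bigr => q _; rewrite !(vcoef_circle aE _ _ x1).
move: x1; rewrite /dot.
move: (a q.1 true 0 x) (a q.1 true 1 x) (rho q.2 k l) (x 0 0) (x 0 1).
move=> p0 p1 r u v uv.
rewrite [LHS](_ : _ = r * (p0 * u + p1 * v) -
  2 * r * (p0 * u + p1 * v) * (u * u + v * v)); last by ring.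
by rewrite uv; ring.
Qed.

Local Notation c0 := (conn0 a s rho).
Local Notation c1 := (conn1 a s rho).

(** In the direction of the circle the connection is, up to sign, the quotient
    of the radial component of r by the bivector. Both change sign under the
    reflection. *)
Lemma connection_circle (x : V) k l : dot x x = 1 ->
  c0 false k l x * - x 0 1 + c1 false k l x * x 0 0 =
  c0 true k l x * - x 0 1 + c1 true k l x * x 0 0.
Proof.
move=> x1.
have E c : c0 c k l x * - x 0 1 + c1 c k l x * x 0 0 =
    - (P c 0 x k l * x 0 0 + P c 1 x k l * x 0 1) / biv c 0 1 x.
  by rewrite /conn0 /conn1; ring.
by rewrite !E half_action_circle // bivector_circle // invrN mulrN !mulNr opprK.
Qed.

Local Notation circ t := (pt (cos t) (sin t)).

Lemma dot_circle (t : R) : dot (circ t) (circ t) = 1.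
Proof. by rewrite /dot !pt0 !pt1 -!expr2 cos2Dsin2. Qed.

Section ParallelOnCircle.
Variables (c : bool) (S : 'I_m.+1 -> R -> R -> R).
Hypothesis Sc : forall k, continuous (fun p : R * R => S k p.1 p.2).
Hypothesis Sx : forall k (x y : R), is_derive x 1 ((S k)^~ y)
      (\sum_j c0 c k j (pt x y) * S j x y).
Hypothesis Sy : forall k (x y : R), is_derive y 1 (S k x)
      (\sum_j c1 c k j (pt x y) * S j x y).

Lemma parallel_circle k (t : R) : is_derive t 1 (fun t => S k (cos t) (sin t))
  (\sum_j (c0 c k j (circ t) * - (circ t) 0 1 + c1 c k j (circ t) * (circ t) 0 0) *
     S j (cos t) (sin t)).
Proof.
have c0c j : continuous (fun p : R * R => c0 c k j (pt p.1 p.2)).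
  by apply: joint_pt; case: (Ck_conn0 a_smooth biv_neq0 rho 0 c k j).
have D := der_curve (f := S k)
  (fx := fun x y => \sum_j c0 c k j (pt x y) * S j x y) _
  (fun x y => Sx k x y) (Sy k (cos t) (sin t)) (is_derive_cos t) (is_derive_sin t).
apply: der_eq (D _) _.
  by move=> p; apply: cont_sum => j; exact: contM (@c0c j p) (@Sc j p).
rewrite !mulr_suml -big_split; apply: eq_bigr => j _ /=.
by rewrite pt0 pt1; ring.
Qed.

End ParallelOnCircle.

Lemma circ_continuous : continuous (fun t : R => circ t).
Proof.
move=> t; have h : {for t, continuous (fun t : R => (cos t, sin t))}.
  by apply: (@cvg_pair _ _ _ (nbhs t) (nbhs (cos t)) (nbhs (sin t)));
    [exact: continuous_cos|exact: continuous_sin].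
exact: continuous_comp h (@pt_continuous R (cos t, sin t)).
Qed.

Lemma parallel_agree_circle (S : bool -> 'I_m.+1 -> R -> R -> R) :
  (forall c k, continuous (fun p : R * R => S c k p.1 p.2)) ->
  (forall c k (x y : R), is_derive x 1 ((S c k)^~ y)
      (\sum_j c0 c k j (pt x y) * S c j x y)) ->
  (forall c k (x y : R), is_derive y 1 (S c k x)
      (\sum_j c1 c k j (pt x y) * S c j x y)) ->
  (forall k, S true k 1 0 = S false k 1 0) ->
  forall k t, S true k (cos t) (sin t) = S false k (cos t) (sin t).
Proof.
move=> Sc Sx Sy S0 k t; apply/eqP; rewrite -subr_eq0; apply/eqP.
apply: (@ode_unique _ _ (fun k j t => c0 true k j (circ t) * - (circ t) 0 1 +
    c1 true k j (circ t) * (circ t) 0 0)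
  (fun k t => S true k (cos t) (sin t) - S false k (cos t) (sin t)) 0).
- move=> i j {}t.
  have [h _] : Ck 0 (fun u => c0 true i j u * (-1 * u 0 1) + c1 true i j u * u 0 0).
    apply: CkD; apply: CkM; try exact: (CkZ (-1) (Ck_coord R 0 1)).
    - exact: Ck_conn0.
    - exact: Ck_conn1.
    - exact: Ck_coord.
  have := continuous_comp (@circ_continuous t) (h (circ t)).
  rewrite (_ : (_ \o _) = fun t => c0 true i j (circ t) * - (circ t) 0 1 +
    c1 true i j (circ t) * (circ t) 0 0) //.
  by apply/funext => t' /=; rewrite mulN1r.
- move=> {}t i; have Dt := parallel_circle (@Sc true) (@Sx true) (@Sy true) i t.
  have Df := parallel_circle (@Sc false) (@Sx false) (@Sy false) i t.
  apply: der_eq (derB Dt Df) _; rewrite -sumrB; apply: eq_bigr => j _.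
  by rewrite (connection_circle _ _ (dot_circle t)) mulrBr.
- by move=> i; rewrite cos0 sin0 S0 subrr.
Qed.

End UnitCircle.

(** * The obstruction on the sphere *)

(** Otherwise the parallel sections with a suitable initial value would give a
    vector field on the sphere without zeros, with components Z in the
    charts. *)
Lemma bivector_has_zero (R : realType) (g : lmodType R) (br : g -> g -> g)
    (phi : g -> endo (Csphere R)) (a : g -> bool -> 'I_2 -> 'rV[R]_2 -> R)
    (s : seq (g * g)) (m : nat) (e : 'I_m.+1 -> g) (co : 'I_m.+1 -> g -> R^o) :
  lie_bracket br -> lie_hom br phi -> (forall z c i, smooth (a z c i)) ->
  (forall z (f : Csphere R) c x,
    phi z f (stereo c x) = \sum_i a z c i x * partial i (f \o stereo c) x) ->
  flip (gsum br s) = - gsum br s -> cybe br s ->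
  (forall k, linear (co k)) -> (forall v, \sum_k co k v *: e k = v) ->
  ~ (forall c x, bivector a s c 0 1 x != 0).
Proof.
move=> hbr hphi a_smooth aE sN sC co_linear coE biv_neq0.
have hrho := adm_hom hbr co_linear coE.
pose u1 : 'rV[R]_2 := pt 1 0.
have u11 : dot u1 u1 = 1 by rewrite /dot !pt0 !pt1 mulr1 mulr0 addr0.
(* Since the bivector field does not vanish at u1, the vector fields of g do
   not all vanish there. *)
have [w w0] : exists w, a w true 0 u1 != 0.
  apply: contrapT => nw; have := biv_neq0 true u1.
  rewrite /bivector big1 ?eqxx // => p _.
  have [->|a0] := eqVneq (a p.1 true 0 u1) 0; first by rewrite mul0r.
  by case: nw; exists p.1.
have /choice [S SP] := fun c => parallel_transport hphi a_smooth aE sN sC biv_neq0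
  hrho c (fun k => co k w).
have S10 c k : S c k 1 0 = co k w by have [-> _ _ _] := SP c.
have Sc c : forall k, continuous (fun p : R * R => S c k p.1 p.2) by have [_ ? _ _] := SP c.
have Sx c : forall k (x y : R), is_derive x 1 ((S c k)^~ y)
    (\sum_j conn0 a s (adm br e co) c k j (pt x y) * S c j x y) by have [_ _ ? _] := SP c.
have Sy c : forall k (x y : R), is_derive y 1 (S c k x)
    (\sum_j conn1 a s (adm br e co) c k j (pt x y) * S c j x y) by have [_ _ _ ?] := SP c.
pose Z c i x y := field a e c (S c) i x y.
have Zc c i : continuous (fun p : R * R => Z c i p.1 p.2).
  by apply: field_joint => //; exact: Sc.
have Zw c i : Z c i 1 0 = a w c i u1.
  rewrite /Z (field_coef hphi aE); congr (a _ c i _).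
  by rewrite -[RHS]coE; apply: eq_bigr => j _; rewrite S10.
have Z10 c : ~ (forall i, Z c i 1 0 = 0).
  case: c => Z0; first by move: w0; rewrite -Zw Z0 eqxx.
  have := Z0 1; have := Z0 0; rewrite !Zw !(vcoef_circle aE _ _ u11) pt0 pt1.
  by move=> h0 _; move/eqP: w0; apply; lra.
have Zn c x y : 0 < Z c 0 x y ^+ 2 + Z c 1 x y ^+ 2.
  rewrite lt0r addr_ge0 ?sqr_ge0 // andbT paddr_eq0 ?sqr_ge0 // !sqrf_eq0.
  apply/negP => /andP[/eqP z0 /eqP z1]; apply: (Z10 c).
  apply: (field_zero hbr hphi a_smooth aE sN biv_neq0 co_linear coE (Sx c) (Sy c)).
  exact: ord2P z0 z1.
have Sf := parallel_agree_circle hphi a_smooth aE sN biv_neq0 (rho := adm br e co) Sc Sx Sy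
  (fun k => etrans (S10 true k) (esym (S10 false k))).
have Zcirc i (t : R) : Z false i (cos t) (sin t) = Z true i (cos t) (sin t) -
    2 * (Z true 0 (cos t) (sin t) * cos t + Z true 1 (cos t) (sin t) * sin t) *
    pt (cos t) (sin t) 0 i.
  have E : \sum_j S false j (cos t) (sin t) *: e j = \sum_j S true j (cos t) (sin t) *: e j.
    by apply: eq_bigr => j _; rewrite Sf.
  rewrite /Z !(field_coef hphi aE) E (vcoef_circle aE _ _ (dot_circle t)).
  by rewrite pt0 pt1.
(* For the complex numbers Z true = z and u, the product of the two charts is z
   (z - 2 (z . u) u) = - |z|^2 u^2 when |u| = 1. *)
apply: (@no_disc_extension R
  (fun x y => Z true 0 x y * Z false 0 x y - Z true 1 x y * Z false 1 x y)
  (fun x y => Z true 0 x y * Z false 1 x y + Z true 1 x y * Z false 0 x y)).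
- move=> p; exact: contB (contM (@Zc true 0 p) (@Zc false 0 p))
    (contM (@Zc true 1 p) (@Zc false 1 p)).
- move=> p; exact: contD (contM (@Zc true 0 p) (@Zc false 1 p))
    (contM (@Zc true 1 p) (@Zc false 0 p)).
- move=> x y _; rewrite (_ : _ + _ = (Z true 0 x y ^+ 2 + Z true 1 x y ^+ 2) *
    (Z false 0 x y ^+ 2 + Z false 1 x y ^+ 2)); last by ring.
  by apply: mulr_gt0.
move=> t; exists (Z true 0 (cos t) (sin t) ^+ 2 + Z true 1 (cos t) (sin t) ^+ 2) => //.
rewrite !Zcirc pt0 pt1; have := cos2Dsin2 t; rewrite cosD sinD.
move: (cos t) (sin t) (Z true 0 _ _) (Z true 1 _ _) => u v z0 z1 uv; split.
  rewrite [LHS](_ : _ = z0 ^+ 2 * (u ^+ 2 + v ^+ 2 - 2 * u ^+ 2) -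
    z1 ^+ 2 * (u ^+ 2 + v ^+ 2 - 2 * v ^+ 2)
    + (z0 ^+ 2 - z1 ^+ 2) * (1 - (u ^+ 2 + v ^+ 2))); last by ring.
  by rewrite [in X in _ + X]uv; ring.
rewrite [LHS](_ : _ = - (z0 ^+ 2 + z1 ^+ 2) * (u * v + v * u)
  + 2 * z0 * z1 * (1 - (u ^+ 2 + v ^+ 2))); last by ring.
by rewrite uv; ring.
Qed.

Theorem corollary3p12 (R : realType) (omega : symplectic_form R)
    (star : (nat -> Csphere R) -> (nat -> Csphere R) -> (nat -> Csphere R))
    (hstar : star_product star) (hquant : quantizes omega star)
    (g : vectType R) (br : g -> g -> g) (hbr : lie_bracket br)
    (F : nat -> tensor (uea br) (uea br)) (hF : twist F) :
  ~ induced_by F star.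
Proof.
case=> phi [hphi hvf [Finv [FFinv _ starE]]].
have [s [sE sN sC]] := twist_rmatrix hF.
have /choice [a aP] := hvf.
have a_smooth z c i : smooth (a z c i) by have [h _] := aP z.
have aE z (f : Csphere R) c x : phi z f (stereo c x) =
    \sum_i a z c i x * partial i (f \o stereo c) x by have [_ h] := aP z.
have [m [e [co [co_linear coE]]]] := exists_coordinates g.
apply: (bivector_has_zero hbr hphi a_smooth aE sN sC co_linear coE) => c x.
apply: (bivector_neq0 hphi aE sN (om := omega)) => f h.
rewrite -hquant (star_commutator hphi hF FFinv starE _ _ sE).
by [].
Qed.
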